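(* Assume $\alpha\ge\alpha_m$ and $\varepsilon\ge\hat\varepsilon_\alpha$. Then $\mathscr H_\varepsilon$ admits a minimiser $u\in N_\alpha$ which satisfies $0<u'(x)<v_\alpha'(x)$ for all $x\in(0,1)$ and $v_\alpha(x)<u(x)<\alpha$ for all $x\in(-1,1)$. The function $u$ belongs to $C^\infty([-1,1])$ and solves the Dirichlet problem $$\frac{1}{u\sqrt{1+u'^2}}\frac{d}{dx}\Bigl(\frac{u}{\sqrt{1+u'^2}}H'\Bigr)+\frac12 H\Bigl(\frac{u''}{(1+u'^2)^{3/2}}+\frac{1}{u\sqrt{1+u'^2}}\Bigr)^2-2\varepsilon H=0 \text{ in }(-1,1),\quad u(\pm1)=\alpha,\ u'(\pm1)=0.$$ Furthermore there is a constant $c\in\mathbb R$ such that for all $x\in[-1,1]$ $$\frac{u(x)u'(x)H'(x)}{1+u'(x)^2}+\frac{u(x)H(x)^2}{\sqrt{1+u'(x)^2}}-\frac{H(x)}{1+u'(x)^2}-\varepsilon\frac{u(x)}{\sqrt{1+u'(x)^2}}=c.$$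
   Context: $H:=\frac12\bigl(\frac{1}{u\sqrt{1+u'^2}}-\frac{u''}{(1+u'^2)^{3/2}}\bigr)$. $N_\alpha:=\{u\in H^2(-1,1): u \text{ even},\ u>0 \text{ on }[-1,1],\ u(\pm1)=\alpha,\ u'(\pm1)=0\}$; $\mathscr A(u)=2\pi\int_{-1}^1u\sqrt{1+u'^2}\,dx$, $\mathscr W(u)=\frac\pi2\int_{-1}^1(\frac{1}{u\sqrt{1+u'^2}}-\frac{u''}{(1+u'^2)^{3/2}})^2u\sqrt{1+u'^2}\,dx$, $\mathscr H_\varepsilon=\mathscr W+\varepsilon\mathscr A$. Let $c_0\approx0.8336$ be the positive solution of $c=\tanh(1/c)$ and $\alpha_0:=c_0\cosh(1/c_0)$; for $\alpha>\alpha_0$ the equation $c\cosh(1/c)=\alpha$ has exactly two positive solutions, and $c_\alpha$ denotes the larger one ($c_\alpha>c_0$). Set $v_\alpha(x):=c_\alpha\cosh(x/c_\alpha)$ and $\hat\varepsilon_\alpha:=\frac{1}{4c_\alpha^2}$. Let $c_m$ be the unique positive solution of $\frac2c=1+e^{-2/c}$ and $\alpha_m:=c_m\cosh(1/c_m)$ ($\approx1.895$, and $\alpha_m>\alpha_0$). *)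

(* Defs.v *)
From HB Require Import structures.
From mathcomp Require Import all_boot all_order all_algebra.
From mathcomp Require Import all_classical all_reals all_analysis.
Set Implicit Arguments. Unset Strict Implicit. Unset Printing Implicit Defensive.
Import Order.TTheory GRing.Theory Num.Theory.
Import numFieldNormedType.Exports.
Local Open Scope classical_set_scope.
Local Open Scope ring_scope.

Section Defs.
Variable R : realType.
Notation mu := (@lebesgue_measure R).

Definition Icc (a b : R) : set R := `[a, b].

Definition cosh (x : R) : R := (expR x + expR (- x)) / 2.

Definition vcat (c : R) (x : R) : R := c * cosh (x / c).

(* pointwise mean-curvature expression H from values (u, u', u'') *)
Definition Hexpr (u u1 u2 : R) : R :=
  2^-1 * (1 / (u * Num.sqrt (1 + u1 ^+ 2)) - u2 / (Num.sqrt (1 + u1 ^+ 2)) ^+ 3).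

(* u belongs to H^2(-1,1) (continuous representative u on [-1,1]) with
   first weak derivative u1 and second weak derivative u2:
   u and u1 are absolutely continuous on [-1,1] with u' = u1, u1' = u2 a.e.,
   and u2 in L^2(-1,1). *)
Definition isH2 (u u1 u2 : R -> R) : Prop :=
  mu.-integrable (Icc (-1) 1) (EFin \o u2) /\
  mu.-integrable (Icc (-1) 1) (EFin \o (fun x => u2 x ^+ 2)) /\
  mu.-integrable (Icc (-1) 1) (EFin \o u1) /\
  (forall x, -1 <= x <= 1 ->
     ((u1 x - u1 (-1))%:E = \int[mu]_(t in Icc (-1) x) (u2 t)%:E)%E) /\
  (forall x, -1 <= x <= 1 ->
     ((u x - u (-1))%:E = \int[mu]_(t in Icc (-1) x) (u1 t)%:E)%E).

Definition inN (alpha : R) (u u1 u2 : R -> R) : Prop :=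
  isH2 u u1 u2 /\
  (forall x, -1 <= x <= 1 -> u (- x) = u x) /\
  (forall x, -1 <= x <= 1 -> 0 < u x) /\
  u (-1) = alpha /\ u 1 = alpha /\ u1 (-1) = 0 /\ u1 1 = 0.

Definition areaA (u u1 : R -> R) : \bar R :=
  ((2 * pi)%:E * \int[mu]_(x in Icc (-1) 1) (u x * Num.sqrt (1 + u1 x ^+ 2))%:E)%E.

Definition willW (u u1 u2 : R -> R) : \bar R :=
  ((pi / 2)%:E * \int[mu]_(x in Icc (-1) 1)
     (((1 / (u x * Num.sqrt (1 + u1 x ^+ 2)) - u2 x / (Num.sqrt (1 + u1 x ^+ 2)) ^+ 3) ^+ 2)
       * u x * Num.sqrt (1 + u1 x ^+ 2))%:E)%E.

Definition helfH (eps : R) (u u1 u2 : R -> R) : \bar R :=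
  (willW u u1 u2 + eps%:E * areaA u u1)%E.

Definition smooth (U : R -> R) : Prop :=
  forall (n : nat) (x : R), derivable (derive1n n U) x 1.

End Defs.

(* Main.v *)
Require Import Defs.
From HB Require Import structures.
From mathcomp Require Import all_boot all_order all_algebra.
From mathcomp Require Import all_classical all_reals all_analysis.
From mathcomp Require Import measurable_realfun ring lra.
Import Order.TTheory GRing.Theory Num.Theory.
Import numFieldNormedType.Exports.
Set Implicit Arguments. Unset Strict Implicit. Unset Printing Implicit Defensive.
Local Open Scope classical_set_scope.
Local Open Scope ring_scope.

(**
By evenness the functional is pi/2 times the sum of the energies of the two halves of the graph, so
it suffices to minimise over profiles on [0, 1] with horizontal ends; there the cross term of the
squared mean curvature integrates to zero and the Lagrangian is convex in u''.

A competitor whose slope exceeds that of the catenary v_alpha is last tangent, at some x1, to a leaf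
of the foliation by the catenaries c cosh(x/c).  Replacing it on [0, x1] by this leaf kills the
Willmore energy there, and does not increase the area: inside the foliated cone this is the
calibration by the unit normal field of the leaves, outside the cone the comparison is with the disc,
and alpha >= alpha_m says exactly that the catenary beats the disc.  Then u' may be replaced by its
positive part, because z |-> 1/z + 4 eps z is nondecreasing for z >= c_alpha when
eps >= 1/(4 c_alpha^2).  So one may minimise under the constraint 0 <= u' <= v_alpha', where the
direct method applies, and the constrained minimiser is an unconstrained one.

Its Euler-Lagrange equation is a first order system, polynomial in u, u', the two momenta, 1/u and
1/sqrt(1+u'^2), hence the minimiser is smooth up to the boundary and Borel's lemma extends it to R.
The Hamiltonian of the system is four times the first integral.  If x1 > 0 for the minimiser itself,
its mean curvature H vanishes on an interval; (H, u H'/sqrt(1+u'^2)) solves a linear system, so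
H = 0 up to x = 1, where u'' > 0 contradicts u'(1) = 0 <= u'.  If u' vanishes at an interior point,
conservation of the Hamiltonian forces u to be constant near 0, hence equal to the radius
1/(2 sqrt eps) <= c_alpha of the stationary cylinder, contradicting u(0) > c_alpha.
*)

(** * Continuity and integrals on compact intervals *)

(** The obstacle is coercivity: the coefficient of u''^2 in the Lagrangian is u / (1 + u'^2)^(5/2),
    so the energy controls u'' in L^2 only where u is bounded below and u' is bounded. The
    constraint 0 <= u' <= v_alpha' supplies both bounds. The two replacements must come in the given
    order: taking the positive part of u' lowers u, which is harmless only once the inserted
    catenary keeps u above v_alpha >= c_alpha. No weak topology enters: members of a minimising
    sequence with uniformly close slopes are close in L^2 for u'' by convexity, so a fast
    subsequence converges almost everywhere and Fatou's lemma passes to the limit. As the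
    constrained minimiser is an unconstrained one, two-sided variations are allowed and give an
    equation, in integrated form; solving it algebraically for u'' shows that u'' is continuous. The
    number t = 1/c_m satisfies 2t = 1 + exp(-2t), that is t + sinh t cosh t = cosh^2 t: the catenoid
    from parameter 0 to t and the disc spanning its end circle have equal area. *)

Section Toolkit.
Context {R : realType}.
Notation mu := (@lebesgue_measure R).
Implicit Types (a b c x y : R) (f g F G : R -> R).

Definition cont a b f := {within `[a, b], continuous f}.
Definition intg a b f := mu.-integrable `[a, b] (EFin \o f).
(** For b < a the interval is empty and this is 0; it is not the oriented integral. *)
Definition rint a b f : R := \int[mu]_(x in `[a, b]) f x.

Lemma contP a b f : cont a b f <->
  forall x, a <= x <= b -> f y @[y --> within `[a, b] (nbhs x)] --> f x.
Proof.
split.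
  move=> /subspace_continuousP h x xab; apply: h.
  by rewrite /= in_itv.
move=> h; apply/subspace_continuousP => x; rewrite /= in_itv/= => /h.
exact.
Qed.

Lemma cont_cst a b k : cont a b (fun=> k).
Proof. by apply/contP => x _; exact: cvg_cst. Qed.

Lemma cont_id a b : cont a b id.
Proof. by apply/contP => x _; apply: cvg_within_filter; exact: cvg_id. Qed.

Lemma contD a b f g : cont a b f -> cont a b g -> cont a b (fun x => f x + g x).
Proof. by move=> /contP cf /contP cg; apply/contP => x xab; apply: cvgD; [exact: cf|exact: cg]. Qed.

Lemma contN a b f : cont a b f -> cont a b (fun x => - f x).
Proof. by move=> /contP cf; apply/contP => x xab; apply: cvgN; exact: cf. Qed.

Lemma contB a b f g : cont a b f -> cont a b g -> cont a b (fun x => f x - g x).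
Proof. by move=> cf /contN cg; exact: contD. Qed.

Lemma contM a b f g : cont a b f -> cont a b g -> cont a b (fun x => f x * g x).
Proof. by move=> /contP cf /contP cg; apply/contP => x xab; apply: cvgM; [exact: cf|exact: cg]. Qed.

Lemma contX a b f n : cont a b f -> cont a b (fun x => f x ^+ n).
Proof.
move=> cf; elim: n => [|n ih]; first exact: cont_cst.
by under eq_fun do rewrite exprS; exact: contM.
Qed.

Lemma contV a b f : (forall x, a <= x <= b -> f x != 0) -> cont a b f ->
  cont a b (fun x => (f x)^-1).
Proof.
by move=> f0 /contP cf; apply/contP => x xab; apply: cvgV; [exact: f0|exact: cf].
Qed.

Lemma cont_comp a b f (phi : R -> R) : (forall x, a <= x <= b -> {for f x, continuous phi}) ->
  cont a b f -> cont a b (fun x => phi (f x)).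
Proof.
move=> cp /contP cf; apply/contP => x xab.
by apply: (cvg_comp _ _ (cf x xab)); exact: cp.
Qed.

Lemma cont_sqrt a b f : cont a b f -> cont a b (fun x => Num.sqrt (f x)).
Proof. by move=> cf; apply: cont_comp cf => x _; exact: sqrt_continuous. Qed.

Lemma cont_eq a b f g : (forall x, a <= x <= b -> f x = g x) -> cont a b f -> cont a b g.
Proof.
move=> fg /contP cf; apply/contP => x xab; rewrite -fg//.
apply: cvg_trans (cf x xab); apply: near_eq_cvg.
rewrite near_withinE; near=> y => /=; rewrite in_itv/= => yab; exact: fg.
Unshelve. all: by end_near. Qed.

Lemma cont_sub a b c d f : a <= c -> d <= b -> cont a b f -> cont c d f.
Proof.
move=> ac db; apply: continuous_subspaceW => x /=.
rewrite !in_itv/= => /andP[cx xd]; apply/andP; split; lra.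
Qed.

Lemma continuous_cont a b f : continuous f -> cont a b f.
Proof. exact: continuous_subspaceT. Qed.

Lemma cont_for a b x f : cont a b f -> a < x < b -> {for x, continuous f}.
Proof.
move=> cf xab.
have ab : a < b by lra.
have xi : x \in `]a, b[ by rewrite in_itv.
exact: (within_continuous_continuous ab cf xi).
Qed.

Lemma cont_intg a b f : cont a b f -> intg a b f.
Proof. by move=> cf; apply: continuous_compact_integrable => //; exact: segment_compact. Qed.

Lemma intg_meas a b f : intg a b f -> measurable_fun `[a, b] f.
Proof. by case/integrableP => /measurable_EFinP. Qed.

Lemma cont_meas a b f : cont a b f -> measurable_fun `[a, b] f.
Proof. by move/cont_intg/intg_meas. Qed.

Lemma intg_le a b f g : measurable_fun `[a, b] f -> intg a b g ->
  (forall x, a <= x <= b -> `|f x| <= g x) -> intg a b f.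
Proof.
move=> mf ig fg; apply: le_integrable ig => //; first exact/measurable_EFinP.
move=> x /=; rewrite in_itv/= => xab; rewrite lee_fin.
by rewrite (le_trans (fg _ xab))// ler_norm.
Qed.

Lemma intgD a b f g : intg a b f -> intg a b g -> intg a b (fun x => f x + g x).
Proof.
move=> jf jg; rewrite /intg (_ : _ \o _ = (EFin \o f) \+ (EFin \o g))%E//.
exact: integrableD.
Qed.

Lemma intgZ a b k f : intg a b f -> intg a b (fun x => k * f x).
Proof.
move=> jf; rewrite /intg (_ : _ \o _ = (fun x => k%:E * (EFin \o f) x))%E//.
exact: integrableZl.
Qed.

Lemma intgN a b f : intg a b f -> intg a b (fun x => - f x).
Proof. by move=> /(intgZ (-1)); under eq_fun do rewrite mulN1r. Qed.

Lemma intgB a b f g : intg a b f -> intg a b g -> intg a b (fun x => f x - g x).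
Proof. by move=> jf /intgN jg; exact: intgD. Qed.

Lemma intg_abs a b f : intg a b f -> intg a b (fun x => `|f x|).
Proof. by move=> jf; have := integrable_abse jf; rewrite /intg /comp. Qed.

Lemma intg_cst a b k : intg a b (fun=> k).
Proof. by apply: cont_intg; exact: cont_cst. Qed.

Lemma intg_sub a b c d f : a <= c -> d <= b -> intg a b f -> intg c d f.
Proof.
move=> ac db; apply: integrableS => //.
move=> x /=; rewrite !in_itv/= => /andP[cx xd]; apply/andP; split; lra.
Qed.

Lemma intg_eq a b f g : (forall x, a <= x <= b -> f x = g x) -> intg a b f -> intg a b g.
Proof.
move=> fg; apply: eq_integrable => // x; rewrite inE/= in_itv/= => xab.
by rewrite /= fg.
Qed.

Lemma intg_bdM a b f g (K : R) : measurable_fun `[a, b] f -> (forall x, a <= x <= b -> `|f x| <= K) ->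
  intg a b g -> intg a b (fun x => f x * g x).
Proof.
move=> mf fK ig; apply: (@intg_le _ _ _ (fun x => K * `|g x|)).
- by apply: measurable_funM => //; exact: intg_meas ig.
- by apply: intgZ; exact: intg_abs.
- by move=> x xab; rewrite normrM ler_wpM2r// fK.
Qed.

Lemma cont_bounded a b f : cont a b f -> exists2 K : R, 0 < K & forall x, a <= x <= b -> `|f x| <= K.
Proof.
move=> cf; have [ba|ab] := ltP b a.
  by exists 1 => // x /andP[? ?]; lra.
have /(EVT_max ab)[c _ h] : cont a b (fun x => `|f x|).
  by apply: cont_comp cf => x _; exact: norm_continuous.
exists (`|f c| + 1) => [|x xab]; first by rewrite ltr_wpDl.
by rewrite (le_trans (h x _)) ?in_itv//= lerDl.
Qed.

Lemma intg_contM a b f g : cont a b f -> intg a b g -> intg a b (fun x => f x * g x).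
Proof.
move=> cf ig; have [K _ fK] := cont_bounded cf.
by apply: intg_bdM fK ig; exact: cont_meas.
Qed.

Lemma rintD a b f g : intg a b f -> intg a b g ->
  rint a b (fun x => f x + g x) = rint a b f + rint a b g.
Proof. by move=> jf jg; exact: RintegralD. Qed.

Lemma rintB a b f g : intg a b f -> intg a b g ->
  rint a b (fun x => f x - g x) = rint a b f - rint a b g.
Proof. by move=> jf jg; exact: RintegralB. Qed.

Lemma rintZ a b k f : intg a b f -> rint a b (fun x => k * f x) = k * rint a b f.
Proof. by move=> jf; exact: RintegralZl. Qed.

Lemma rintN a b f : intg a b f -> rint a b (fun x => - f x) = - rint a b f.
Proof.
move=> jf; rewrite -mulN1r -rintZ//; congr rint; apply/funext => x.
by rewrite mulN1r.
Qed.

Lemma rint_le a b f g : intg a b f -> intg a b g ->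
  (forall x, a <= x <= b -> f x <= g x) -> rint a b f <= rint a b g.
Proof.
move=> jf jg fg; apply: le_Rintegral => // x /=; rewrite in_itv/=; exact: fg.
Qed.

Lemma rint_eq a b f g : (forall x, a <= x <= b -> f x = g x) -> rint a b f = rint a b g.
Proof. by move=> fg; apply: eq_Rintegral => x; rewrite inE/= in_itv/=; exact: fg. Qed.

Lemma rint_ge0 a b f : (forall x, a <= x <= b -> 0 <= f x) -> 0 <= rint a b f.
Proof. by move=> f0; apply: Rintegral_ge0 => x /=; rewrite in_itv/=; exact: f0. Qed.

Lemma rint_abs a b f : intg a b f -> `|rint a b f| <= rint a b (fun x => `|f x|).
Proof. by move=> jf; exact: le_normr_Rintegral. Qed.

Lemma rint_same a f : rint a a f = 0.
Proof. by rewrite /rint set_itv1 Rintegral_set1. Qed.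

Lemma rint_chasles a b c f : a <= b -> b <= c -> intg a c f ->
  rint a c f = rint a b f + rint b c f.
Proof.
move=> ab bc jf.
have jab : intg a b f by apply: intg_sub jf.
have jbc : intg b c f by apply: intg_sub jf.
have := @Rintegral_itvB R f (BLeft a) (BRight c) b.
rewrite /= !bnd_simp => /(_ jf ab bc) h.
rewrite /rint -[X in _ = _ + X]Rintegral_itv_obnd_cbnd; last first.
  by apply: integrableS jbc => //; apply: subset_itvr; rewrite bnd_simp.
by rewrite -h addrC subrK.
Qed.

Lemma rint_cst a b k : a <= b -> rint a b (fun=> k) = k * (b - a).
Proof.
move=> ab; rewrite /rint Rintegral_cst//= lebesgue_measure_itv/= lte_fin.
by move: ab; rewrite le_eqVlt => /predU1P[->|->]//; rewrite ltxx subrr.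
Qed.

Lemma rintE a b f : intg a b f -> (rint a b f)%:E = (\int[mu]_(x in `[a, b]) (f x)%:E)%E.
Proof. by move=> jf; rewrite /rint /Rintegral fineK//; exact: integrable_fin_num. Qed.

Lemma rint_dom a b (F : nat -> R -> R) f g : (forall n, measurable_fun `[a, b] (F n)) ->
  (forall x, a <= x <= b -> F n x @[n --> \oo] --> f x) -> intg a b g ->
  (forall n x, a <= x <= b -> `|F n x| <= g x) ->
  intg a b f /\ rint a b (F n) @[n --> \oo] --> rint a b f.
Proof.
move=> mF Ff jg Fg.
have mf : measurable_fun `[a, b] f.
  by apply: measurable_fun_cvg mF _ => x /=; rewrite in_itv/=; exact: Ff.
have [] := @dominated_convergence _ _ _ mu `[a, b] _ (fun n x => (F n x)%:E)
  (fun x => (f x)%:E) (EFin \o g) _ _ _ jg _ => //.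
- by move=> n; apply/measurable_EFinP; exact: mF.
- exact/measurable_EFinP.
- apply/aeW => x /=; rewrite in_itv/= => xab.
  by apply: cvg_EFin; [exact: nearW|exact: Ff].
- by apply/aeW => x n /=; rewrite in_itv/= => xab; rewrite lee_fin Fg.
move=> jf _ c; split=> //.
apply: fine_cvg; rewrite /rint /Rintegral fineK//.
exact: integrable_fin_num.
Qed.

Lemma rint_cont a b f : intg a b f -> cont a b (fun x => rint a x f).
Proof.
have [ba|ab] := ltP b a.
  by move=> _; apply/contP => x /andP[? ?]; lra.
by move=> jf; exact: parameterized_integral_continuous.
Qed.

Lemma near_oo a b x : a < x < b -> \near x, a < x < b.
Proof.
move=> xab; have xi : x \in `]a, b[ by rewrite in_itv.
by have := near_in_itvoo xi; apply: filterS => z; rewrite in_itv.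
Qed.

Definition isd f x (df : R) : Prop := is_derive (x : R) (1 : R) f df.

Lemma rint_derive a b f x : intg a b f -> a < x < b -> {for x, continuous f} ->
  isd (fun y => rint a y f) x (f x).
Proof.
move=> jf /andP[ax xb] cf.
have [df dE] := continuous_FTC1_closed xb jf ax cf.
by split; [exact: df|rewrite -derive1E; exact: dE].
Qed.

Lemma rint_FTC a b f F : a <= b -> cont a b f -> cont a b F ->
  (forall x, a < x < b -> isd F x (f x)) -> rint a b f = F b - F a.
Proof.
rewrite le_eqVlt => /predU1P[<-|ab cf cF dF]; first by rewrite rint_same subrr.
have /= := @continuous_FTC2 R f F a b ab cf.
rewrite -EFinB -rintE; last exact: cont_intg.
move=> h; apply: EFin_inj; apply: h.
  have [_ h1 h2] := (continuous_within_itvP F ab).1 cF; split => // x.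
  by rewrite in_itv/= => /dF [].
move=> x; rewrite in_itv/= => /dF [_ <-].
by rewrite derive1E.
Qed.

Lemma derivable_isd f x : derivable f x 1 -> isd f x (derive1 f x).
Proof. by move=> df; split => //; rewrite derive1E. Qed.

Lemma isd_derivable f x df : isd f x df -> derivable f x 1.
Proof. by case. Qed.

Lemma isd_derive1 f x df : isd f x df -> derive1 f x = df.
Proof. by case=> _ <-; rewrite derive1E. Qed.

(** Lets [der] produce a derivative in raw form, which [field] or [ring] then identifies with the
    expected one. *)
Lemma isd_eq f x (df dg : R) : isd f x df -> df = dg -> isd f x dg.
Proof. by move=> h <-. Qed.

Lemma isd_cst k x : isd (fun=> k) x 0.
Proof. exact: is_derive_cst. Qed.

Lemma isd_id x : isd (fun y => y) x 1.
Proof. exact: is_derive_id. Qed.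

Lemma isdD f g x (df dg : R) : isd f x df -> isd g x dg -> isd (fun y => f y + g y) x (df + dg).
Proof. exact: is_deriveD. Qed.

Lemma isdN f x (df : R) : isd f x df -> isd (fun y => - f y) x (- df).
Proof. exact: is_deriveN. Qed.

Lemma isdM f g x (df dg : R) : isd f x df -> isd g x dg ->
  isd (fun y => f y * g y) x (df * g x + f x * dg).
Proof.
move=> hf hg; apply: isd_eq (is_deriveM hf hg) _.
by rewrite /GRing.scale/= addrC [df * _]mulrC.
Qed.

Lemma isdX f n x (df : R) : isd f x df -> isd (fun y => f y ^+ n) x (n%:R * f x ^+ n.-1 * df).
Proof.
move=> hf; have := is_deriveX n hf.
by rewrite (_ : f ^+ n = (fun y => f y ^+ n))//; apply/funext => y; rewrite exprfctE.
Qed.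

Lemma isdV f x (df : R) : f x != 0 -> isd f x df -> isd (fun y => (f y)^-1) x (- df / f x ^+ 2).
Proof.
move=> f0 hf; apply: isd_eq (is_deriveV f0 hf) _.
by rewrite /GRing.scale/= mulNr mulrC mulNr.
Qed.

Lemma isd_comp f g x (df dg : R) : isd f (g x) df -> isd g x dg -> isd (fun y => f (g y)) x (df * dg).
Proof. by move=> hf hg; exact: (is_derive1_comp hf hg). Qed.

Lemma isd_sqrt f x (df : R) : 0 < f x -> isd f x df ->
  isd (fun y => Num.sqrt (f y)) x (df / (2 * Num.sqrt (f x))).
Proof.
move=> f0 hf; apply: isd_eq (isd_comp (is_derive1_sqrt f0) hf) _.
by rewrite mulrC.
Qed.

Lemma isd_exp f x (df : R) : isd f x df -> isd (fun y => expR (f y)) x (expR (f x) * df).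
Proof. by move=> hf; exact: (isd_comp (is_derive_expR _) hf). Qed.

Lemma isd_near f g x (df : R) : (\near x, f x = g x) -> isd f x df -> isd g x df.
Proof. exact: near_eq_is_derive. Qed.

End Toolkit.

(** Differentiates by the shape of the expression, taking derivatives of opaque functions from the
    context; nonvanishing and positivity conditions are left as goals. *)
Ltac der := lazymatch goal with
  | |- isd (fun y => y) _ _ => exact: isd_id
  | |- isd (fun _ => ?c) _ _ => exact: isd_cst
  | |- isd (fun y => @?F y + @?G y) _ _ => apply: (@isdD _ F G); [der|der]
  | |- isd (fun y => - (@?F y)) _ _ => apply: (@isdN _ F); der
  | |- isd (fun y => @?F y * @?G y) _ _ => apply: (@isdM _ F G); [der|der]
  | |- isd (fun y => @?F y ^+ ?n) _ _ => apply: (@isdX _ F n); der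
  | |- isd (fun y => (@?F y)^-1) _ _ => apply: (@isdV _ F); [|der]
  | |- isd (fun y => Num.sqrt (@?F y)) _ _ => apply: (@isd_sqrt _ F); [|der]
  | |- isd (fun y => expR (@?F y)) _ _ => apply: (@isd_exp _ F); der
  | |- _ => first [eassumption | idtac]
  end.

(** * Absolutely continuous functions *)

Section AbsolutelyContinuous.
Context {R : realType}.
Notation mu := (@lebesgue_measure R).
Implicit Types (a b c x y k e L K : R) (f g F G df phi dphi : R -> R).

Lemma cvgn_unique (f : nat -> R) (l l' : R) :
  f n @[n --> \oo] --> l -> f n @[n --> \oo] --> l' -> l = l'.
Proof.
move=> h1 h2.
by rewrite -(@cvg_lim R^o (@norm_hausdorff R R^o) _ _ _ f l h1) -(@cvg_lim R^o (@norm_hausdorff R R^o) _ _ _ f l' h2).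
Qed.

Lemma mvt_in a b f df : a < b -> (forall x, a < x < b -> isd f x (df x)) ->
  cont a b f -> exists2 c, a < c < b & f b - f a = df c * (b - a).
Proof.
move=> ab dF cf; have dF' x : x \in `]a, b[ -> is_derive x 1 f (df x) by rewrite in_itv/=; exact: dF.
have [c ci ->] := MVT ab dF' cf.
by exists c => //; move: ci; rewrite in_itv.
Qed.

Lemma derive_ge0_le a b f df : a <= b -> (forall x, a < x < b -> isd f x (df x)) ->
  (forall x, a < x < b -> 0 <= df x) -> cont a b f -> f a <= f b.
Proof.
rewrite le_eqVlt => /predU1P[->//|ab dF df0 cf].
have [c cab h] := mvt_in ab dF cf.
by rewrite -subr_ge0 h mulr_ge0 ?df0// subr_ge0 ltW.
Qed.

Lemma derive_gt0_lt a b f df : a < b -> (forall x, a < x < b -> isd f x (df x)) ->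
  (forall x, a < x < b -> 0 < df x) -> cont a b f -> f a < f b.
Proof.
move=> ab dF df0 cf; have [c cab h] := mvt_in ab dF cf.
by rewrite -subr_gt0 h mulr_gt0 ?df0// subr_gt0.
Qed.

Lemma derive_0_eq a b f df : a <= b -> (forall x, a < x < b -> isd f x (df x)) ->
  (forall x, a < x < b -> df x = 0) -> cont a b f -> f a = f b.
Proof.
rewrite le_eqVlt => /predU1P[->//|ab dF df0 cf].
have [c cab h] := mvt_in ab dF cf.
by apply/eqP; rewrite eq_sym -subr_eq0 h df0// mul0r.
Qed.

Lemma is_derive_continuous f x (df : R) : isd f x df -> {for x, continuous f}.
Proof. by case=> d _; apply: differentiable_continuous; apply/derivable1_diffP. Qed.

Lemma is_derive_cont a b f df : (forall x, isd f x (df x)) -> cont a b f.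
Proof.
move=> h; apply: continuous_cont => x; exact: is_derive_continuous (h x).
Qed.

Lemma lipschitz_derive f df (L : R) : (forall x, isd f x (df x)) ->
  (forall x, `|df x| <= L) -> forall x y, `|f x - f y| <= L * `|x - y|.
Proof.
move=> dF dL.
suff h (x y : R) : x < y -> `|f x - f y| <= L * `|x - y|.
  move=> x y; case: (ltgtP x y) => [/h//|/h|->]; last by rewrite !subrr normr0 mulr0.
  by rewrite distrC (distrC x).
move=> xy; have [|c _ e] := mvt_in xy (fun z _ => dF z); first exact: is_derive_cont dF.
by rewrite distrC e normrM (distrC y) ler_wpM2r.
Qed.

(** Absolute continuity in integrated form: the density [g] matters only up to null sets and no
    pointwise derivative is claimed. Differentiability is recovered where [g] is continuous
    ([ac_derive]). *)
Definition ac a b f g := intg a b g /\ forall x, a <= x <= b -> f x = f a + rint a x g.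

Lemma ac_intg a b f g : ac a b f g -> intg a b g. Proof. by case. Qed.

Lemma ac_sub_rint a b f g x y : ac a b f g -> a <= x -> x <= y -> y <= b ->
  f y - f x = rint x y g.
Proof.
move=> [jg h] ax xy yb; rewrite (h y) ?(h x); try by apply/andP; split; lra.
by rewrite (@rint_chasles _ a x y)//; [ring|apply: intg_sub jg].
Qed.

Lemma ac_cont a b f g : ac a b f g -> cont a b f.
Proof.
move=> [jg h]; apply: (@cont_eq _ _ _ (fun x => f a + rint a x g)).
  by move=> x /h.
by apply: contD; [exact: cont_cst|exact: rint_cont].
Qed.

Lemma ac_sub a b c d f g : a <= c -> c <= d -> d <= b -> ac a b f g -> ac c d f g.
Proof.
move=> ac cd db h; split; first exact: intg_sub (ac_intg h).
move=> x /andP[cx xd]; rewrite -(ac_sub_rint h)//; first by ring.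
exact: le_trans db.
Qed.

Lemma ac_derive a b f g x : ac a b f g -> a < x < b -> {for x, continuous g} ->
  isd f x (g x).
Proof.
move=> [jg h] xab cg.
have := rint_derive jg xab cg => dr.
have d2 : isd (fun y => f a + rint a y g) x (g x) by apply: isd_eq; [der|rewrite add0r].
apply: isd_near d2; apply: filterS (near_oo xab) => y /andP[ay yb].
by apply/esym/h; rewrite !ltW.
Qed.

Lemma C1_ac a b f g : cont a b f -> cont a b g ->
  (forall x, a < x < b -> isd f x (g x)) -> ac a b f g.
Proof.
move=> cf cg d; split; first exact: cont_intg.
move=> x /andP[ax xb]; rewrite (_ : rint a x g = f x - f a); first by ring.
apply: rint_FTC => //.
- exact: cont_sub cg.
- exact: cont_sub cf.
- by move=> y /andP[ay yx]; apply: d; apply/andP; split; lra.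
Qed.

Lemma acD a b f g F G : ac a b f g -> ac a b F G ->
  ac a b (fun x => f x + F x) (fun x => g x + G x).
Proof.
move=> [jg h] [jG H]; split; first exact: intgD.
move=> x /[dup] xab /andP[ax xb]; rewrite (h x)// (H x)// rintD; first by ring.
- exact: intg_sub jg.
- exact: intg_sub jG.
Qed.

Lemma acZ a b k f g : ac a b f g -> ac a b (fun x => k * f x) (fun x => k * g x).
Proof.
move=> [jg h]; split; first exact: intgZ.
move=> x /[dup] xab /andP[ax xb]; rewrite (h x)// rintZ; first by ring.
exact: intg_sub jg.
Qed.

Lemma acB a b f g F G : ac a b f g -> ac a b F G ->
  ac a b (fun x => f x - F x) (fun x => g x - G x).
Proof.
move=> h /(acZ (-1)) H; have := acD h H.
have e (u v : R -> R) : (fun x => u x + -1 * v x) = (fun x => u x - v x).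
  by apply/funext => x; rewrite mulN1r.
by rewrite !e.
Qed.

Lemma ac_eq a b f g F G : a <= b -> (forall x, a <= x <= b -> f x = F x) ->
  (forall x, a <= x <= b -> g x = G x) -> ac a b f g -> ac a b F G.
Proof.
move=> ab fF gG [jg h]; split; first exact: intg_eq gG jg.
move=> x /[dup] xab /andP[ax xb]; rewrite -fF// -fF ?lexx//= h//; congr (_ + _).
by apply: rint_eq => y /andP[ay yx]; rewrite gG// ay; lra.
Qed.

Lemma ac_approx a b g : a <= b -> intg a b g -> forall e, 0 < e -> exists h,
  [/\ continuous h, intg a b h & rint a b (fun x => `|g x - h x|) <= e].
Proof.
move=> ab jg e e0.
have := @approximation_continuous_integrable R `[a, b] g.
case=> //.
  by rewrite [X in (X < _)%E]lebesgue_measure_itv/=; case: ifP => // _; rewrite -EFinD ltry.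
move=> h [ch jh /fine_cvgP[_ /cvgrPdist_le /(_ e e0)]] [N _ /(_ N)] /=.
rewrite leqnn => /(_ isT); rewrite sub0r normrN => hN.
exists (h N); split; [exact: ch|exact: jh|].
by rewrite /rint /Rintegral (le_trans (ler_norm _)).
Qed.

(** For continuous [g] this is the fundamental theorem of calculus. In general [g] is approximated
    in L^1 by a continuous [h]; the primitive of [h] is then uniformly close to [f], and both sides
    of the identity move by at most a constant times the error. *)
Lemma ac_chain a b f g phi dphi L : a <= b -> ac a b f g ->
  (forall t, isd phi t (dphi t)) ->
  (forall s t, `|dphi s - dphi t| <= L * `|s - t|) ->
  ac a b (fun x => phi (f x)) (fun x => dphi (f x) * g x).
Proof.
move=> ab acf dp dL; have [jg hf] := acf.
have cdp : continuous dphi.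
  move=> t; apply/cvgrPdist_le => e e0.
  near=> s; rewrite (le_trans (dL t s))//.
  rewrite (@le_trans _ _ ((`|L| + 1) * `|t - s|))//.
    by rewrite ler_wpM2r// (le_trans (ler_norm L))// lerDl.
  rewrite mulrC -ler_pdivlMr; last by rewrite ltr_wpDl.
  near: s; apply: cvgr_dist_le; [exact: cvg_id|].
  by rewrite divr_gt0// ltr_wpDl.
have cf := ac_cont acf.
have jdg c d : a <= c -> d <= b -> intg c d (fun x => dphi (f x) * g x).
  move=> ac db; apply: intg_contM; last exact: intg_sub jg.
  apply: (@cont_comp _ _ _ f dphi) => [x _|]; [exact: cdp|exact: cont_sub cf].
split; first exact: jdg.
move=> x /andP[ax xb].
have [M M0 fM] := cont_bounded cf.
have L0 : 0 <= L.
  by have := dL 1 0; rewrite subr0 normr1 mulr1; apply: le_trans.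
(* A bound for [dphi] on the ball of radius M + 1, which contains the values of [f] and of every
   approximation at distance at most 1. *)
pose K : R := `|dphi 0| + L * (M + 1).
have dK t : `|t| <= M + 1 -> `|dphi t| <= K.
  move=> tM; rewrite (_ : dphi t = dphi 0 + (dphi t - dphi 0)); last by ring.
  rewrite (le_trans (ler_normD _ _))// lerD2l (le_trans (dL _ _))// subr0.
  by rewrite ler_wpM2l.
have K0 : 0 <= K by rewrite addr_ge0// mulr_ge0// addr_ge0// ltW.
have phiK s t : `|s| <= M + 1 -> `|t| <= M + 1 -> `|phi s - phi t| <= K * `|s - t|.
  suff H u v : u < v -> `|u| <= M + 1 -> `|v| <= M + 1 -> `|phi u - phi v| <= K * `|u - v|.
    move=> sM tM; case: (ltgtP s t) => [st|ts|->]; last by rewrite !subrr normr0 mulr0.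
      exact: H.
    by rewrite distrC (distrC s) H.
  move=> uv uM vM.
  have [|c /andP[uc cv] e] := mvt_in uv (fun z _ => dp z); first exact: is_derive_cont dp.
  rewrite distrC e normrM (distrC v) ler_wpM2r// dK//.
  by move: uM vM; rewrite !ler_norml => /andP[? ?] /andP[? ?]; apply/andP; split; lra.
pose I : R := rint a b (fun y => `|g y|).
have I0 : 0 <= I by apply: rint_ge0.
(* The defect in the chain rule: it is at most a fixed multiple of e for every e in (0, 1], hence
   zero. *)
pose Z : R := phi (f x) - phi (f a) - rint a x (fun y => dphi (f y) * g y).
suff : Z = 0 by rewrite /Z => /eqP; rewrite -addrA -opprD subr_eq0 => /eqP.
have Ze e : 0 < e -> e <= 1 -> `|Z| <= (K + (K + L * I)) * e.
  move=> e0 e1; have [h [ch jh he]] := ac_approx ab jg e0.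
  pose fh y := f a + rint a y h.
  have dist y : a <= y <= b -> `|fh y - f y| <= e.
    move=> /[dup] yab /andP[ay yb]; rewrite /fh (hf y yab) opprD addrACA subrr add0r.
    have jhy : intg a y h by apply: intg_sub jh.
    have jgy : intg a y g by apply: intg_sub jg.
    rewrite -rintB// (le_trans (rint_abs _))//; first exact: intgB.
    rewrite (le_trans _ he)//.
    under eq_fun do rewrite distrC.
    have jgh : intg a b (fun z => `|g z - h z|) by apply: intg_abs; exact: intgB.
    rewrite (@rint_chasles _ a y b)//; rewrite lerDl.
    by apply: rint_ge0 => z _.
  have fhM y : a <= y <= b -> `|fh y| <= M + 1.
    move=> yab; rewrite (_ : fh y = f y + (fh y - f y)); last by ring.
    rewrite (le_trans (ler_normD _ _))// lerD ?fM//.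
    exact: le_trans (dist _ yab) e1.
  have fM1 y : a <= y <= b -> `|f y| <= M + 1.
    by move=> yab; rewrite (le_trans (fM _ yab))// lerDl.
  have acfh : ac a b fh h.
    by split=> // y yab; rewrite /fh rint_same addr0.
  have cfh := ac_cont acfh.
  have cdfh : cont a b (fun y => dphi (fh y)).
    by apply: (@cont_comp _ _ _ fh dphi) => // y _; exact: cdp.
  have cdf : cont a b (fun y => dphi (f y)).
    by apply: (@cont_comp _ _ _ f dphi) => // y _; exact: cdp.
  have jdh : intg a b (fun y => dphi (fh y) * h y) by apply: intg_contM.
  have C1 : phi (fh x) - phi (fh a) = rint a x (fun y => dphi (fh y) * h y).
    apply/esym; apply: (@rint_FTC _ a x _ (fun y => phi (fh y))) => //.
    - apply: (@cont_sub _ a b) => //; apply: contM => //; exact: continuous_cont.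
    - apply: (@cont_sub _ a b) => //.
      apply: (@cont_comp _ _ _ fh phi) => // y _; exact: is_derive_continuous (dp _).
    - move=> y /andP[ay yx].
      have dfh : isd fh y (h y).
        apply: ac_derive acfh _ _; last exact: ch.
        by apply/andP; split => //; lra.
      exact: (isd_comp (dp _) dfh).
  have xab : a <= x <= b by apply/andP.
  have aab : a <= a <= b by rewrite lexx.
  have fha : fh a = f a by rewrite /fh rint_same addr0.
  have -> : Z = (phi (f x) - phi (fh x)) +
     rint a x (fun y => dphi (fh y) * h y - dphi (f y) * g y).
    rewrite rintB; [|by apply: intg_sub jdh|exact: jdg].
    by rewrite -C1 fha /Z; ring.
  rewrite (le_trans (ler_normD _ _))// mulrDl lerD//.
    rewrite (le_trans (phiK _ _ (fM1 _ xab) (fhM _ xab)))// ler_wpM2l//.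
    by rewrite distrC dist.
  have jD : intg a b (fun y => dphi (fh y) * h y - dphi (f y) * g y).
    by apply: intgB => //; exact: jdg.
  have jgh : intg a b (fun z => `|g z - h z|) by apply: intg_abs; exact: intgB.
  have jag : intg a b (fun z => `|g z|) by apply: intg_abs.
  apply: (@le_trans _ _ (rint a b (fun y => K * `|g y - h y| + (L * e) * `|g y|))).
    rewrite (le_trans (rint_abs _))//; first by apply: intg_sub jD.
    apply: (@le_trans _ _ (rint a b (fun y => `|dphi (fh y) * h y - dphi (f y) * g y|))).
      rewrite (@rint_chasles _ a x b)//; last exact: intg_abs.
      by rewrite lerDl; apply: rint_ge0.
    apply: rint_le; first exact: intg_abs.
      by apply: intgD; exact: intgZ.
    move=> y yab.
    rewrite (_ : _ - _ = dphi (fh y) * (h y - g y) + (dphi (fh y) - dphi (f y)) * g y); last by ring.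
    rewrite (le_trans (ler_normD _ _))// !normrM lerD//.
      by rewrite distrC ler_wpM2r// dK// fhM.
    by rewrite ler_wpM2r// (le_trans (dL _ _))// ler_wpM2l// dist.
  rewrite rintD; [|exact: intgZ|exact: intgZ].
  rewrite (rintZ K jgh) (rintZ (L * e) jag) [leRHS]mulrDl lerD//; first by rewrite ler_wpM2l.
  by rewrite -/I mulrAC.
apply/eqP; rewrite -normr_le0; apply/ler_addgt0Pr => e e0; rewrite add0r.
pose Q : R := K + (K + L * I).
have Q0 : 0 <= Q := addr_ge0 K0 (addr_ge0 K0 (mulr_ge0 L0 I0)).
have := Ze (Num.min 1 (e / (Q + 1))).
rewrite lt_min ltr01 divr_gt0 ?ltr_wpDl//= ge_min lexx => /(_ isT isT) /le_trans; apply.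
apply: (@le_trans _ _ (Q * (e / (Q + 1)))).
  by rewrite ler_wpM2l// ge_min lexx orbT.
rewrite mulrCA ger_pMr// ler_pdivrMr ?mul1r ?lerDl// ltr_wpDl//.
Unshelve. all: by end_near. Qed.

Lemma ac_sqr a b f g : a <= b -> ac a b f g -> ac a b (fun x => f x ^+ 2) (fun x => 2 * f x * g x).
Proof.
move=> ab h; apply: (@ac_chain _ _ f g (fun t => t ^+ 2) (fun t => 2 * t) 2) => //.
  by move=> t; apply: isd_eq; [der|rewrite /=; ring].
by move=> s t; rewrite -mulrBr normrM ger0_norm.
Qed.

(** Polarisation: fF = ((f + F)^2 - (f - F)^2) / 4 reduces products to squares, and t^2 has a
    globally Lipschitz derivative as [ac_chain] requires. *)
Lemma acM a b f g F G : a <= b -> ac a b f g -> ac a b F G ->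
  ac a b (fun x => f x * F x) (fun x => g x * F x + f x * G x).
Proof.
move=> ab h H.
have := acB (acZ (4^-1) (ac_sqr ab (acD h H))) (acZ (4^-1) (ac_sqr ab (acB h H))).
by apply: ac_eq => // x _; field.
Qed.

Lemma sqrtD1_ge1 (t : R) : 1 <= Num.sqrt (1 + t ^+ 2).
Proof. by rewrite -[leLHS]sqrtr1 ler_wsqrtr// lerDl sqr_ge0. Qed.

Lemma sqrtD1_gt0 (t : R) : 0 < Num.sqrt (1 + t ^+ 2).
Proof. exact: lt_le_trans (sqrtD1_ge1 t). Qed.

Lemma sqr_sqrtD1 (t : R) : Num.sqrt (1 + t ^+ 2) ^+ 2 = 1 + t ^+ 2.
Proof. by rewrite sqr_sqrtr// addr_ge0// sqr_ge0. Qed.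

Lemma norm_le_sqrtD (k t : R) : 0 <= k -> `|t| <= Num.sqrt (k + t ^+ 2).
Proof. by move=> k0; rewrite -sqrtr_sqr ler_wsqrtr// lerDr. Qed.

(** The sine of the slope angle is a primitive of u'' / (1 + u'^2)^(3/2), the cross term of the
    squared mean curvature. The Lipschitz constant 3 bounds the second derivative of t / sqrt(1 +
    t^2). *)
Lemma ac_slope a b f g : a <= b -> ac a b f g ->
  ac a b (fun x => f x / Num.sqrt (1 + f x ^+ 2)) (fun x => g x / Num.sqrt (1 + f x ^+ 2) ^+ 3).
Proof.
move=> ab h.
pose dphi (t : R) := (Num.sqrt (1 + t ^+ 2))^-1 ^+ 3.
pose ddphi (t : R) := - 3 * t * (Num.sqrt (1 + t ^+ 2))^-1 ^+ 5.
have p0 (t : R) : 0 < 1 + t ^+ 2 by rewrite ltr_wpDr// sqr_ge0.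
have s0 (t : R) : Num.sqrt (1 + t ^+ 2) != 0 by rewrite gt_eqF// sqrtD1_gt0.
have dd t : isd dphi t (ddphi t).
  rewrite /dphi /ddphi; apply: isd_eq; first by der.
  by rewrite /=; field.
have dp t : isd (fun t => t / Num.sqrt (1 + t ^+ 2)) t (dphi t).
  rewrite /dphi; apply: isd_eq; first by der.
  have e : t ^+ 2 = Num.sqrt (1 + t ^+ 2) ^+ 2 - 1 by rewrite sqr_sqrtD1; ring.
  rewrite /=; field: e => //.
have dL s t : `|dphi s - dphi t| <= 3 * `|s - t|.
  apply: (lipschitz_derive dd) => {s t} t.
  rewrite /ddphi -mulrA mulNr normrN normrM ger0_norm// -[leRHS]mulr1 ler_wpM2l//.
  rewrite exprS mulrA normrM mulr_ile1//.
    by rewrite normrM normfV (ger0_norm (sqrtr_ge0 _)) ler_pdivrMr ?sqrtD1_gt0// mul1r norm_le_sqrtD.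
  rewrite normrX normfV (ger0_norm (sqrtr_ge0 _)) exprn_ile1// ?invr_ge0 ?sqrtr_ge0//.
  by rewrite invf_le1 ?sqrtD1_gt0// sqrtD1_ge1.
apply: ac_eq (ac_chain ab h dp dL) => // x _.
by rewrite /dphi exprVn mulrC.
Qed.

(** Smooth the absolute value to sqrt(k + t^2) and let k tend to 0 under dominated convergence.
    Since [Num.sg 0] is 0, the density vanishes where [f] does. *)
Lemma ac_abs a b f g : a <= b -> ac a b f g ->
  ac a b (fun x => `|f x|) (fun x => Num.sg (f x) * g x).
Proof.
move=> ab h; have [jg hf] := h.
have cf := ac_cont h.
(* The second derivative k / (k + t^2)^(3/2) is at most k^(-1/2) = n + 1, the Lipschitz constant in
   [dL]. *)
pose k (n : nat) : R := n.+1%:R^-1 ^+ 2.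
have k0 n : 0 < k n by rewrite exprn_gt0// invr_gt0.
pose phi n (t : R) := Num.sqrt (k n + t ^+ 2).
pose dphi n (t : R) := t / Num.sqrt (k n + t ^+ 2).
have p0 n (t : R) : 0 < k n + t ^+ 2 by rewrite ltr_wpDr// sqr_ge0.
have s0 n (t : R) : 0 < Num.sqrt (k n + t ^+ 2) by rewrite sqrtr_gt0.
have s0' n (t : R) : Num.sqrt (k n + t ^+ 2) != 0 by rewrite gt_eqF.
have dp n t : isd (phi n) t (dphi n t).
  by rewrite /phi /dphi; apply: isd_eq; first (by der); rewrite /=; field.
have dphi1 n t : `|dphi n t| <= 1.
  by rewrite normrM normfV (ger0_norm (sqrtr_ge0 _)) ler_pdivrMr// mul1r norm_le_sqrtD// ltW.
have dd n t : isd (dphi n) t (k n / Num.sqrt (k n + t ^+ 2) ^+ 3).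
  rewrite /dphi; apply: isd_eq; first by der.
  have e : t ^+ 2 = Num.sqrt (k n + t ^+ 2) ^+ 2 - k n by rewrite sqr_sqrtr ?ltW//; ring.
  by rewrite /=; field: e.
have dL n s t : `|dphi n s - dphi n t| <= n.+1%:R * `|s - t|.
  apply: (lipschitz_derive (dd n)) => {s t} t.
  have kE : n.+1%:R^-1 <= Num.sqrt (k n + t ^+ 2).
    rewrite -[leLHS]ger0_norm ?invr_ge0// -sqrtr_sqr ler_wsqrtr// lerDl sqr_ge0//.
  rewrite ger0_norm; last by rewrite divr_ge0 ?exprn_ge0 ?sqrtr_ge0.
  rewrite ler_pdivrMr; last exact: exprn_gt0.
  have e : k n = n.+1%:R * n.+1%:R^-1 ^+ 3 by rewrite /k; field.
  by rewrite [leLHS]e ler_wpM2l// lerXn2r// nnegrE ?invr_ge0 ?sqrtr_ge0.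
have H n := ac_chain ab h (dp n) (dL n).
have phic t : phi n t @[n --> \oo] --> `|t|.
  have kc : k n @[n --> \oo] --> (0 : R).
    have -> : k = (fun n => harmonic n * harmonic n) by apply/funext => n; rewrite /k expr2.
    by rewrite -(mulr0 (0 : R)); apply: cvgM; exact: cvg_harmonic.
  rewrite -sqrtr_sqr -[t ^+ 2]add0r.
  apply: (@cvg_comp _ _ _ (fun n => k n + t ^+ 2) Num.sqrt); last exact: sqrt_continuous.
  by apply: cvgD kc _; exact: cvg_cst.
have dphic t : dphi n t @[n --> \oo] --> Num.sg t.
  have [->|t0] := eqVneq t 0.
    rewrite sgr0 (_ : dphi ^~ 0 = fun=> 0); first exact: cvg_cst.
    by apply/funext => n; rewrite /dphi mul0r.
  have -> : Num.sg t = t * `|t|^-1.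
    by rewrite {2}[t]numEsg -mulrA divff ?mulr1// normr_eq0.
  by apply: cvgM; [exact: cvg_cst|apply: cvgV; rewrite ?normr_eq0//; exact: phic].
have cdf n : cont a b (fun x => dphi n (f x)).
  by apply: (@cont_comp _ _ _ f (dphi n)) => // y _; exact: is_derive_continuous (dd n _).
have mdg n x : a <= x <= b -> measurable_fun `[a, x] (fun x => dphi n (f x) * g x).
  move=> /andP[ax xb]; apply: measurable_funM; apply: intg_meas.
    by apply: cont_intg; exact: cont_sub (cdf n).
  exact: intg_sub jg.
have key x : a <= x <= b -> intg a x (fun y => Num.sg (f y) * g y) /\
    rint a x (fun y => dphi n (f y) * g y) @[n --> \oo] --> rint a x (fun y => Num.sg (f y) * g y).
  move=> /[dup] xab /andP[ax xb].
  apply: (@rint_dom _ a x (fun n y => dphi n (f y) * g y) _ (fun y => `|g y|)).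
  - by move=> n; exact: mdg.
  - by move=> y _; apply: cvgM; [exact: dphic|exact: cvg_cst].
  - by apply: intg_abs; exact: intg_sub jg.
  - by move=> n y _; rewrite normrM ler_piMl.
split; first by have [] := key b; rewrite ?lexx ?ab.
move=> x xab; have [_ c1] := key x xab.
have c2 : phi n (f a) + rint a x (fun y => dphi n (f y) * g y) @[n --> \oo] --> `|f x|.
  rewrite (_ : (fun n => _) = (fun n => phi n (f x))); first exact: phic.
  by apply/funext => n; have [_ Hn] := H n; rewrite (Hn x xab).
have c3 : phi n (f a) + rint a x (fun y => dphi n (f y) * g y) @[n --> \oo] -->
    `|f a| + rint a x (fun y => Num.sg (f y) * g y) by apply: cvgD; [exact: phic|exact: c1].
exact: cvgn_unique c2 c3.
Qed.

End AbsolutelyContinuous.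

(** * The energy of a half profile *)

Section Slope.
Context {R : realType}.
Implicit Types (a b p q : R) (f : R -> R).

Definition sl p : R := Num.sqrt (1 + p ^+ 2).

Lemma sl_ge1 p : 1 <= sl p. Proof. exact: sqrtD1_ge1. Qed.
Lemma sl_gt0 p : 0 < sl p. Proof. exact: sqrtD1_gt0. Qed.
Lemma sl_neq0 p : sl p != 0. Proof. by rewrite gt_eqF// sl_gt0. Qed.
Lemma sl_sqr p : sl p ^+ 2 = 1 + p ^+ 2. Proof. exact: sqr_sqrtD1. Qed.
Lemma sl0 : sl 0 = 1. Proof. by rewrite /sl expr0n addr0 sqrtr1. Qed.
Lemma slN p : sl (- p) = sl p. Proof. by rewrite /sl sqrrN. Qed.

Lemma sl_le p q : `|p| <= `|q| -> sl p <= sl q.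
Proof.
move=> pq; rewrite /sl ler_wsqrtr// lerD2l -(real_normK (num_real p)).
by rewrite -(real_normK (num_real q)) lerXn2r// nnegrE.
Qed.

Lemma cont_sl a b f : cont a b f -> cont a b (fun x => sl (f x)).
Proof. by move=> cf; apply: cont_sqrt; apply: contD; [exact: cont_cst|exact: contX]. Qed.

Lemma isd_sl f x (df : R) : isd f x df -> isd (fun y => sl (f y)) x (f x * df / sl (f x)).
Proof.
move=> h; rewrite /sl; apply: isd_eq; first (by der; rewrite ltr_wpDr// sqr_ge0).
by rewrite /=; field; exact: sl_neq0.
Qed.

End Slope.

(** The counterpart of [der] for continuity on an interval; nonvanishing of denominators is left as
    goals. *)
Ltac ct := lazymatch goal with
  | |- cont _ _ (fun y => y) => exact: cont_id
  | |- cont _ _ (fun _ => ?c) => exact: cont_cst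
  | |- cont _ _ (fun y => @?F y + @?G y) => apply: (@contD _ _ _ F G); [ct|ct]
  | |- cont _ _ (fun y => - (@?F y)) => apply: (@contN _ _ _ F); ct
  | |- cont _ _ (fun y => @?F y * @?G y) => apply: (@contM _ _ _ F G); [ct|ct]
  | |- cont _ _ (fun y => @?F y ^+ ?n) => apply: (@contX _ _ _ F n); ct
  | |- cont _ _ (fun y => (@?F y)^-1) => apply: (@contV _ _ _ F); [|ct]
  | |- cont _ _ (fun y => sl (@?F y)) => apply: (@cont_sl _ _ _ F); ct
  | |- _ => first [eassumption | idtac]
  end.

Section HalfProblem.
Context {R : realType}.
Notation mu := (@lebesgue_measure R).
Implicit Types (a b c x y p q k e L K alpha eps : R) (f g F G df phi dphi u v w : R -> R).

(** Half of an even competitor, carried with its weak derivatives. Evenness survives as u'(0) = 0,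
    while u(0) is free. *)
Record profile alpha u u1 u2 : Prop := Profile {
  prof_ac1 : ac 0 1 u1 u2;
  prof_L2 : intg 0 1 (fun x => u2 x ^+ 2);
  prof_ac0 : ac 0 1 u u1;
  prof_gt0 : forall x, 0 <= x <= 1 -> 0 < u x;
  prof_u1 : u 1 = alpha;
  prof_d0 : u1 0 = 0;
  prof_d1 : u1 1 = 0 }.

(** The integrand of [helfH] divided by pi / 2; the area weight 2 pi eps becomes 4 eps. *)
Definition dens eps y p q : R :=
  (1 / (y * sl p) - q / sl p ^+ 3) ^+ 2 * y * sl p + 4 * eps * (y * sl p).

(** [dens] after discarding the exact derivative -2 q / (1 + p^2)^(3/2): no term linear in q
    remains, and for y > 0 and eps >= 0 all terms are nonnegative. *)
Definition lag eps y p q : R := 1 / (y * sl p) + 4 * eps * (y * sl p) + y / sl p ^+ 5 * q ^+ 2.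

Lemma densE eps y p q : y != 0 -> dens eps y p q = lag eps y p q - 2 * (q / sl p ^+ 3).
Proof. by move=> y0; rewrite /dens /lag; field; rewrite y0 sl_neq0. Qed.

Definition energy eps u u1 u2 : R := rint 0 1 (fun x => dens eps (u x) (u1 x) (u2 x)).

Section Half.
Context alpha eps u u1 u2 (H : profile alpha u u1 u2).

Lemma prof_cont1 : cont 0 1 u1. Proof. exact: ac_cont (prof_ac1 H). Qed.
Lemma prof_cont : cont 0 1 u. Proof. exact: ac_cont (prof_ac0 H). Qed.
Lemma prof_neq0 x : 0 <= x <= 1 -> u x != 0. Proof. by move=> h; rewrite gt_eqF// (prof_gt0 H). Qed.

Lemma prof_isd x : 0 < x < 1 -> isd u x (u1 x).
Proof.
move=> /[dup] x01 h; apply: ac_derive (prof_ac0 H) h _.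
exact: cont_for prof_cont1 x01.
Qed.

Lemma prof_intg_slope : intg 0 1 (fun x => u2 x / sl (u1 x) ^+ 3).
Proof. by have := ac_intg (ac_slope ler01 (prof_ac1 H)). Qed.

Lemma prof_slope0 : rint 0 1 (fun x => u2 x / sl (u1 x) ^+ 3) = 0.
Proof.
have [_ /(_ 1)] := ac_slope ler01 (prof_ac1 H).
rewrite ler01 lexx (prof_d0 H) (prof_d1 H) !mul0r add0r => /(_ isT) h.
by rewrite [RHS]h.
Qed.

Lemma prof_contV : cont 0 1 (fun x => 1 / (u x * sl (u1 x)) + 4 * eps * (u x * sl (u1 x))).
Proof.
have cu := prof_cont; have cu1 := prof_cont1; ct => x x01.
by rewrite mulf_neq0 ?sl_neq0// prof_neq0.
Qed.

Lemma prof_contB : cont 0 1 (fun x => u x / sl (u1 x) ^+ 5).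
Proof.
have cu := prof_cont; have cu1 := prof_cont1; ct => x _.
by rewrite expf_neq0// sl_neq0.
Qed.

Lemma prof_intg_lag : intg 0 1 (fun x => lag eps (u x) (u1 x) (u2 x)).
Proof.
apply: intgD; first exact: cont_intg prof_contV.
exact: intg_contM prof_contB (prof_L2 H).
Qed.

Lemma prof_intg_dens : intg 0 1 (fun x => dens eps (u x) (u1 x) (u2 x)).
Proof.
apply: (@intg_eq _ _ _ (fun x => lag eps (u x) (u1 x) (u2 x) - 2 * (u2 x / sl (u1 x) ^+ 3))).
  by move=> x x01; rewrite densE// prof_neq0.
by apply: intgB; [exact: prof_intg_lag|apply: intgZ; exact: prof_intg_slope].
Qed.

(* The cross term of the square is the total Gauss curvature, which vanishes for horizontal ends. *)
Lemma energy_lag : energy eps u u1 u2 = rint 0 1 (fun x => lag eps (u x) (u1 x) (u2 x)).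
Proof.
rewrite /energy (@rint_eq _ _ _ _ (fun x => lag eps (u x) (u1 x) (u2 x) - 2 * (u2 x / sl (u1 x) ^+ 3))); last first.
  by move=> x x01; rewrite densE// prof_neq0.
rewrite rintB; [|exact: prof_intg_lag|by apply: intgZ; exact: prof_intg_slope].
by rewrite (rintZ 2 prof_intg_slope) prof_slope0 mulr0 subr0.
Qed.

End Half.

(** The function 1/z + 4 eps z has its minimum at 1 / (2 sqrt eps); the hypothesis places z to the
    right of it. *)
Lemma recip_linear_le eps (z w : R) : 0 < z -> 1 <= 4 * eps * z ^+ 2 -> z <= w ->
  1 / z + 4 * eps * z <= 1 / w + 4 * eps * w.
Proof.
move=> z0 ez zw; have w0 : 0 < w by exact: lt_le_trans zw.
rewrite -subr_ge0.
have -> : 1 / w + 4 * eps * w - (1 / z + 4 * eps * z) =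
  (w - z) * (4 * eps * (z * w) - 1) / (z * w).
  by field; rewrite !gt_eqF.
have h : 1 <= 4 * eps * (z * w) by nra.
by rewrite divr_ge0// mulr_ge0// ?subr_ge0// ltW.
Qed.

Lemma recip_linear_lt eps (z w : R) : 0 < z -> 1 <= 4 * eps * z ^+ 2 -> z < w ->
  1 / z + 4 * eps * z < 1 / w + 4 * eps * w.
Proof.
move=> z0 ez zw; have w0 : 0 < w by exact: lt_trans zw.
rewrite -subr_gt0.
have -> : 1 / w + 4 * eps * w - (1 / z + 4 * eps * z) =
  (w - z) * (4 * eps * (z * w) - 1) / (z * w).
  by field; rewrite !gt_eqF.
rewrite divr_gt0 ?mulr_gt0 ?subr_gt0//.
nra.
Qed.

(* Replacing u' by its positive part lowers u, |u'| and |u''| while u stays in the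
   range where recip_linear_le applies. *)
Lemma nonneg_slope_replace alpha eps c0 u u1 u2 (v v1 : R -> R) :
  profile alpha u u1 u2 -> 0 < c0 -> 1 <= 4 * eps * c0 ^+ 2 -> 0 <= eps ->
  (forall x, 0 <= x <= 1 -> c0 <= v x) -> ac 0 1 v v1 -> v 1 = alpha ->
  (forall x, 0 <= x <= 1 -> u1 x <= v1 x /\ 0 <= v1 x) ->
  exists w w1 w2, [/\ profile alpha w w1 w2, energy eps w w1 w2 <= energy eps u u1 u2 &
    forall x, 0 <= x <= 1 -> 0 <= w1 x <= v1 x].
Proof.
move=> H c00 ec e0 vc acv va uv.
have ac1 := prof_ac1 H.
(* The positive part of u', written with an absolute value so that [ac_abs] gives its density. Where
   u' = 0 the density is u'' / 2, still dominated by u''. *)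
pose w1 x := 2^-1 * (u1 x + `|u1 x|).
pose w2 x := 2^-1 * (u2 x + Num.sg (u1 x) * u2 x).
(* Integrating from the right end keeps the boundary value alpha. *)
pose w x := alpha - rint x 1 w1.
have acw1 : ac 0 1 w1 w2 by apply: acZ; apply: acD => //; exact: ac_abs.
have w1E x : w1 x = Num.max 0 (u1 x).
  by rewrite /w1; case: (lerP 0 (u1 x)) => h; [rewrite (ger0_norm h)|rewrite (ltr0_norm h)]; field.
have w10 x : 0 <= w1 x by rewrite w1E le_max lexx.
have u1w x : u1 x <= w1 x by rewrite w1E le_max lexx orbT.
have w1v x : 0 <= x <= 1 -> w1 x <= v1 x.
  by move=> /uv [a b]; rewrite w1E ge_max b a.
have w1n x : `|w1 x| <= `|u1 x|.
  by rewrite w1E; case: (lerP 0 (u1 x)) => h; rewrite ?normr0.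
have jw1 : intg 0 1 w1 by apply: cont_intg; exact: ac_cont acw1.
have acw : ac 0 1 w w1.
  split => // x /andP[x0 x1].
  by rewrite /w (rint_chasles x0 x1 jw1); ring.
have diff f f1 x : ac 0 1 f f1 -> 0 <= x <= 1 -> f 1 = alpha -> f x = alpha - rint x 1 f1.
  by move=> acf /andP[x0 x1] <-; rewrite -(ac_sub_rint acf)//; ring.
(* Equal values at 1 and smaller slopes put [w] above [v], hence above [c0], where [recip_linear_le]
   applies. *)
have vw x : 0 <= x <= 1 -> v x <= w x.
  move=> /[dup] x01 /andP[x0 x1]; rewrite (diff v v1)// /w lerD2l lerN2.
  apply: rint_le; [exact: intg_sub jw1|by apply: intg_sub (ac_intg acv)|].
  by move=> y /andP[xy y1]; apply: w1v; rewrite y1 (le_trans x0).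
have wu x : 0 <= x <= 1 -> w x <= u x.
  move=> /[dup] x01 /andP[x0 x1]; rewrite (diff u u1)//; [|exact: prof_ac0 H|exact: prof_u1 H].
  rewrite /w lerD2l lerN2.
  apply: rint_le; [by apply: intg_sub (ac_intg (prof_ac0 H))|exact: intg_sub jw1|].
  by move=> y _.
have w2n x : `|w2 x| <= `|u2 x|.
  rewrite /w2 normrM (_ : u2 x + _ = (1 + Num.sg (u1 x)) * u2 x); last by ring.
  rewrite normrM mulrA -[leRHS]mul1r ler_wpM2r// -normrM.
  by case: sgrP => _; rewrite ?addr0 ?subrr ?mulr0 ?normr0// ?mulr1 ger0_norm//; lra.
have Hw : profile alpha w w1 w2.
  split=> //.
  - apply: (@intg_le _ _ _ _ (fun x => u2 x ^+ 2)); last 2 first.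
    + exact: prof_L2 H.
    + move=> x _; rewrite normrX -(real_normK (num_real (u2 x))) lerXn2r// ?nnegrE//.
    by apply: measurable_funX; exact: intg_meas (ac_intg acw1).
  - by move=> x x01; apply: lt_le_trans (vw _ x01); apply: lt_le_trans (vc _ x01).
  - by rewrite /w rint_same subr0.
  - by rewrite w1E (prof_d0 H) maxxx.
  - by rewrite w1E (prof_d1 H) maxxx.
exists w, w1, w2; split=> //; last by move=> x x01; rewrite w10 w1v.
rewrite (energy_lag eps Hw) (energy_lag eps H).
apply: rint_le; [exact: prof_intg_lag Hw|exact: prof_intg_lag H|].
move=> x x01.
have cw : c0 <= w x := le_trans (vc _ x01) (vw _ x01).
have w0 : 0 < w x := lt_le_trans c00 cw.
have u0 : 0 < u x := lt_le_trans w0 (wu _ x01).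
have s1 := sl_ge1 (w1 x); have s2 := sl_le (w1n x).
rewrite /lag lerD//.
  apply: recip_linear_le; first by rewrite mulr_gt0// sl_gt0.
    apply: le_trans ec _; rewrite ler_wpM2l ?mulr_ge0//.
    have cz : c0 <= w x * sl (w1 x) by rewrite (le_trans cw)// ler_peMr// ltW.
    by rewrite lerXn2r// nnegrE ?(ltW c00)// (le_trans (ltW c00)).
  by rewrite ler_pM ?sqrtr_ge0 ?wu// ltW.
have w2n2 : w2 x ^+ 2 <= u2 x ^+ 2.
  by rewrite -(real_normK (num_real (w2 x))) -(real_normK (num_real (u2 x))) lerXn2r ?nnegrE.
(* For u' >= 0 the slope is unchanged and only u shrinks in the coefficient; for u' < 0 the new
   second derivative is 0 and the quadratic term disappears. *)
have [u1x|u1x] := lerP 0 (u1 x).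
  have e1 : w1 x = u1 x by rewrite w1E; apply/max_idPr.
  rewrite e1 ler_pM ?sqr_ge0//; first by rewrite divr_ge0 ?exprn_ge0 ?sqrtr_ge0// ltW.
  by rewrite ler_pM2r ?wu// invr_gt0 exprn_gt0// sl_gt0.
have -> : w2 x = 0 by rewrite /w2 ltr0_sg//; ring.
by rewrite expr0n mulr0 mulr_ge0 ?sqr_ge0// divr_ge0 ?exprn_ge0 ?sqrtr_ge0// ltW.
Qed.

End HalfProblem.

(** * Hyperbolic functions *)

Section LastZero.
Context {R : realType}.
Implicit Types (a b c x y e : R) (f g : R -> R).

Lemma cont_ed a b f x e : cont a b f -> a <= x <= b -> 0 < e ->
  exists2 d : R, 0 < d & forall y, a <= y <= b -> `|y - x| < d -> `|f y - f x| < e.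
Proof.
move=> /contP cf xab e0; have /cvgrPdist_lt/(_ e e0) := cf x xab.
rewrite near_withinE => /nbhs_ballP[d /= d0 h]; exists d => // y yab yx.
rewrite distrC; apply: h; last by rewrite /= in_itv.
by rewrite /ball/= distrC.
Qed.

Lemma ed_cont a b f : (forall x, a <= x <= b -> forall e, 0 < e ->
  exists2 d : R, 0 < d & forall y, a <= y <= b -> `|y - x| < d -> `|f y - f x| <= e) -> cont a b f.
Proof.
move=> h; apply/contP => x xab; apply/cvgrPdist_le => e e0.
have [d d0 hd] := h x xab e e0.
rewrite near_withinE; apply/nbhs_ballP; exists d => //= y xy /=.
by rewrite in_itv/= distrC => yab; apply: hd => //; rewrite distrC.
Qed.

(** The supremum of the points where g >= 0: continuity excludes both signs of g there. *)
Lemma last_zero a b g : a <= b -> cont a b g -> 0 <= g a -> g b < 0 ->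
  exists z, [/\ a <= z < b, g z = 0 & forall x, z < x <= b -> g x < 0].
Proof.
move=> ab cg ga gb.
pose Z : set R := [set x | a <= x <= b /\ 0 <= g x].
have Za : Z a by rewrite /Z/= lexx.
have ubZ : ubound Z b by move=> x [/andP[]].
have hZ : has_sup Z by split; [exists a|exists b].
pose z : R := sup Z.
have az : a <= z by apply: ub_le_sup Za; exists b.
have zb : z <= b by apply: ge_sup => //; exists a.
have zab : a <= z <= b by rewrite az.
have gz0 : 0 <= g z.
  rewrite leNgt; apply/negP => gz.
  have [|d d0 hd] := @cont_ed a b g z (- g z) cg zab; first by rewrite oppr_gt0.
  have [y [yab gy] zy] := sup_adherent d0 hZ.
  have yz : y <= z by apply: ub_le_sup => //; exists b.
  have : `|g y - g z| < - g z by rewrite -/z in zy; apply: hd => //; rewrite ler0_norm; lra.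
  by rewrite ger0_norm; lra.
have above x : z < x <= b -> g x < 0.
  move=> /andP[zx xb]; rewrite ltNge; apply/negP => gx.
  have : x <= z; last by rewrite leNgt zx.
  apply: ub_le_sup; first by exists b.
  by split => //; rewrite xb (le_trans az)// ltW.
have zltb : z < b.
  by rewrite lt_neqAle zb andbT; apply/eqP => e; move: gb; rewrite -e ltNge gz0.
exists z; split => //; first by rewrite az.
apply/eqP; rewrite eq_le gz0 andbT leNgt; apply/negP => gz.
have [d d0 hd] := @cont_ed a b g z (g z) cg zab gz.
pose x := Num.min b (z + d / 2).
have x1 : z < x by rewrite lt_min zltb ltrDl divr_gt0.
have x2 : x <= b by rewrite ge_min lexx.
have x3 : x <= z + d / 2 by rewrite ge_min lexx orbT.
have gx := above x; rewrite x1 x2 in gx.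
have : `|g x - g z| < g z by apply: hd; rewrite ?gtr0_norm; lra.
by rewrite ltr0_norm; have := gx isT; lra.
Qed.

Lemma first_zero a b g : a <= b -> cont a b g -> g a < 0 -> 0 <= g b ->
  exists z, [/\ a < z <= b, g z = 0 & forall x, a <= x < z -> g x < 0].
Proof.
move=> ab cg ga gb; pose f x := g (a + b - x).
have cf : cont a b f.
  apply: ed_cont => x xab e e0.
  have xab' : a <= a + b - x <= b by lra.
  have [d d0 hd] := @cont_ed a b g (a + b - x) e cg xab' e0.
  exists d => // y yab yx; apply/ltW/hd; first by lra.
  by rewrite (_ : _ - _ = x - y) 1?distrC//; ring.
have e1 : a + b - a = b by ring.
have e2 : a + b - b = a by ring.
have [||z [zab gz h]] := last_zero ab cf; rewrite /f ?e1 ?e2//.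
exists (a + b - z); split => //; first by lra.
move=> x xab; have := h (a + b - x); rewrite /f (_ : a + b - (a + b - x) = x); last by ring.
by apply; lra.
Qed.

Lemma cont_comp_cont a b c d f g : cont a b g -> (forall x, a <= x <= b -> c <= g x <= d) ->
  cont c d f -> cont a b (fun x => f (g x)).
Proof.
move=> cg gcd cf; apply: ed_cont => x xab e e0.
have [d1 d10 h1] := cont_ed cf (gcd _ xab) e0.
have [d2 d20 h2] := cont_ed cg xab d10.
exists d2 => // y yab yx; apply/ltW/h1; first exact: gcd.
exact: h2.
Qed.

End LastZero.

Section Hyperbolic.
Context {R : realType}.
Implicit Types (a b c x y p q k e t : R) (f g : R -> R).

Definition sinh x : R := (expR x - expR (- x)) / 2.

Lemma cosh_sqr x : cosh x ^+ 2 = 1 + sinh x ^+ 2.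
Proof.
have : expR x * expR (- x) = 1 by rewrite -expRD subrr expR0.
by rewrite /cosh /sinh => h; field: h.
Qed.

Lemma isd_cosh f x (df : R) : isd f x df -> isd (fun y => cosh (f y)) x (sinh (f x) * df).
Proof. by move=> h; rewrite /cosh /sinh; apply: isd_eq; [der|rewrite /=; field]. Qed.

Lemma isd_sinh f x (df : R) : isd f x df -> isd (fun y => sinh (f y)) x (cosh (f x) * df).
Proof. by move=> h; rewrite /cosh /sinh; apply: isd_eq; [der|rewrite /=; field]. Qed.

Lemma cosh_gt0 x : 0 < cosh x.
Proof. by rewrite divr_gt0// addr_gt0// expR_gt0. Qed.

Lemma cosh_neq0 x : cosh x != 0.
Proof. by rewrite gt_eqF// cosh_gt0. Qed.

Lemma cosh0 : cosh 0 = 1 :> R.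
Proof. by rewrite /cosh oppr0 expR0; field. Qed.

Lemma sinh0 : sinh 0 = 0.
Proof. by rewrite /sinh oppr0 subrr mul0r. Qed.

Lemma coshN x : cosh (- x) = cosh x.
Proof. by rewrite /cosh opprK addrC. Qed.

Lemma cosh_ge1 x : 1 <= cosh x.
Proof.
have h1 := cosh_sqr x; have h2 := cosh_gt0 x; have h3 := sqr_ge0 (sinh x).
nra.
Qed.

Lemma sl_sinh x : sl (sinh x) = cosh x.
Proof. by rewrite /sl -cosh_sqr sqrtr_sqr ger0_norm// ltW// cosh_gt0. Qed.

Lemma sinh_lt x y : x < y -> sinh x < sinh y.
Proof.
by move=> xy; rewrite ltr_pM2r// ltrB// ltr_expR// ltrN2.
Qed.

Lemma sinh_le x y : x <= y -> sinh x <= sinh y.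
Proof. by rewrite le_eqVlt => /predU1P[->//|/sinh_lt/ltW]. Qed.

Lemma sinh_gt0 x : 0 < x -> 0 < sinh x.
Proof. by move=> /sinh_lt; rewrite sinh0. Qed.

Lemma sinh_ge0 x : 0 <= x -> 0 <= sinh x.
Proof. by move=> /sinh_le; rewrite sinh0. Qed.

Lemma cosh_continuous : continuous (@cosh R).
Proof. by move=> x; exact: is_derive_continuous (isd_cosh (isd_id x)). Qed.

Lemma sinh_continuous : continuous sinh.
Proof. by move=> x; exact: is_derive_continuous (isd_sinh (isd_id x)). Qed.

(** A point (x, y) of the catenary y = c cosh(x / c) with t = x / c satisfies x / y = hrat t;
    inverting [hrat] finds the leaf through a given point. *)
Definition hrat t : R := t / cosh t.

Definition hrat' t : R := (cosh t - t * sinh t) / cosh t ^+ 2.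

Lemma isd_hrat t : isd hrat t (hrat' t).
Proof.
have h := isd_cosh (isd_id t).
apply: isd_eq; first by apply: isdM; [exact: isd_id|apply: isdV; [exact: cosh_neq0|exact: h]].
by rewrite /hrat'/=; field; rewrite cosh_neq0.
Qed.

(** Written in exponentials this is a positive combination for |t| <= 1. The maximum of [hrat] lies
    further out, at t tanh t = 1, but [-1, 1] already contains the parameters that occur. *)
Lemma cosh_sub_gt0 t : -1 <= t <= 1 -> 0 < cosh t - t * sinh t.
Proof.
move=> /andP[t1 t2].
have -> : cosh t - t * sinh t = ((1 - t) * expR t + (1 + t) * expR (- t)) / 2.
  by rewrite /cosh /sinh; field.
have e1 := expR_gt0 t; have e2 := expR_gt0 (- t).
by rewrite divr_gt0//; nra.
Qed.

Lemma hrat'_gt0 t : -1 <= t <= 1 -> 0 < hrat' t.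
Proof. by move=> h; rewrite divr_gt0 ?cosh_sub_gt0// exprn_gt0// cosh_gt0. Qed.

Lemma hrat_lt s t : -1 <= s -> s < t -> t <= 1 -> hrat s < hrat t.
Proof.
move=> s1 st t1; apply: derive_gt0_lt st (fun x _ => isd_hrat x) _ _.
  by move=> x /andP[sx xt]; apply: hrat'_gt0; lra.
exact: is_derive_cont isd_hrat.
Qed.

Lemma hrat_inj s t : -1 <= s <= 1 -> -1 <= t <= 1 -> hrat s = hrat t -> s = t.
Proof.
move=> /andP[s1 s2] /andP[t1 t2]; case: (ltgtP s t) => // h.
  by have := hrat_lt s1 h t2 => /[swap] ->; rewrite ltxx.
by have := hrat_lt t1 h s2 => /[swap] ->; rewrite ltxx.
Qed.

Lemma hrat_le s t : -1 <= s -> s <= t -> t <= 1 -> hrat s <= hrat t.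
Proof. by move=> s1; rewrite le_eqVlt => /predU1P[->//|st] t1; rewrite ltW// hrat_lt. Qed.

Lemma hratN t : hrat (- t) = - hrat t.
Proof. by rewrite /hrat coshN mulNr. Qed.

Lemma hrat0 : hrat 0 = 0. Proof. by rewrite /hrat mul0r. Qed.

(** The inverse of [hrat] restricted to [-1, 1], where it is increasing; 0 is only the default
    outside the range. *)
Definition hinv y : R := xget 0 [set t | -1 <= t <= 1 /\ hrat t = y].

Lemma hinvP y : - hrat 1 <= y <= hrat 1 -> -1 <= hinv y <= 1 /\ hrat (hinv y) = y.
Proof.
move=> /andP[y1 y2]; apply: (@xgetPex _ 0 [set t | -1 <= t <= 1 /\ hrat t = y]).
have [] := @IVT R hrat (-1) 1 y _ _ _.
- by lra.
- exact: is_derive_cont isd_hrat.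
- rewrite hratN; have h : - hrat 1 <= hrat 1 by exact: le_trans y1 y2.
  by rewrite (min_idPl h) (max_idPr h) y1.
- by move=> c; rewrite in_itv/= => c1 hc; exists c.
Qed.

Lemma hratK t : -1 <= t <= 1 -> hinv (hrat t) = t.
Proof.
move=> /[dup] t01 /andP[t0 t1].
have h : - hrat 1 <= hrat t <= hrat 1 by rewrite -hratN !hrat_le//; lra.
have [a b] := hinvP h; exact: hrat_inj.
Qed.

Lemma isd_hinv y : - hrat 1 < y < hrat 1 -> isd hinv y (hrat' (hinv y))^-1.
Proof.
move=> /andP[y1 y2]; have [|a b] := @hinvP y; first by rewrite !ltW.
have t1 : hinv y != 1 by apply: contraTneq y2 => e; rewrite -b e ltxx.
have t2 : hinv y != -1 by apply: contraTneq y1 => e; rewrite -b e hratN ltxx.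
have ti : -1 < hinv y < 1 by move: a; rewrite !lt_neqAle t1 eq_sym t2.
rewrite -{1}b; apply: is_derive_inverse.
- by apply: filterS (near_oo ti) => z /andP[z1 z2]; apply: hratK; rewrite !ltW.
- apply: filterS (near_oo ti) => z _; exact: is_derive_continuous (isd_hrat z).
- exact: isd_hrat.
- by rewrite gt_eqF// hrat'_gt0.
Qed.

Lemma cont_hinv : cont (- hrat 1) (hrat 1) hinv.
Proof.
rewrite -hratN; apply: segment_can_le_continuous.
- by lra.
- exact: is_derive_cont isd_hrat.
- by move=> x; rewrite in_itv/=; exact: hratK.
Qed.

End Hyperbolic.

(** * Replacing a profile by a catenary *)

Section Glue.
Context {R : realType}.
Notation mu := (@lebesgue_measure R).
Implicit Types (a b c x y e : R) (f g F G : R -> R).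

Definition glue b f F x : R := if x <= b then f x else F x.

Lemma intg_glue a b c g G : a <= b -> b <= c -> intg a b g -> intg b c G -> intg a c (glue b g G).
Proof.
move=> ab bc jg jG.
have j1 : intg a b (glue b g G).
  by apply: intg_eq jg => x /andP[_ xb]; rewrite /glue xb.
have j2 : mu.-integrable `]b, c] (EFin \o glue b g G).
  have j3 : mu.-integrable `]b, c] (EFin \o G).
    by apply: integrableS jG => //; apply: subset_itvr; rewrite bnd_simp.
  apply: eq_integrable j3 => // x; rewrite inE/= in_itv/= => /andP[bx _].
  by rewrite /glue leNgt bx.
rewrite /intg (@itv_bndbnd_setU _ _ (BLeft a) (BRight b) (BRight c)); last 2 first.
- by rewrite bnd_simp.
- by rewrite bnd_simp.
apply/integrableP; split.
  apply/measurable_funU => //; split; first by case/integrableP : j1.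
  by case/integrableP : j2.
have m1 : measurable_fun `[a, b] (EFin \o glue b g G) by case/integrableP : j1.
have m2 : measurable_fun `]b, c] (EFin \o glue b g G) by case/integrableP : j2.
rewrite ge0_integral_setU//=.
- by rewrite lte_add_pinfty//; [case/integrableP : j1|case/integrableP : j2].
- apply/measurable_EFinP; apply: measurableT_comp => //; apply/measurable_funU => //.
  by split; apply/measurable_EFinP.
- rewrite disj_set2E; apply/eqP/seteqP; split => // x /= [].
  by rewrite !in_itv/= => /andP[_ xb] /andP[]; rewrite ltNge xb.
Qed.

Lemma rint_glue a b c g G : a <= b -> b <= c -> intg a b g -> intg b c G ->
  rint a c (glue b g G) = rint a b g + rint b c G.
Proof.
move=> ab bc jg jG; have j := intg_glue ab bc jg jG.
rewrite (rint_chasles ab bc j); congr (_ + _).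
  by apply: rint_eq => x /andP[_ xb]; rewrite /glue xb.
rewrite /rint -[LHS]Rintegral_itv_obnd_cbnd; last first.
  by apply: integrableS j => //; apply: subset_itv; rewrite bnd_simp.
rewrite -[RHS]Rintegral_itv_obnd_cbnd; last first.
  by apply: integrableS jG => //; apply: subset_itvr; rewrite bnd_simp.
apply: eq_Rintegral => x; rewrite inE/= in_itv/= => /andP[bx _].
by rewrite /glue leNgt bx.
Qed.

(** Matching values at the seam suffice; the densities may jump, as u'' may when a catenary is glued
    in. *)
Lemma ac_glue a b c f g F G : a <= b -> b <= c -> ac a b f g -> ac b c F G -> f b = F b ->
  ac a c (glue b f F) (glue b g G).
Proof.
move=> ab bc h H e; split.
  exact: (intg_glue ab bc (ac_intg h) (ac_intg H)).
move=> x /andP[ax xc]; rewrite {1 2}/glue ab.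
have [xb|bx] := leP x b.
  rewrite (@rint_eq _ _ _ _ g); last first.
    by move=> y /andP[_ yx]; rewrite /glue (le_trans yx).
  by have [_ ->] := h; rewrite ?ax.
rewrite rint_glue ?(ltW bx)//; last 2 first.
- exact: ac_intg h.
- by apply: intg_sub (ac_intg H).
have [_ Hx] := H; rewrite (Hx x) ?(ltW bx)//= -e.
by have [_ hb] := h; rewrite (hb b) ?lexx ?ab//; ring.
Qed.

End Glue.

Section Catenary.
Context {R : realType}.

Lemma cont_min (a b : R) f g : cont a b f -> cont a b g -> cont a b (fun x => Num.min (f x) (g x)).
Proof.
move=> cf cg; under eq_fun do rewrite minr_absE.
apply: contM; last exact: cont_cst.
apply: contB; first exact: contD.
by apply: (@cont_comp _ a b (fun x => f x - g x) (fun t => `|t|)); [move=> *; exact: norm_continuous|exact: contB].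
Qed.

Lemma cont_max (a b : R) f g : cont a b f -> cont a b g -> cont a b (fun x => Num.max (f x) (g x)).
Proof.
move=> cf cg; under eq_fun do rewrite maxr_absE.
apply: contM; last exact: cont_cst.
apply: contD; first exact: contD.
by apply: (@cont_comp _ a b (fun x => f x - g x) (fun t => `|t|)); [move=> *; exact: norm_continuous|exact: contB].
Qed.

Notation mu := (@lebesgue_measure R).
Implicit Types (a b c x y p q k e t tm : R).

Lemma isd_vcat c x : c != 0 -> isd (vcat c) x (sinh (x / c)).
Proof.
move=> c0; have h : isd (fun y => y / c) x (1 / c).
  by apply: isd_eq; [der|rewrite mulr0 addr0].
apply: isd_eq; first by apply: (@isdM _ (fun=> c) (fun y => cosh (y / c))); [exact: isd_cst|exact: isd_cosh h].
by rewrite /=; field.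
Qed.

Lemma vcat_ge c x : 0 < c -> c <= vcat c x.
Proof. by move=> c0; rewrite /vcat ler_peMr ?cosh_ge1// ltW. Qed.

Lemma vcat_arc c x : 0 < c -> 0 <= x ->
  rint 0 x (fun y => vcat c y * sl (sinh (y / c))) =
  c ^+ 2 / 2 * (x / c + sinh (x / c) * cosh (x / c)).
Proof.
move=> c0 x0; have cN : c != 0 by rewrite gt_eqF.
have h y : isd (fun y => y / c) y (1 / c).
  by apply: isd_eq; [der|rewrite mulr0 addr0].
pose F y := c ^+ 2 / 2 * (y / c + sinh (y / c) * cosh (y / c)).
have dF y : isd F y (vcat c y * sl (sinh (y / c))).
  have h1 := isd_sinh (h y); have h2 := isd_cosh (h y).
  rewrite /F; apply: isd_eq; first by der.
  rewrite sl_sinh /vcat/=.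
  have e := cosh_sqr (y / c).
  have e' : sinh (y / c) ^+ 2 = cosh (y / c) ^+ 2 - 1 by rewrite e; ring.
  field: e' => //.
rewrite (@rint_FTC _ 0 x _ F)//.
- by rewrite /F mul0r sinh0 mul0r addr0 mulr0 subr0.
- have cc : cont 0 x (fun y => cosh (y / c)).
    by apply: (is_derive_cont (df := fun y => sinh (y / c) * (1 / c))) => y; exact: isd_cosh (h y).
  under eq_fun do rewrite sl_sinh.
  by apply: contM => //; apply: contM => //; exact: cont_cst.
- exact: is_derive_cont dF.
Qed.

(** * The foliation by catenaries and its calibration *)

Section Leaf.
Context (alpha : R) (u u1 u2 : R -> R) (H : profile alpha u u1 u2).

Definition xratio x := x / u x.
(** Parameter of the leaf through (x, u x). The minimum keeps the argument in the domain of the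
    inverse, so [tau] is continuous on [0, 1] even where the curve leaves the foliated cone. *)
Definition tau x := hinv (Num.min (xratio x) (hrat 1)).
(** The scale c of the leaf through (x, u x). *)
Definition leaf x := u x / cosh (tau x).
(** Area, up to the factor 2 pi, of that leaf between 0 and x: the formula of [vcat_arc] with c = u
    / cosh tau. *)
Definition pot x := u x ^+ 2 / 2 * ((tau x + sinh (tau x) * cosh (tau x)) / cosh (tau x) ^+ 2).

Let u_gt0 x : 0 <= x <= 1 -> 0 < u x. Proof. exact: (prof_gt0 H). Qed.

Lemma xratio_ge0 x : 0 <= x <= 1 -> 0 <= xratio x.
Proof. by move=> /[dup] /u_gt0 u0 /andP[x0 _]; rewrite divr_ge0// ltW. Qed.

Lemma cont_xratio : cont 0 1 xratio.
Proof.
apply: contM; first exact: cont_id.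
by apply: contV; [move=> x /u_gt0 h; rewrite gt_eqF|exact: prof_cont H].
Qed.

Lemma hrat1_gt0 : 0 < hrat 1 :> R.
Proof. by rewrite divr_gt0// cosh_gt0. Qed.

Lemma tau_bnd x : 0 <= x <= 1 -> - hrat 1 <= Num.min (xratio x) (hrat 1) <= hrat 1.
Proof.
move=> /xratio_ge0 h; have h1 := hrat1_gt0.
by rewrite ge_min lexx orbT andbT le_min; apply/andP; split; lra.
Qed.

Lemma cont_tau : cont 0 1 tau.
Proof.
apply: (@cont_comp_cont _ 0 1 (- hrat 1) (hrat 1) hinv); last exact: cont_hinv.
  by apply: cont_min; [exact: cont_xratio|exact: cont_cst].
exact: tau_bnd.
Qed.

Lemma tauP x : 0 <= x <= 1 -> xratio x <= hrat 1 ->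
  [/\ 0 <= tau x <= 1, hrat (tau x) = xratio x & x * cosh (tau x) = tau x * u x].
Proof.
move=> /[dup] x01 /[dup] /u_gt0 u0 /andP[x0 x1] h.
have [] := hinvP (tau_bnd x01); rewrite -/(tau x) (min_idPl h) => /andP[t1 t2] e.
split=> //.
  rewrite t2 andbT leNgt; apply/negP => t0.
  have := hrat_lt t1 t0 ler01; rewrite hrat0 e ltNge xratio_ge0//.
move: e; rewrite /hrat /xratio => /eqP; rewrite eqr_div ?cosh_neq0// ?(gt_eqF u0)//.
by move=> /eqP ->.
Qed.

Lemma isd_xratio x : 0 < x < 1 -> isd xratio x ((u x - x * u1 x) / u x ^+ 2).
Proof.
move=> x01; have du := prof_isd H x01.
have u0 : u x != 0 by rewrite gt_eqF// u_gt0//; lra.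
by rewrite /xratio; apply: isd_eq; [der|rewrite /=; field].
Qed.

Lemma isd_tau x : 0 < x < 1 -> xratio x < hrat 1 ->
  isd tau x (cosh (tau x) * (cosh (tau x) - tau x * u1 x) /
             (u x * (cosh (tau x) - tau x * sinh (tau x)))).
Proof.
move=> x01 r1; have x01' : 0 <= x <= 1 by lra.
have u0 := u_gt0 x01'.
have [/andP[t0 t1] th tx] := tauP x01' (ltW r1).
have h1 := hrat1_gt0; have r0 := xratio_ge0 x01'.
have te : tau x = hinv (xratio x) by rewrite /tau (min_idPl (ltW r1)).
have d1 : isd hinv (xratio x) (hrat' (hinv (xratio x)))^-1.
  by apply: isd_hinv; lra.
have d2 := isd_comp d1 (isd_xratio x01).
have nr : \near x, xratio x < hrat 1.
  have cr := cont_for cont_xratio x01.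
  exact: (cvgr_lt (xratio x) cr _ r1).
apply: (@isd_near _ (fun y => hinv (xratio y))).
  by apply: filterS nr => y yr; rewrite /tau (min_idPl (ltW yr)).
apply: isd_eq d2 _; rewrite -te /hrat'.
have ex : x = tau x * u x / cosh (tau x) by rewrite -tx mulfK ?cosh_neq0.
have k0 : cosh (tau x) - tau x * sinh (tau x) != 0.
  by rewrite gt_eqF// cosh_sub_gt0//; lra.
rewrite [in X in _ * ((_ - X * _) / _)]ex; field.
by rewrite k0 cosh_neq0 gt_eqF.
Qed.

(** The denominator is positive, so the sign of u' - sinh tau decides whether the curve moves to
    leaves of larger or smaller scale. *)
Lemma isd_leaf x : 0 < x < 1 -> xratio x < hrat 1 ->
  isd leaf x ((u1 x - sinh (tau x)) / (cosh (tau x) - tau x * sinh (tau x))).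
Proof.
move=> x01 r1; have x01' : 0 <= x <= 1 by lra.
have u0 := u_gt0 x01'.
have [t01 th tx] := tauP x01' (ltW r1).
have dt := isd_cosh (isd_tau x01 r1).
have du := prof_isd H x01.
have k0 : cosh (tau x) - tau x * sinh (tau x) != 0.
  by rewrite gt_eqF// cosh_sub_gt0//; lra.
rewrite /leaf; apply: isd_eq.
  by der; exact: cosh_neq0.
by rewrite /=; field; rewrite k0 cosh_neq0 gt_eqF.
Qed.

Lemma isd_pot x : 0 < x < 1 -> xratio x < hrat 1 ->
  isd pot x (u x * (1 + u1 x * sinh (tau x)) / cosh (tau x)).
Proof.
move=> x01 r1; have x01' : 0 <= x <= 1 by lra.
have u0 := u_gt0 x01'.
have [t01 th tx] := tauP x01' (ltW r1).
have dt0 := isd_tau x01 r1.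
have dt := isd_cosh dt0; have ds := isd_sinh dt0.
have du := prof_isd H x01.
have k0 : cosh (tau x) - tau x * sinh (tau x) != 0.
  by rewrite gt_eqF// cosh_sub_gt0//; lra.
rewrite /pot; apply: isd_eq.
  by der; rewrite expf_neq0// cosh_neq0.
have e' : sinh (tau x) ^+ 2 = cosh (tau x) ^+ 2 - 1 by rewrite cosh_sqr; ring.
by rewrite /=; field: e'; rewrite k0 cosh_neq0 gt_eqF.
Qed.

Lemma cont_cosh_tau : cont 0 1 (fun x => cosh (tau x)).
Proof. by apply: cont_comp cont_tau => x _; exact: cosh_continuous. Qed.

Lemma cont_sinh_tau : cont 0 1 (fun x => sinh (tau x)).
Proof. by apply: cont_comp cont_tau => x _; exact: sinh_continuous. Qed.

Lemma cont_leaf : cont 0 1 leaf.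
Proof.
apply: contM; first exact: prof_cont H.
by apply: contV; [move=> *; exact: cosh_neq0|exact: cont_cosh_tau].
Qed.

Lemma cont_pot : cont 0 1 pot.
Proof.
apply: contM.
  by apply: contM; [apply: contX; exact: prof_cont H|exact: cont_cst].
apply: contM.
  apply: contD; first exact: cont_tau.
  by apply: contM; [exact: cont_sinh_tau|exact: cont_cosh_tau].
by apply: contV; [move=> *; rewrite expf_neq0// cosh_neq0|apply: contX; exact: cont_cosh_tau].
Qed.

Lemma cont_arc : cont 0 1 (fun x => u x * sl (u1 x)).
Proof. by apply: contM; [exact: prof_cont H|apply: cont_sl; exact: prof_cont1 H]. Qed.

Definition arc x := rint 0 x (fun y => u y * sl (u1 y)).

Lemma isd_arc x : 0 < x < 1 -> isd arc x (u x * sl (u1 x)).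
Proof.
move=> x01; have h := cont_for cont_arc x01.
exact: rint_derive (cont_intg cont_arc) x01 h.
Qed.

Lemma cont_arcfun : cont 0 1 arc.
Proof. exact: rint_cont (cont_intg cont_arc). Qed.

(* The leaves c cosh (x / c) foliate the region xratio < hrat 1, and u / cosh tau (1, sinh tau), the
   gradient of pot, has Euclidean length u: pot is a calibration. *)
Lemma arc_pot_le a b : 0 <= a -> a <= b -> b <= 1 -> (forall x, a < x < b -> xratio x < hrat 1) ->
  arc a - pot a <= arc b - pot b.
Proof.
move=> a0 ab b1 hr.
apply: (@derive_ge0_le _ a b (fun x => arc x - pot x)
  (fun x => u x * sl (u1 x) - u x * (1 + u1 x * sinh (tau x)) / cosh (tau x))) => //.
- move=> x xab; have x01 : 0 < x < 1 by lra.
  have h1 := isd_arc x01; have h2 := isd_pot x01 (hr _ xab).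
  by der.
- move=> x xab; have u0 : 0 < u x by apply: u_gt0; lra.
  rewrite -mulrA -mulrBr mulr_ge0 ?(ltW u0)// subr_ge0 ler_pdivrMr ?cosh_gt0//.
  set p := u1 x; set s := sinh (tau x).
  have k0 := cosh_gt0 (tau x); have s0 := sl_gt0 p.
  (* Cauchy-Schwarz for the vectors (1, p) and (1, s). *)
  have [h|h] := lerP (1 + p * s) 0; first by rewrite (le_trans h)// mulr_ge0// ltW.
  rewrite -ler_sqr ?nnegrE ?mulr_ge0 ?(ltW h) ?(ltW k0) ?(ltW s0)//.
  rewrite exprMn sl_sqr cosh_sqr -/s -subr_ge0.
  by have -> : (1 + p ^+ 2) * (1 + s ^+ 2) - (1 + p * s) ^+ 2 = (p - s) ^+ 2; [ring|exact: sqr_ge0].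
- apply: (@cont_sub _ 0 1) => //.
  by apply: contB; [exact: cont_arcfun|exact: cont_pot].
Qed.

(** Comparison with flat annuli: u sqrt(1 + u'^2) >= u u', the derivative of u^2 / 2. *)
Lemma arc_sqr_le a b : 0 <= a -> a <= b -> b <= 1 ->
  arc a - u a ^+ 2 / 2 <= arc b - u b ^+ 2 / 2.
Proof.
move=> a0 ab b1.
apply: (@derive_ge0_le _ a b (fun x => arc x - u x ^+ 2 / 2)
  (fun x => u x * sl (u1 x) - u x * u1 x)) => //.
- move=> x xab; have x01 : 0 < x < 1 by lra.
  have h1 := isd_arc x01; have h2 := prof_isd H x01.
  by apply: isd_eq; [der|rewrite /=; field].
- move=> x xab; have u0 : 0 < u x by apply: u_gt0; lra.
  rewrite -mulrBr mulr_ge0 ?(ltW u0)// subr_ge0 (le_trans (ler_norm _))//.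
  exact: norm_le_sqrtD.
- apply: (@cont_sub _ 0 1) => //.
  apply: contB; first exact: cont_arcfun.
  by apply: contM; [apply: contX; exact: prof_cont H|exact: cont_cst].
Qed.

(* On the ray xratio = hrat tm the catenary bounds as much area as the Goldschmidt solution:
   pot = u^2/2 there. *)
Lemma pot_goldschmidt tm x : 0 <= x <= 1 -> 0 < tm < 1 -> 2 * tm = 1 + expR (- (2 * tm)) ->
  xratio x = hrat tm -> pot x = u x ^+ 2 / 2.
Proof.
move=> x01 t01 ht rx.
have -> : pot x = u x ^+ 2 / 2 * ((tm + sinh tm * cosh tm) / cosh tm ^+ 2).
  rewrite /pot (_ : tau x = tm)// /tau rx (min_idPl _); last by apply: hrat_le; lra.
  by apply: hratK; lra.
suff -> : tm + sinh tm * cosh tm = cosh tm ^+ 2.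
  by rewrite divff ?mulr1// expf_neq0// cosh_neq0.
have e1 : expR tm * expR (- tm) = 1 by rewrite -expRD subrr expR0.
have e2 : expR (- (2 * tm)) = expR (- tm) ^+ 2.
  by rewrite -expRM_natl; congr expR; ring.
rewrite e2 in ht; rewrite /cosh /sinh.
have ht' : tm = (1 + expR (- tm) ^+ 2) / 2 by rewrite -ht; field.
by rewrite {1}ht'; field: e1.
Qed.

(** A curve that stays in the cone xratio < hrat tm is calibrated throughout. Otherwise it is
    calibrated up to its first point on the boundary ray and after its last one, and compared with
    flat annuli in between; the bounds fit together because pot = u^2 / 2 on the ray. *)
Lemma pot_le_arc tm x : 0 <= x <= 1 -> 0 < tm < 1 -> 2 * tm = 1 + expR (- (2 * tm)) ->
  xratio x <= hrat tm -> pot x <= arc x.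
Proof.
move=> /[dup] x01 /andP[x0 x1] t01 ht rx.
have p0 : pot 0 = 0.
  have [||_ _] := @tauP 0; first by rewrite lexx ler01.
    by rewrite /xratio mul0r ltW// hrat1_gt0.
  rewrite mul0r => /esym/eqP; rewrite mulf_eq0 [u 0 == 0]gt_eqF ?orbF; last first.
    by apply: u_gt0; rewrite lexx ler01.
  by move=> /eqP e; rewrite /pot e sinh0 mul0r addr0 mul0r mulr0.
have a0 : arc 0 = 0 by rewrite /arc rint_same.
have htm : hrat tm < hrat 1 by apply: hrat_lt; lra.
have htm0 : 0 < hrat tm by rewrite divr_gt0 ?cosh_gt0//; lra.
pose g y := xratio y - hrat tm.
have cg a b : 0 <= a -> b <= 1 -> cont a b g.
  move=> ha hb; apply: contB; last exact: cont_cst.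
  exact: cont_sub cont_xratio.
have [[y [yx gy]]|hno] := pselect (exists y, 0 <= y <= x /\ 0 <= g y); last first.
  have := @arc_pot_le 0 x (lexx 0) x0 x1; rewrite p0 a0 subrr subr_ge0; apply.
  move=> z zx; rewrite ltNge; apply/negP => hz; apply: hno; exists z.
  by split; [lra|rewrite /g; lra].
have y0 : 0 <= y by lra.
have [|||z1 [z1y gz1 hz1]] := first_zero y0 (cg 0 y (lexx 0) _); [lra| |exact: gy|].
  by rewrite /g /xratio mul0r sub0r oppr_lt0.
have rz1 : xratio z1 = hrat tm by move: gz1; rewrite /g; lra.
have step1 : arc z1 - pot z1 >= 0.
  have := @arc_pot_le 0 z1 (lexx 0); rewrite p0 a0 subrr; apply; [lra|lra|].
  move=> z hz; have gz : g z < 0 by apply: hz1; lra.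
      by move: gz; rewrite /g; lra.
(* If g x >= 0, the hypothesis on x forces g x = 0, and z2 = x serves. *)
have [z2 [z2y rz2 step3]] : exists z2, [/\ y <= z2 <= x, xratio z2 = hrat tm &
    arc z2 - pot z2 <= arc x - pot x].
  have [gx|gx] := ltP (g x) 0.
    have yx' : y <= x by lra.
    have [||z2 [z2x gz2 hz2]] := last_zero yx' (cg y x _ _) gy gx; [lra|lra|].
    exists z2; split; [lra|by move: gz2; rewrite /g; lra|].
    apply: arc_pot_le; [lra|lra|lra|].
    move=> z hz; have gz : g z < 0 by apply: hz2; lra.
      by move: gz; rewrite /g; lra.
  exists x; split => //; first by lra.
  by move: gx; rewrite /g; lra.
have step2 := @arc_sqr_le z1 z2.
rewrite (pot_goldschmidt _ t01 ht rz1) in step1; last by lra.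
rewrite (pot_goldschmidt _ t01 ht rz2) in step3; last by lra.
have : arc z1 - u z1 ^+ 2 / 2 <= arc z2 - u z2 ^+ 2 / 2 by apply: step2; lra.
lra.
Qed.

(* After the last point x1 where u is tangent to a leaf, u crosses the leaves downwards. *)
Lemma last_tangency c : 0 < c -> c^-1 < 1 -> vcat c 1 = alpha ->
  exists x1 c1, [/\ 0 <= x1 < 1, c <= c1, u x1 = vcat c1 x1, u1 x1 = sinh (x1 / c1) &
    xratio x1 <= hrat c^-1] /\
    pot x1 = c1 ^+ 2 / 2 * (x1 / c1 + sinh (x1 / c1) * cosh (x1 / c1)) /\
    forall x, x1 < x < 1 -> u1 x < sinh (x / c).
Proof.
move=> c0 c1 vc; have ci0 : 0 < c^-1 by rewrite invr_gt0.
(* g < 0 says that the point is strictly inside the cone and that the curve descends through the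
   leaves. At 0 curve and leaf are both horizontal, at 1 only the curve is. *)
pose g x := Num.max (xratio x - hrat 1) (u1 x - sinh (tau x)).
have cg : cont 0 1 g.
  apply: cont_max; apply: contB; [exact: cont_xratio|exact: cont_cst|exact: prof_cont1 H|exact: cont_sinh_tau].
have r1E : xratio 1 = hrat c^-1.
  rewrite /xratio (prof_u1 H) -vc /vcat /hrat div1r invfM mul1r.
  by rewrite mulrC.
have hc : hrat c^-1 < hrat 1 by apply: hrat_lt; lra.
have tau1 : tau 1 = c^-1.
  by rewrite /tau r1E (min_idPl (ltW hc)) hratK//; lra.
have g0 : 0 <= g 0.
  have [||_ _] := @tauP 0; first by rewrite lexx ler01.
    by rewrite /xratio mul0r ltW// hrat1_gt0.
  rewrite mul0r => /esym/eqP; rewrite mulf_eq0 [u 0 == 0]gt_eqF ?orbF; last first.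
    by apply: u_gt0; rewrite lexx ler01.
  by move=> /eqP e; rewrite /g e sinh0 (prof_d0 H) subrr le_max lexx orbT.
have g1 : g 1 < 0.
  rewrite /g gt_max r1E tau1 (prof_d1 H) sub0r oppr_lt0 sinh_gt0// andbT.
  by rewrite subr_lt0.
have [x1 [/andP[x10 x11] gx1 hx1]] := last_zero ler01 cg g0 g1.
have after x : x1 < x <= 1 -> xratio x < hrat 1 /\ u1 x < sinh (tau x).
  by move=> /hx1; rewrite /g gt_max !subr_lt0 => /andP[].
have leaf1 : leaf 1 = c.
  by rewrite /leaf tau1 (prof_u1 H) -vc /vcat div1r mulfK// cosh_neq0.
(* After x1 the scale of the leaf decreases to its value c at 1, so it is at least c before. *)
have mono x y : x1 <= x -> x <= y -> y <= 1 -> leaf y <= leaf x.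
  move=> x1x xy y1; rewrite -lerN2.
  apply: (@derive_ge0_le _ x y (fun z => - leaf z)
     (fun z => - ((u1 z - sinh (tau z)) / (cosh (tau z) - tau z * sinh (tau z))))) => //.
  - move=> z zxy; have [r t] := after z ltac:(lra).
    by have := isd_leaf (x := z) ltac:(lra) r => h; der.
  - move=> z zxy; have [r t] := after z ltac:(lra).
    have [t01 _ _] := @tauP z ltac:(lra) (ltW r).
    have k0 : 0 < cosh (tau z) - tau z * sinh (tau z) by apply: cosh_sub_gt0; lra.
    by rewrite -mulNr divr_ge0 ?(ltW k0)//; lra.
  - by apply: contN; apply: (@cont_sub _ 0 1) cont_leaf; lra.
have leaf_ge x : x1 <= x -> x <= 1 -> c <= leaf x.
  by move=> h1 h2; rewrite -leaf1 mono.
have leafE x : 0 <= x <= 1 -> xratio x <= hrat 1 -> [/\ 0 < leaf x, tau x = x / leaf x & u x = vcat (leaf x) x].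
  move=> xx hr; have [t01 _ e] := tauP xx hr; have u0 := u_gt0 xx.
  have l0 : 0 < leaf x by rewrite divr_gt0// cosh_gt0.
  have te : tau x = x / leaf x by rewrite /leaf invf_div mulrA e mulfK// gt_eqF.
  by split=> //; rewrite /vcat -te /leaf mulfVK// cosh_neq0.
have tau_le x : x1 < x <= 1 -> tau x <= x / c.
  move=> xx; have [r t] := after x xx; have [l0 -> _] := leafE x ltac:(lra) (ltW r).
  have lc : c <= leaf x by apply: leaf_ge; lra.
  by rewrite ler_wpM2l ?lef_pV2 ?posrE//; lra.
have rat_le x : x1 < x <= 1 -> xratio x <= hrat c^-1.
  move=> xx; have [r t] := after x xx; have [t01 <- _] := @tauP x ltac:(lra) (ltW r).
  apply: hrat_le; [lra| |lra]; apply: (le_trans (tau_le x xx)).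
  by rewrite ler_piMl//; lra.
have x1i : 0 <= x1 <= 1 by lra.
(* Passing to the limit, the curve is still strictly inside the cone at x1, so the zero of g there
   comes from the second entry of the maximum: tangency. *)
have ratx1 : xratio x1 <= hrat c^-1.
  rewrite leNgt; apply/negP => h.
  have [|d d0 hd] := @cont_ed _ 0 1 xratio x1 (xratio x1 - hrat c^-1) cont_xratio x1i; first by lra.
  pose x := Num.min 1 (x1 + d / 2).
  have y1 : x1 < x by rewrite lt_min x11 ltrDl divr_gt0.
  have y2 : x <= 1 by rewrite ge_min lexx.
  have y3 : x <= x1 + d / 2 by rewrite ge_min lexx orbT.
  have := rat_le x; rewrite y1 y2 => /(_ isT) hx.
  have : `|xratio x - xratio x1| < xratio x1 - hrat c^-1.
    by apply: hd; rewrite ?gtr0_norm; lra.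
  by rewrite ltr0_norm; lra.
have [l0 te ue] := leafE x1 x1i (le_trans ratx1 (ltW hc)).
exists x1, (leaf x1); split; [split => //|split].
- by rewrite x10.
- by apply: leaf_ge; lra.
- rewrite -te; apply/eqP; rewrite -subr_eq0; move: gx1; rewrite /g maxEle.
  by case: ifP => [_ ->//|_ h]; lra.
- rewrite -te /pot /leaf.
  by field; rewrite cosh_neq0.
- move=> x xx; have [r t] := after x ltac:(lra).
  by apply: (lt_le_trans t); apply: sinh_le; apply: tau_le; lra.
Qed.

End Leaf.

Lemma vcat_gt0 c x : 0 < c -> 0 < vcat c x.
Proof. by move=> c0; rewrite mulr_gt0// cosh_gt0. Qed.

(** The Willmore energy removed on [0, x1] is kept in the inequality, since minimality will force it
    to vanish. On [0, x1] the slope of the inserted leaf is below that of [vcat c] because its scale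
    is larger. *)
Lemma catenary_replace (alpha eps c tm : R) (u u1 u2 : R -> R) : profile alpha u u1 u2 ->
  0 <= eps -> 0 < c -> vcat c 1 = alpha -> 0 < tm < 1 -> 2 * tm = 1 + expR (- (2 * tm)) ->
  c^-1 <= tm ->
  exists x1 w w1 w2, [/\ profile alpha w w1 w2, 0 <= x1 < 1,
    energy eps w w1 w2 + rint 0 x1 (fun x =>
      (1 / (u x * sl (u1 x)) - u2 x / sl (u1 x) ^+ 3) ^+ 2 * u x * sl (u1 x)) <= energy eps u u1 u2,
    forall x, 0 <= x <= 1 -> w1 x <= sinh (x / c) &
    forall x, x1 < x < 1 -> u1 x < sinh (x / c)].
Proof.
move=> H eps0 c0 vc t01 ht ct.
have c1 : c^-1 < 1 by lra.
have [x1 [k [[/andP[x10 x11] ck ux1 u1x1 rx1] [px1 after]]]] := last_tangency H c0 c1 vc.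
have k0 : 0 < k by lra.
have kN : k != 0 by rewrite gt_eqF.
have x1i : 0 <= x1 <= 1 by lra.
pose v1 x := sinh (x / k). pose v2 x := cosh (x / k) / k.
have hk x : isd (fun y => y / k) x (1 / k) by apply: isd_eq; [der|rewrite mulr0 addr0].
have dv1 x : isd v1 x (v2 x) by apply: isd_eq (isd_sinh (hk x)) _; rewrite /v2 div1r.
have dv2 x : isd v2 x (sinh (x / k) / k ^+ 2).
  by have h := isd_cosh (hk x); rewrite /v2; apply: isd_eq; [der|rewrite /=; field].
have dv x : isd (vcat k) x (v1 x) := isd_vcat x kN.
have cv : cont 0 x1 (vcat k) := is_derive_cont dv.
have cv1 : cont 0 x1 v1 := is_derive_cont dv1.
have cv2 : cont 0 x1 v2 := is_derive_cont dv2.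
have acv1 : ac 0 x1 v1 v2 by apply: C1_ac.
have acv : ac 0 x1 (vcat k) v1 by apply: C1_ac.
have x1le : x1 <= 1 by lra.
have acu1 : ac x1 1 u1 u2 by apply: ac_sub (prof_ac1 H).
have acu : ac x1 1 u u1 by apply: ac_sub (prof_ac0 H).
pose w := glue x1 (vcat k) u. pose w1 := glue x1 v1 u1. pose w2 := glue x1 v2 u2.
have Hw : profile alpha w w1 w2.
  split.
  - by apply: ac_glue; rewrite /v1.
  - rewrite (_ : (fun x => w2 x ^+ 2) = glue x1 (fun x => v2 x ^+ 2) (fun x => u2 x ^+ 2)).
      apply: intg_glue => //; first by apply: cont_intg; exact: contX.
      by apply: intg_sub (prof_L2 H).
    by apply/funext => x; rewrite /w2 /glue; case: ifP.
  - by apply: ac_glue.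
  - by move=> x x01; rewrite /w /glue; case: ifP => _; [exact: vcat_gt0|exact: prof_gt0 H _ x01].
  - by rewrite /w /glue leNgt x11 /= (prof_u1 H).
  - by rewrite /w1 /glue x10 /v1 mul0r sinh0.
  - by rewrite /w1 /glue leNgt x11 /= (prof_d1 H).
exists x1, w, w1, w2; split => //; first by rewrite x10.
- have ju := prof_intg_dens eps H.
  have dE : (fun x => dens eps (w x) (w1 x) (w2 x)) =
    glue x1 (fun x => dens eps (vcat k x) (v1 x) (v2 x)) (fun x => dens eps (u x) (u1 x) (u2 x)).
    by apply/funext => x; rewrite /w /w1 /w2 /glue; case: ifP.
  (* The catenoid is a minimal surface: only the area term survives. *)
  have vE x : dens eps (vcat k x) (v1 x) (v2 x) = 4 * eps * (vcat k x * sl (sinh (x / k))).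
    rewrite /dens /v1 /v2 sl_sinh /vcat; field.
    by rewrite kN cosh_neq0.
  have jv : intg 0 x1 (fun x => vcat k x * sl (sinh (x / k))).
    by apply: cont_intg; apply: contM => //; exact: cont_sl.
  have au : intg 0 x1 (fun x => u x * sl (u1 x)).
    by apply: cont_intg; apply: (@cont_sub _ 0 1) => //; exact: cont_arc H.
  have ju1 : intg 0 x1 (fun x => dens eps (u x) (u1 x) (u2 x)) by apply: intg_sub ju.
  rewrite /energy dE rint_glue//; last 2 first.
  - by apply: (intg_eq (fun x _ => esym (vE x))); exact: intgZ.
  - exact: intg_sub ju.
  rewrite (rint_eq (fun x _ => vE x)) (rintZ _ jv) (vcat_arc k0 x10) -px1.
  rewrite (rint_chasles x10 x1le ju) addrAC lerD2r.
  have -> : rint 0 x1 (fun x => (1 / (u x * sl (u1 x)) - u2 x / sl (u1 x) ^+ 3) ^+ 2 * u x * sl (u1 x)) =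
     rint 0 x1 (fun x => dens eps (u x) (u1 x) (u2 x)) - 4 * eps * arc u u1 x1.
    rewrite /arc -(rintZ _ au) -rintB//; last exact: intgZ.
    by apply: rint_eq => x _; rewrite /dens; ring.
  rewrite addrCA gerDl subr_le0 ler_wpM2l ?mulr_ge0//.
  have ci0 : 0 < c^-1 by rewrite invr_gt0.
  by apply: (pot_le_arc H x1i t01 ht); apply: (le_trans rx1); apply: hrat_le; lra.
- move=> x /andP[x0 xl]; rewrite /w1 /glue; case: ifP => [xx|/negbT]; last rewrite -ltNge => xx.
    by apply: sinh_le; rewrite ler_wpM2l ?lef_pV2 ?posrE.
  have [->|x1'] := eqVneq x 1; first by rewrite (prof_d1 H) sinh_ge0// div1r invr_ge0 ltW.
  by apply/ltW/after; rewrite xx lt_neqAle x1'.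
Qed.

End Catenary.

(** * Limits of integrals *)

Section Limits.
Context {R : realType}.
Notation mu := (@lebesgue_measure R).
Implicit Types (a b c x y e C : R) (f g F G : R -> R) (q : nat -> R -> R) (N : set R).

Lemma rint_ae a b f g N : measurable N -> mu N = 0 ->
  (forall x, a <= x <= b -> ~ N x -> f x = g x) ->
  measurable_fun `[a, b] f -> measurable_fun `[a, b] g -> rint a b f = rint a b g.
Proof.
move=> mN N0 fg mf mg; congr fine; apply: ae_eq_integral => //.
- exact/measurable_EFinP.
- exact/measurable_EFinP.
- exists N; split => // x /= h; apply: contrapT => Nx; apply: h.
  by rewrite in_itv/= => xab; congr EFin; exact: fg.
Qed.

Lemma intg_ae a b f g N : measurable N -> mu N = 0 ->
  (forall x, a <= x <= b -> ~ N x -> f x = g x) ->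
  intg a b f -> measurable_fun `[a, b] g -> intg a b g.
Proof.
move=> mN N0 fg /integrableP[mf jf] mg; apply/integrableP; split; first exact/measurable_EFinP.
rewrite -(_ : \int[mu]_(x in `[a, b]) `|(EFin \o f) x| = \int[mu]_(x in `[a, b]) `|(EFin \o g) x|)%E//.
apply: ge0_ae_eq_integral => //.
- by apply: measurableT_comp => //.
- by apply: measurableT_comp => //; exact/measurable_EFinP.
- exists N; split => // x /= h; apply: contrapT => Nx; apply: h.
  by rewrite in_itv/= => xab; rewrite fg.
Qed.

Lemma cvgn_ge (u : nat -> R) (l K : R) : u n @[n --> \oo] --> l -> (forall n, K <= u n) -> K <= l.
Proof.
move=> ul Ku; rewrite -(@cvg_lim R^o (@norm_hausdorff R R^o) _ _ _ u l ul).
by apply: limr_ge; [apply/cvg_ex; exists l|exact: nearW].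
Qed.

Lemma cvgn_le (u : nat -> R) (l K : R) : u n @[n --> \oo] --> l -> (forall n, u n <= K) -> l <= K.
Proof.
move=> ul Ku; rewrite -(@cvg_lim R^o (@norm_hausdorff R R^o) _ _ _ u l ul).
by apply: limr_le; [apply/cvg_ex; exists l|exact: nearW].
Qed.

(** Fatou's lemma for real integrals; the slack e allows a bound that holds only asymptotically. *)
Lemma rint_fatou a b q f (B : R) : (forall n, intg a b (q n)) ->
  (forall n x, a <= x <= b -> 0 <= q n x) ->
  (forall x, a <= x <= b -> q n x @[n --> \oo] --> f x) ->
  (forall e, 0 < e -> \forall n \near \oo, rint a b (q n) <= B + e) ->
  intg a b f /\ rint a b f <= B.
Proof.
move=> jq q0 qf qB.
have mf : measurable_fun `[a, b] f.
  by apply: (measurable_fun_cvg (fun n => intg_meas (jq n))) => x /=; rewrite in_itv/=; exact: qf.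
have f0 x : a <= x <= b -> 0 <= f x.
  by move=> xab; apply: (cvgn_ge (qf x xab)) => n; exact: q0.
have key : (\int[mu]_(x in `[a, b]) (f x)%:E <= B%:E)%E.
  have F := @fatou _ _ _ mu `[a, b] (measurable_itv _) (fun n x => (q n x)%:E).
  have -> : (\int[mu]_(x in `[a, b]) (f x)%:E = \int[mu]_(x in `[a, b]) limn_einf (fun n => (q n x)%:E))%E.
    apply: eq_integral => x; rewrite inE/= in_itv/= => xab.
    have c : (q n x)%:E @[n --> \oo] --> (f x)%:E by apply: cvg_EFin; [exact: nearW|exact: qf].
    by rewrite (cvg_limn_einf_sup c).1.
  apply: le_trans (F _ _) _.
  - by move=> n; apply/measurable_EFinP; exact: intg_meas (jq n).
  - by move=> n x /=; rewrite in_itv/= => xab; rewrite lee_fin q0.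
  apply/lee_addgt0Pr => e e0; rewrite limn_einf_lim.
  apply: lime_le; first exact: is_cvg_einfs.
  apply: filterS (qB e e0) => n hn.
  apply: (@le_trans _ _ (rint a b (q n))%:E); last by rewrite -EFinD lee_fin.
  by rewrite rintE//; apply: ereal_inf_lbound; exists n => /=.
have j : intg a b f.
  apply/integrableP; split; first exact/measurable_EFinP.
  have -> : (\int[mu]_(x in `[a, b]) `|(EFin \o f) x| = \int[mu]_(x in `[a, b]) (f x)%:E)%E.
    by apply: eq_integral => x; rewrite inE/= in_itv/= => xab; rewrite ger0_norm// f0.
  exact: le_lt_trans key (ltry _).
by split => //; rewrite -lee_fin rintE.
Qed.

(** As in Riesz-Fischer, the jumps have finite total integral, so their sum S is finite off a null
    set; there the sequence converges absolutely and is dominated by |q_0| + S. *)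
Lemma L1_fast a b q C : (forall k, intg a b (q k)) ->
  0 <= C -> (forall k, rint a b (fun x => `|q k.+1 x - q k x|) <= C / (2 ^ k.+1)%:R) ->
  exists N f g, [/\ measurable N, mu N = 0, intg a b g &
    forall x, a <= x <= b -> ~ N x ->
      q k x @[k --> \oo] --> f x /\ forall k, `|q k x| <= g x].
Proof.
move=> jq C0 qC.
pose h k x : \bar R := (`|q k.+1 x - q k x|)%:E.
pose S x : \bar R := (\sum_(0 <= k <oo) h k x)%E.
have jd k : intg a b (fun x => `|q k.+1 x - q k x|) by apply: intg_abs; exact: intgB.
have mh k : measurable_fun `[a, b] (h k) by apply/measurable_EFinP; exact: intg_meas (jd k).
have h0 k x : (0 <= h k x)%E by rewrite lee_fin.
have mS : measurable_fun `[a, b] S.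
  exact: (@ge0_emeasurable_sum _ _ _ _ h xpredT).
have S0 x : (0 <= S x)%E by apply: nneseries_ge0.
have IS : (\int[mu]_(x in `[a, b]) S x < +oo)%E.
  rewrite integral_nneseries//.
  apply: (@le_lt_trans _ _ (\sum_(0 <= k <oo) (C / (2 ^ k.+1)%:R)%:E)%E).
    apply: lee_nneseries => //.
      by move=> k _ _; apply: integral_ge0 => *; exact: h0.
    by move=> k _; rewrite -rintE// lee_fin.
  exact: le_lt_trans (epsilon_trick0 xpredT C0) (ltry _).
have jS : mu.-integrable `[a, b] S.
  apply/integrableP; split => //.
  by under eq_integral do rewrite gee0_abs//.
have [//|N [mN N0 hN]] := @integrable_ae _ _ _ mu `[a, b] _ S jS.
exists N, (fun x => limn (q^~ x)), (fun x => `|q 0%N x| + fine (S x)); split => //.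
  apply: intgD; first exact: intg_abs.
  apply: le_integrable jS => //.
    by apply/measurable_EFinP; apply: measurableT_comp => //.
  move=> x _ /=; case: (S x) (S0 x) => [r| |]//=.
  by rewrite normr0 => _; exact: leey.
move=> x xab Nx.
have Sfin : S x \is a fin_num.
  by apply: contrapT => H; apply: Nx; apply: hN => /= /(_ _); rewrite in_itv/= => /(_ xab).
have partial n : \sum_(0 <= k < n) `|q k.+1 x - q k x| <= fine (S x).
  rewrite -lee_fin fineK// -sumEFin.
  by apply: (@nneseries_lim_ge _ (h^~ x) xpredT).
have tel n : q n x = q 0%N x + \sum_(0 <= k < n) (q k.+1 x - q k x).
  by rewrite telescope_sumr// addrC subrK.
split.
  pose nu n : R := \sum_(0 <= k < n) `|q k.+1 x - q k x|.
  have cn : cvgn nu.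
    apply: nondecreasing_is_cvgn.
      by apply/nondecreasing_seqP => n; rewrite /nu big_nat_recr//= lerDl.
    by exists (fine (S x)) => _ [n _ <-]; exact: partial.
  have cq := @normed_cvg R R^o (fun k => q k.+1 x - q k x) cn.
  have -> : q^~ x = (fun n => q 0%N x + series (fun k => q k.+1 x - q k x) n).
    by apply/funext => n; rewrite tel.
  have cc : q 0%N x + series (fun k => q k.+1 x - q k x) n @[n --> \oo] -->
      q 0%N x + limn (series (fun k => q k.+1 x - q k x)).
    by apply: cvgD; [exact: cvg_cst|exact: cq].
  by rewrite (@cvg_lim R^o (@norm_hausdorff R R^o) _ _ _ _ _ cc).
move=> k; rewrite tel (le_trans (ler_normD _ _))// lerD2l.
by rewrite (le_trans (ler_norm_sum _ _ _))// partial.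
Qed.

End Limits.

(** * Compactness *)

Section Arzela.
Context {R : realType}.
Implicit Types (x y e : R) (w : R -> R) (f : nat -> R -> R).

Lemma fmap_ultra (T U : Type) (h : T -> U) (G : set_system T) :
  UltraFilter G -> UltraFilter (h @ G).
Proof.
move=> UG; have PG : ProperFilter G by exact: ultra_proper.
split; first exact: fmap_proper_filter.
move=> F PF GF; apply/seteqP; split; last exact: GF.
move=> A FA; have [//|GA] := in_ultra_setVsetC (h @^-1` A) UG; exfalso.
have FA' : F (~` A) by apply: GF.
by have := filter_ex (filterI FA FA') => -[x []].
Qed.

(** Pointwise limits are taken along a free ultrafilter, which avoids a diagonal extraction;
    equicontinuity makes the convergence uniform. The conclusion is a subsequence in disguise:
    arbitrarily late members are uniformly close to [w]. *)
Lemma arzela f (V : R) : (forall n x, 0 <= x <= 1 -> 0 <= f n x <= V) ->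
  (forall e, 0 < e -> exists2 d : R, 0 < d & forall n x y, 0 <= x <= 1 -> 0 <= y <= 1 ->
     `|x - y| < d -> `|f n x - f n y| <= e) ->
  exists w, forall e, 0 < e -> forall N, exists2 n, (N <= n)%N &
    forall x, 0 <= x <= 1 -> `|f n x - w x| <= e.
Proof.
move=> fV fe; have [G [UG ooG]] := ultraFilterLemma (eventually_filter).
have PG : ProperFilter G by exact: ultra_proper.
have lim (h : nat -> R) (A B : R) : (forall n, A <= h n <= B) ->
    exists2 l, A <= l <= B & h n @[n --> G] --> l.
  move=> hAB; have := @segment_compact R A B; rewrite compact_ultra => /(_ (h @ G)).
  case.
  - exact: fmap_ultra.
  - by apply: (@filterE _ G) => n /=; rewrite in_itv/=; exact: hAB.
  - by move=> l [/=]; rewrite in_itv/= => ? ?; exists l.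
have wex x : exists l : R, 0 <= x <= 1 -> f n x @[n --> G] --> l.
  have [x01|x01] := pselect (0 <= x <= 1); last by exists 0.
  by have [l _ hl] := lim (f^~ x) 0 V (fun n => fV n x x01); exists l.
have [w hw] := choice wex; exists w => e e0 N.
have e4 : 0 < e / 4 by rewrite divr_gt0.
have [d d0 hd] := fe _ e4.
have wd x y : 0 <= x <= 1 -> 0 <= y <= 1 -> `|x - y| < d -> `|w x - w y| <= e / 4.
  move=> x01 y01 xy.
  have c : `|f n x - f n y| @[n --> G] --> `|w x - w y|.
    by apply: cvg_norm; apply: cvgB; exact: hw.
  apply: (@closed_cvg _ _ G PG (fun n => `|f n x - f n y|) [set t | t <= e / 4]) c.
  - exact: closed_le.
  - by apply: filterE => n /=; exact: hd.
pose A := [set n | forall x, 0 <= x <= 1 -> `|f n x - w x| <= e].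
suff GA : G A.
  have GN : G [set n | (N <= n)%N] by apply: ooG; exists N.
  by have [n [An Nn]] := filter_ex (filterI GA GN); exists n.
have [//|GnA] := in_ultra_setVsetC A UG; exfalso.
(* If uniform closeness failed along the ultrafilter, points z_n of failure would converge to some
   l, and three errors of at most e / 4 would contradict a gap exceeding e. *)
have xex n : exists x, 0 <= x <= 1 /\ (~ A n -> e < `|f n x - w x|).
  have [An|An] := pselect (A n); first by exists 0; rewrite lexx ler01.
  move: An; rewrite /A/= => /existsNP[x /not_implyP[x01 /negP]]; rewrite -ltNge => h.
  by exists x.
have [z hz] := choice xex.
have [l l01 zl] := lim z 0 1 (fun n => (hz n).1).
have near1 : \forall n \near G, `|z n - l| < d by have /cvgrPdist_lt/(_ d d0) := zl; apply: filterS => n; rewrite distrC.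
have near2 : \forall n \near G, `|f n l - w l| < e / 4 by have /cvgrPdist_lt/(_ _ e4) := hw l l01; apply: filterS => n; rewrite distrC.
have [n [[n1 n2] /= n3]] := filter_ex (filterI (filterI near1 near2) GnA).
have [z01 /(_ n3)] := hz n.
rewrite ltNge => /negP; apply.
have -> : f n (z n) - w (z n) = (f n (z n) - f n l) + (f n l - w l) - (w (z n) - w l) by ring.
have h1 := hd n (z n) l z01 l01 n1.
have h2 := wd (z n) l z01 l01 n1.
rewrite (le_trans (ler_normB _ _))//; have := ler_normD (f n (z n) - f n l) (f n l - w l).
move: n2 => /=; lra.
Qed.

End Arzela.

(** * Lipschitz bounds for the coefficients of the Lagrangian *)

Section LagLipschitz.
Context {R : realType}.
Notation mu := (@lebesgue_measure R).
Implicit Types (x y p q e : R).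

Lemma norm_sl_le p : `|p / sl p| <= 1.
Proof.
rewrite normrM normfV [`|sl p|]gtr0_norm ?sl_gt0// ler_pdivrMr ?sl_gt0// mul1r.
exact: norm_le_sqrtD.
Qed.

Lemma slV_le1 p n : `|(sl p)^-1 ^+ n| <= 1.
Proof.
rewrite ger0_norm ?exprn_ge0 ?invr_ge0 ?sqrtr_ge0//.
by rewrite exprn_ile1 ?invr_ge0 ?sqrtr_ge0// invf_le1 ?sl_gt0// sl_ge1.
Qed.

Lemma sl_lip p q : `|sl p - sl q| <= `|p - q|.
Proof.
rewrite -[leRHS]mul1r; apply: (lipschitz_derive (fun t => isd_sl (isd_id t))) => t.
by rewrite mulr1 norm_sl_le.
Qed.

Lemma slV_lip p q : `|(sl p)^-1 - (sl q)^-1| <= `|p - q|.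
Proof.
rewrite -[leRHS]mul1r; apply: (lipschitz_derive (fun t => isdV (sl_neq0 t) (isd_sl (isd_id t)))) => t.
rewrite mulr1 -mulNr.
have -> : - t / sl t / sl t ^+ 2 = - ((t / sl t) * (sl t)^-1 ^+ 2) by field; exact: sl_neq0.
by rewrite normrN normrM mulr_ile1// ?norm_sl_le ?slV_le1.
Qed.

Lemma slV5_lip p q : `|(sl p)^-1 ^+ 5 - (sl q)^-1 ^+ 5| <= 5 * `|p - q|.
Proof.
apply: (lipschitz_derive (fun t => isdX 5 (isdV (sl_neq0 t) (isd_sl (isd_id t))))) => t /=.
have -> : 5 * (sl t)^-1 ^+ 4 * (- (t * 1 / sl t) / sl t ^+ 2) = - (5 * ((t / sl t) * (sl t)^-1 ^+ 6)).
  by field; exact: sl_neq0.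
rewrite normrN normrM [`|5|]ger0_norm// -[leRHS]mulr1 ler_wpM2l//.
by rewrite normrM mulr_ile1// ?norm_sl_le ?slV_le1.
Qed.

(** Here and in [lagB_lip]: how the q-free part and the coefficient of q^2 in [lag] change when u
    and u' move by at most d. This compares a midpoint with its two ends. *)
Lemma lagV_lip (eps c0 al S y y' p p' d : R) : 0 < c0 -> 0 <= eps -> c0 <= y <= al -> c0 <= y' <= al ->
  sl p <= S -> sl p' <= S -> `|y - y'| <= d -> `|p - p'| <= d ->
  `|(1 / (y * sl p) + 4 * eps * (y * sl p)) - (1 / (y' * sl p') + 4 * eps * (y' * sl p'))| <=
  (c0^-1 ^+ 2 + c0^-1 + 4 * eps * (S + al)) * d.
Proof.
move=> c00 e0 /andP[y1 y2] /andP[z1 z2] s1 s2 yd pd.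
have y0 : 0 < y by lra.
have z0 : 0 < y' by lra.
have d0 : 0 <= d by exact: le_trans yd.
have sp := sl_gt0 p; have sp' := sl_gt0 p'.
have yi : y^-1 <= c0^-1 by rewrite lef_pV2 ?posrE.
have zi : y'^-1 <= c0^-1 by rewrite lef_pV2 ?posrE.
have ci : 0 < c0^-1 by rewrite invr_gt0.
have -> : 1 / (y * sl p) + 4 * eps * (y * sl p) - (1 / (y' * sl p') + 4 * eps * (y' * sl p')) =
  ((y' - y) * (y^-1 * y'^-1) * (sl p)^-1 + y'^-1 * ((sl p)^-1 - (sl p')^-1)) +
  4 * eps * ((y - y') * sl p + y' * (sl p - sl p')).
  by field; rewrite !gt_eqF.
rewrite (le_trans (ler_normD _ _))// [leRHS]mulrDl lerD//.
  rewrite (le_trans (ler_normD _ _))// [leRHS]mulrDl lerD//.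
    have h1 : `|(sl p)^-1| <= 1 by have := slV_le1 p 1.
    have h2 : `|y^-1 * y'^-1| <= c0^-1 ^+ 2.
      rewrite normrM expr2 !gtr0_norm ?invr_gt0//.
      by rewrite ler_pM ?invr_ge0// ltW.
    rewrite !normrM in h2 *; rewrite distrC -[leRHS]mulr1 ler_pM ?mulr_ge0//.
    by rewrite mulrC ler_pM// mulr_ge0.
  rewrite normrM [`|y'^-1|]gtr0_norm ?invr_gt0// ler_pM ?invr_ge0 ?(ltW z0)//.
  exact: le_trans (slV_lip _ _) pd.
have e40 : 0 <= 4 * eps by rewrite mulr_ge0.
rewrite normrM (ger0_norm e40) -[leRHS]mulrA; apply: ler_wpM2l => //.
rewrite (le_trans (ler_normD _ _))// !normrM [leRHS]mulrDl.
rewrite (gtr0_norm sp) (gtr0_norm z0) lerD//.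
  by rewrite mulrC ler_pM// ltW.
rewrite ler_pM// ?(ltW z0)//; exact: le_trans (sl_lip _ _) pd.
Qed.

Lemma lagB_lip (c0 al y y' p p' d : R) : 0 < c0 -> c0 <= y <= al -> c0 <= y' <= al ->
  `|y - y'| <= d -> `|p - p'| <= d ->
  `|y / sl p ^+ 5 - y' / sl p' ^+ 5| <= (1 + 5 * al) * d.
Proof.
move=> c00 /andP[y1 y2] /andP[z1 z2] yd pd.
have z0 : 0 < y' by lra.
have -> : y / sl p ^+ 5 - y' / sl p' ^+ 5 =
  (y - y') * (sl p)^-1 ^+ 5 + y' * ((sl p)^-1 ^+ 5 - (sl p')^-1 ^+ 5).
  by rewrite !exprVn; ring.
rewrite (le_trans (ler_normD _ _))// [leRHS]mulrDl lerD//.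
  by rewrite normrM mulrC ler_pM// slV_le1.
rewrite normrM (gtr0_norm z0) mulrAC mulrC ler_pM// ?(ltW z0)//.
by rewrite (le_trans (slV5_lip _ _))// ler_wpM2l.
Qed.

End LagLipschitz.

(** * Existence of a minimiser *)

Section Existence.
Context {R : realType}.
Notation mu := (@lebesgue_measure R).
Implicit Types (x y p q e d : R).

Lemma norm_half_le (t d : R) : `|t| <= d -> `|2^-1 * t| <= d.
Proof. by rewrite normrM ger0_norm//; have := normr_ge0 t; lra. Qed.

(** u'' may be changed on a null set: used to make sequences converge everywhere and to pass to a
    continuous representative. *)
Lemma profile_ae (alpha eps : R) (u u1 u2 v2 : R -> R) (N : set R) :
  profile alpha u u1 u2 -> measurable N -> mu N = 0 ->
  (forall x, 0 <= x <= 1 -> ~ N x -> u2 x = v2 x) -> measurable_fun (`[0, 1]%classic : set R) v2 ->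
  profile alpha u u1 v2 /\ energy eps u u1 v2 = energy eps u u1 u2.
Proof.
move=> H mN N0 uv mv.
have mv' (b : R) : b <= 1 -> measurable_fun `[0, b] v2.
  move=> b1; apply: measurable_funS mv => //; apply: subset_itvl.
  by rewrite bnd_simp.
have H' : profile alpha u u1 v2.
  split; [|by apply: (intg_ae mN N0 _ (prof_L2 H)) => [x x01 Nx|]; [rewrite uv|exact: measurable_funX]|
    exact: prof_ac0 H|exact: (prof_gt0 H)|exact: prof_u1 H|exact: prof_d0 H|exact: prof_d1 H].
  have [j h] := prof_ac1 H; split; first exact: intg_ae mN N0 uv j mv.
  move=> x /[dup] x01 /andP[x0 x1]; rewrite (h x)//; congr (_ + _).
  apply: (rint_ae mN N0); last exact: mv'.
    by move=> y /andP[y0 yx] Ny; apply: uv => //; rewrite y0 (le_trans yx).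
  by apply: intg_meas; apply: intg_sub j.
split => //; apply: (rint_ae mN N0).
- by move=> x x01 Nx; rewrite uv.
- exact: intg_meas (prof_intg_dens eps H').
- exact: intg_meas (prof_intg_dens eps H).
Qed.

Context (alpha eps c0 Vm : R) (V : R -> R).
Hypotheses (c00 : 0 < c0) (e0 : 0 <= eps).

(** The upper slope bound, together with the lower bound on u in [Vlow], keeps the coefficient of
    u''^2 away from 0: this is the coercivity in [adm_lag_ge]. *)
Definition adm u u1 u2 := profile alpha u u1 u2 /\ forall x, 0 <= x <= 1 -> 0 <= u1 x <= V x.

Hypothesis VVm : forall x, 0 <= x <= 1 -> V x <= Vm.
Hypothesis Vlow : forall u u1, ac 0 1 u u1 -> u 1 = alpha ->
  (forall x, 0 <= x <= 1 -> 0 <= u1 x <= V x) -> forall x, 0 <= x <= 1 -> c0 <= u x.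
Hypothesis adm_ex : exists u u1 u2, adm u u1 u2.

Let S := sl Vm.

Lemma adm_bnd u u1 u2 x : adm u u1 u2 -> 0 <= x <= 1 ->
  [/\ c0 <= u x, u x <= alpha, 0 <= u1 x <= Vm & sl (u1 x) <= S].
Proof.
move=> [H hV] x01; have [h1 h2] := andP (hV x x01).
have uV : u1 x <= Vm by rewrite (le_trans h2)// VVm.
split; [by apply: (Vlow (prof_ac0 H) (prof_u1 H) hV)| |by rewrite h1|].
  rewrite -(prof_u1 H) -subr_ge0; have [x0 x1] := andP x01.
  rewrite (ac_sub_rint (prof_ac0 H) x0 x1)//.
  by apply: rint_ge0 => y /andP[xy y1]; have /andP[] := hV y ltac:(lra).
by apply: sl_le; rewrite !ger0_norm// (le_trans h1).
Qed.

Lemma adm_lag_ge u u1 u2 x : adm u u1 u2 -> 0 <= x <= 1 ->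
  c0 / S ^+ 5 * u2 x ^+ 2 <= lag eps (u x) (u1 x) (u2 x).
Proof.
move=> A x01; have [b1 b2 b3 b4] := adm_bnd A x01.
have u0 : 0 < u x := lt_le_trans c00 b1.
have s0 := sl_gt0 (u1 x); have S0 : 0 < S := sl_gt0 _.
rewrite /lag -[leLHS]add0r lerD//.
  by rewrite addr_ge0 ?divr_ge0 ?mulr_ge0// ltW.
rewrite ler_wpM2r ?sqr_ge0// ler_pM ?invr_ge0 ?exprn_ge0 ?(ltW S0) ?(ltW c00)//.
by rewrite lef_pV2 ?posrE ?exprn_gt0// lerXn2r ?nnegrE ?(ltW S0) ?(ltW s0).
Qed.

Lemma adm_energy_ge u u1 u2 : adm u u1 u2 ->
  c0 / S ^+ 5 * rint 0 1 (fun x => u2 x ^+ 2) <= energy eps u u1 u2.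
Proof.
move=> A; have H := A.1; rewrite (energy_lag eps H) -(rintZ _ (prof_L2 H)).
apply: rint_le; [apply: intgZ; exact: prof_L2 H|exact: prof_intg_lag H|].
by move=> x x01; exact: adm_lag_ge A x01.
Qed.

Lemma cS_gt0 : 0 < c0 / S ^+ 5.
Proof. by rewrite divr_gt0// exprn_gt0// sl_gt0. Qed.

Definition emin := inf [set E | exists u u1 u2, adm u u1 u2 /\ E = energy eps u u1 u2].

Let hinf : has_inf [set E | exists u u1 u2, adm u u1 u2 /\ E = energy eps u u1 u2].
Proof.
split.
  by have [u [u1 [u2 A]]] := adm_ex; exists (energy eps u u1 u2), u, u1, u2.
exists 0 => _ [u [u1 [u2 [A ->]]]]; apply: le_trans (adm_energy_ge A).
by rewrite mulr_ge0 ?(ltW cS_gt0)//; apply: rint_ge0 => x _; exact: sqr_ge0.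
Qed.

Lemma emin_le u u1 u2 : adm u u1 u2 -> emin <= energy eps u u1 u2.
Proof. by move=> A; apply: ge_inf; [case: hinf|exists u, u1, u2]. Qed.

(** The inequality t <= eta t^2 / 2 + 1 / (2 eta), integrated: a Cauchy-Schwarz bound whose
    parameter is left to the caller. *)
Lemma rint_amgm a b (f : R -> R) (eta : R) : a <= b -> 0 < eta -> intg a b f ->
  intg a b (fun x => f x ^+ 2) ->
  rint a b (fun x => `|f x|) <= eta / 2 * rint a b (fun x => f x ^+ 2) + (b - a) / (2 * eta).
Proof.
move=> ab eta0 jf j2.
have j3 : intg a b (fun x => eta / 2 * f x ^+ 2) by exact: intgZ.
have j4 : intg a b (fun=> (2 * eta)^-1) by exact: intg_cst.
rewrite -(rintZ _ j2) [(b - a) / _]mulrC -(rint_cst _ ab) -(rintD j3 j4).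
apply: rint_le; [exact: intg_abs|exact: intgD|].
move=> x _; rewrite -subr_ge0 -[f x ^+ 2]real_normK ?num_real//.
set t := `|f x|.
have -> : eta / 2 * t ^+ 2 + (2 * eta)^-1 - t = (eta * t - 1) ^+ 2 / (2 * eta).
  by field; rewrite gt_eqF.
by rewrite divr_ge0 ?sqr_ge0// mulr_ge0// ltW.
Qed.

(** An energy bound controls u'' in L^2, so the slopes are equicontinuous and [arzela] applies to
    them. *)
Lemma adm_modulus (K e : R) : 0 < e -> exists2 d : R, 0 < d & forall u u1 u2, adm u u1 u2 ->
  energy eps u u1 u2 <= K -> forall x y, 0 <= x <= 1 -> 0 <= y <= 1 ->
  `|x - y| < d -> `|u1 x - u1 y| <= e.
Proof.
move=> he; pose K1 := `|K| / (c0 / S ^+ 5) + 1.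
have K10 : 0 < K1 by rewrite ltr_wpDl// divr_ge0 ?(ltW cS_gt0).
(* With this [eta] and |x - y| < e * eta, the two terms of [rint_amgm] are at most e / 2 each. *)
pose eta := e / K1; have eta0 : 0 < eta by rewrite divr_gt0.
exists (e * eta); first exact: mulr_gt0.
move=> u u1 u2 A EK.
have L2K : rint 0 1 (fun x => u2 x ^+ 2) <= K1.
  have := adm_energy_ge A; rewrite mulrC -ler_pdivlMr ?cS_gt0// => h.
  apply: (le_trans h); rewrite /K1 ler_wpDr// ler_pM2r ?invr_gt0 ?cS_gt0//.
  exact: le_trans (ler_norm _).
have H := A.1.
have key x y : 0 <= x -> x <= y -> y <= 1 -> `|x - y| < e * eta -> `|u1 x - u1 y| <= e.
  move=> x0 xy y1 hxy; rewrite distrC (ac_sub_rint (prof_ac1 H) x0 xy y1).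
  have j1 : intg x y u2 by apply: intg_sub (ac_intg (prof_ac1 H)).
  have j2 : intg x y (fun x => u2 x ^+ 2) by apply: intg_sub (prof_L2 H).
  rewrite (le_trans (rint_abs j1))// (le_trans (rint_amgm xy eta0 j1 j2))//.
  have h1 : rint x y (fun x => u2 x ^+ 2) <= K1.
    have x1 : x <= 1 := le_trans xy y1.
    have j := prof_L2 H.
    have j' : intg x 1 (fun x => u2 x ^+ 2) by apply: intg_sub j.
    apply: le_trans L2K; rewrite (rint_chasles x0 x1 j) (rint_chasles xy y1 j').
    by rewrite addrCA lerDl addr_ge0// rint_ge0// => *; exact: sqr_ge0.
  rewrite (_ : e = eta / 2 * K1 + e * eta / (2 * eta)); last by rewrite /eta; field; rewrite !gt_eqF.
  have eta2 : 0 <= eta / 2 by rewrite divr_ge0// ltW.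
  have eta3 : 0 < (2 * eta)^-1 by rewrite invr_gt0 mulr_gt0.
  rewrite lerD ?(ler_wpM2l eta2)// (ler_pM2r eta3).
  by move: hxy; rewrite ler0_norm; lra.
move=> x y /andP[x0 x1] /andP[y0 y1] hxy.
have [xy|yx] := leP x y; first exact: key.
by rewrite distrC; apply: key => //; [exact: ltW|rewrite distrC].
Qed.

(* Uniform convexity in u'': the energy of the midpoint is at least the infimum. *)
Lemma adm_midpoint : exists2 L : R, 0 <= L & forall u u1 u2 v v1 v2 d, adm u u1 u2 -> adm v v1 v2 ->
  0 <= d <= 1 -> (forall x, 0 <= x <= 1 -> `|u1 x - v1 x| <= d) ->
  energy eps u u1 u2 <= emin + d -> energy eps v v1 v2 <= emin + d ->
  rint 0 1 (fun x => (u2 x - v2 x) ^+ 2) <= L * d.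
Proof.
pose L1 := c0^-1 ^+ 2 + c0^-1 + 4 * eps * (S + alpha).
pose L2 := 1 + 5 * alpha.
pose b0 := c0 / S ^+ 5.
have al0 : 0 < alpha.
  have [u [u1 [u2 A]]] := adm_ex.
  have [|h1 h2 _ _] := adm_bnd A (x := 0); first by rewrite lexx ler01.
  exact: lt_le_trans c00 (le_trans h1 h2).
have S0 : 0 < S := sl_gt0 _.
have L10 : 0 <= L1 by rewrite /L1 !addr_ge0 ?mulr_ge0 ?invr_ge0 ?addr_ge0 ?exprn_ge0 ?invr_ge0 ?(ltW c00) ?(ltW S0) ?(ltW al0).
have L20 : 0 <= L2 by rewrite /L2 addr_ge0 ?mulr_ge0 ?(ltW al0).
pose m1 : R := (emin + 1) / b0.
have b00 : 0 < b0 := cS_gt0.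
have em0 : 0 <= emin.
  apply: lb_le_inf; first by case: hinf.
  move=> _ [u [u1 [u2 [A ->]]]]; apply: le_trans (adm_energy_ge A).
  by rewrite mulr_ge0 ?(ltW cS_gt0)//; apply: rint_ge0 => x _; exact: sqr_ge0.
have m10 : 0 <= m1 by rewrite divr_ge0 ?addr_ge0 ?(ltW b00).
(* Times d b0 / 4 this is the energy excess d, plus the error d L1 of the q-free part, plus the
   error d L2 m1 of the quadratic part, where m1 bounds the integrals of u''^2 and v''^2. *)
exists (4 / b0 * (1 + L1 + L2 * m1)) => [|u u1 u2 v v1 v2 d Au Av /andP[d0 d1] uv Eu Ev].
  have k1 : 0 <= 4 / b0 by rewrite divr_ge0// ltW.
  exact: mulr_ge0 k1 (addr_ge0 (addr_ge0 ler01 L10) (mulr_ge0 L20 m10)).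
have Hu := Au.1; have Hv := Av.1.
have bnd1 (w w1 w2 : R -> R) : adm w w1 w2 -> energy eps w w1 w2 <= emin + d -> rint 0 1 (fun x => w2 x ^+ 2) <= m1.
  move=> Aw Ew; have := adm_energy_ge Aw; rewrite mulrC -ler_pdivlMr ?cS_gt0// => h.
  by apply: (le_trans h); rewrite ler_pM2r ?invr_gt0//; lra.
pose w x := 2^-1 * (u x + v x). pose w1 x := 2^-1 * (u1 x + v1 x). pose w2 x := 2^-1 * (u2 x + v2 x).
have acw1 : ac 0 1 w1 w2 by apply: acZ; apply: acD; [exact: prof_ac1 Hu|exact: prof_ac1 Hv].
have acw : ac 0 1 w w1 by apply: acZ; apply: acD; [exact: prof_ac0 Hu|exact: prof_ac0 Hv].
have j2 := prof_L2 Hu; have k2 := prof_L2 Hv.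
have mu2 := intg_meas (ac_intg (prof_ac1 Hu)); have mv2 := intg_meas (ac_intg (prof_ac1 Hv)).
have jd : intg 0 1 (fun x => (u2 x - v2 x) ^+ 2).
  apply: (@intg_le _ _ _ _ (fun x => 2 * (u2 x ^+ 2 + v2 x ^+ 2))).
  - by apply: measurable_funX; exact: measurable_funB.
  - by apply: intgZ; exact: intgD.
  - move=> x _; rewrite ger0_norm ?sqr_ge0// -subr_ge0.
    by rewrite (_ : _ - _ = (u2 x + v2 x) ^+ 2) ?sqr_ge0//; ring.
have Aw : adm w w1 w2.
  split; last by move=> x x01; have /andP[? ?] := Au.2 x x01; have /andP[? ?] := Av.2 x x01; rewrite /w1; lra.
  split => //.
  - apply: (@intg_le _ _ _ _ (fun x => u2 x ^+ 2 + v2 x ^+ 2)).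
    + by apply: measurable_funX; exact: intg_meas (ac_intg acw1).
    + exact: intgD.
    + move=> x _; rewrite ger0_norm ?sqr_ge0// -subr_ge0 /w2.
      have := sqr_ge0 (u2 x - v2 x); have := sqr_ge0 (u2 x); have := sqr_ge0 (v2 x); nra.
  - by move=> x x01; rewrite mulr_gt0 ?invr_gt0// addr_gt0// ?(prof_gt0 Hu)// (prof_gt0 Hv).
  - by rewrite /w (prof_u1 Hu) (prof_u1 Hv); field.
  - by rewrite /w1 (prof_d0 Hu) (prof_d0 Hv); ring.
  - by rewrite /w1 (prof_d1 Hu) (prof_d1 Hv); ring.
have Ew := emin_le Aw.
have uvd x : 0 <= x <= 1 -> `|u x - v x| <= d.
  move=> /[dup] x01 /andP[x0 x1].
  have e1 : u x - v x = - rint x 1 (fun y => u1 y - v1 y).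
    have ju : intg x 1 u1 by apply: intg_sub (ac_intg (prof_ac0 Hu)).
    have jv : intg x 1 v1 by apply: intg_sub (ac_intg (prof_ac0 Hv)).
    rewrite rintB// -(ac_sub_rint (prof_ac0 Hu))// -(ac_sub_rint (prof_ac0 Hv))//.
    by rewrite (prof_u1 Hu) (prof_u1 Hv); ring.
  have juv : intg x 1 (fun y => u1 y - v1 y).
    by apply: intgB; [apply: intg_sub (ac_intg (prof_ac0 Hu))|apply: intg_sub (ac_intg (prof_ac0 Hv))].
  rewrite e1 normrN (le_trans (rint_abs juv))//.
  apply: (@le_trans _ _ (rint x 1 (fun=> d))).
    apply: rint_le; [exact: intg_abs|exact: intg_cst|].
    by move=> y /andP[xy y1]; apply: uv; rewrite y1 (le_trans x0).
  by rewrite rint_cst// ler_piMr//; lra.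
(* The parallelogram identity yields the term in (u'' - v'')^2; moving the coefficients from the
   midpoint to the ends costs multiples of d. *)
have pt x : 0 <= x <= 1 -> lag eps (w x) (w1 x) (w2 x) + b0 / 4 * (u2 x - v2 x) ^+ 2 <=
    2^-1 * (lag eps (u x) (u1 x) (u2 x) + lag eps (v x) (v1 x) (v2 x)) + d * L1 +
    (d * L2) / 2 * (u2 x ^+ 2 + v2 x ^+ 2).
  move=> x01; have [u_1 u_2 u_3 u_4] := adm_bnd Au x01.
  have [v_1 v_2 v_3 v_4] := adm_bnd Av x01.
  have [w_1 w_2 w_3 w_4] := adm_bnd Aw x01.
  have hu := uvd x x01; have hp := uv x x01.
  have du : `|w x - u x| <= d.
    rewrite (_ : w x - u x = 2^-1 * - (u x - v x)); last by rewrite /w; field.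
    by apply: norm_half_le; rewrite normrN.
  have dv : `|w x - v x| <= d.
    rewrite (_ : w x - v x = 2^-1 * (u x - v x)); last by rewrite /w; field.
    by apply: norm_half_le.
  have du1 : `|w1 x - u1 x| <= d.
    rewrite (_ : w1 x - u1 x = 2^-1 * - (u1 x - v1 x)); last by rewrite /w1; field.
    by apply: norm_half_le; rewrite normrN.
  have dv1 : `|w1 x - v1 x| <= d.
    rewrite (_ : w1 x - v1 x = 2^-1 * (u1 x - v1 x)); last by rewrite /w1; field.
    by apply: norm_half_le.
  have iw : c0 <= w x <= alpha by rewrite w_1.
  have iu : c0 <= u x <= alpha by rewrite u_1.
  have iv : c0 <= v x <= alpha by rewrite v_1.
  have := lagV_lip c00 e0 iw iu w_4 u_4 du du1; rewrite -/L1 => /(le_trans (ler_norm _)).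
  have := lagV_lip c00 e0 iw iv w_4 v_4 dv dv1; rewrite -/L1 => /(le_trans (ler_norm _)).
  have := lagB_lip c00 iw iu du du1; rewrite -/L2 => /(le_trans (ler_norm _)).
  have := lagB_lip c00 iw iv dv dv1; rewrite -/L2 => /(le_trans (ler_norm _)).
  have : b0 <= w x / sl (w1 x) ^+ 5.
    rewrite /b0 ler_pM ?invr_ge0 ?exprn_ge0 ?(ltW S0) ?(ltW c00)//.
    by rewrite lef_pV2 ?posrE ?exprn_gt0 ?sl_gt0// lerXn2r ?nnegrE ?(ltW S0) ?(ltW (sl_gt0 _)).
  rewrite /lag.
  move: (1 / (w x * sl (w1 x)) + _) (w x / sl (w1 x) ^+ 5) => aw bw.
  move: (1 / (u x * sl (u1 x)) + _) (u x / sl (u1 x) ^+ 5) => au bu.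
  move: (1 / (v x * sl (v1 x)) + _) (v x / sl (v1 x) ^+ 5) => av bv.
  rewrite /w2; move: (u2 x) (v2 x) => p q hb hbv hbu hav hau.
  have P := sqr_ge0 p; have Q := sqr_ge0 q; have PQ := sqr_ge0 (p - q).
  have h1 : 0 <= (bw - b0) * (p - q) ^+ 2 by rewrite mulr_ge0// subr_ge0.
  have h2 : 0 <= (bu + L2 * d - bw) * p ^+ 2 by rewrite mulr_ge0//; lra.
  have h3 : 0 <= (bv + L2 * d - bw) * q ^+ 2 by rewrite mulr_ge0//; lra.
  rewrite -subr_ge0.
  have -> : 2^-1 * (au + bu * p ^+ 2 + (av + bv * q ^+ 2)) + d * L1 + d * L2 / 2 * (p ^+ 2 + q ^+ 2) -
     (aw + bw * (2^-1 * (p + q)) ^+ 2 + b0 / 4 * (p - q) ^+ 2) =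
     ((au + L1 * d - aw) + (av + L1 * d - aw)) / 2 + (bw - b0) * (p - q) ^+ 2 / 4 +
     (bu + L2 * d - bw) * p ^+ 2 / 2 + (bv + L2 * d - bw) * q ^+ 2 / 2 by field.
  lra.
have J1 := prof_intg_lag eps Aw.1; have J2 := prof_intg_lag eps Hu; have J3 := prof_intg_lag eps Hv.
have K1 : intg 0 1 (fun x => b0 / 4 * (u2 x - v2 x) ^+ 2) by exact: intgZ.
have K2 : intg 0 1 (fun x => lag eps (u x) (u1 x) (u2 x) + lag eps (v x) (v1 x) (v2 x)) by exact: intgD.
have K2' : intg 0 1 (fun x => 2^-1 * (lag eps (u x) (u1 x) (u2 x) + lag eps (v x) (v1 x) (v2 x))) by exact: intgZ.
have K3 : intg 0 1 (fun=> d * L1) by exact: intg_cst.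
have K4 : intg 0 1 (fun x => u2 x ^+ 2 + v2 x ^+ 2) by exact: intgD.
have K4' : intg 0 1 (fun x => (d * L2) / 2 * (u2 x ^+ 2 + v2 x ^+ 2)) by exact: intgZ.
have K5 : intg 0 1 (fun x => 2^-1 * (lag eps (u x) (u1 x) (u2 x) + lag eps (v x) (v1 x) (v2 x)) + d * L1) by exact: intgD.
have h := rint_le (intgD J1 K1) (intgD K5 K4') pt.
move: h; rewrite (rintD J1 K1) (rintD K5 K4') (rintD K2' K3) (rintZ _ jd) (rintZ _ K2) (rintD J2 J3).
rewrite (rintZ _ K4) (rintD j2 k2) rint_cst ?ler01//.
rewrite -(energy_lag eps Aw.1) -(energy_lag eps Hu) -(energy_lag eps Hv) => h.
have B1 := bnd1 _ _ _ Au Eu; have B2 := bnd1 _ _ _ Av Ev.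
have L2d : 0 <= d * L2 / 2 by rewrite divr_ge0// mulr_ge0.
have h4 : d * L2 / 2 * (rint 0 1 (fun x => u2 x ^+ 2) + rint 0 1 (fun x => v2 x ^+ 2)) <=
    d * L2 / 2 * (m1 + m1) by rewrite ler_wpM2l// lerD.
rewrite (_ : 4 / b0 * _ * d = (d + d * L1 + d * L2 / 2 * (m1 + m1)) / (b0 / 4)); last first.
  by field; rewrite gt_eqF.
have b4 : 0 < b0 / 4 by rewrite divr_gt0.
rewrite (ler_pdivlMr _ _ b4) mulrC; lra.
Qed.

Lemma adm_min : exists u u1 u2, adm u u1 u2 /\
  forall v v1 v2, adm v v1 v2 -> energy eps u u1 u2 <= energy eps v v1 v2.
Proof.
have seqx n : exists T : (R -> R) * (R -> R) * (R -> R), adm T.1.1 T.1.2 T.2 /\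
    energy eps T.1.1 T.1.2 T.2 <= emin + n.+1%:R^-1.
  have n0 : 0 < n.+1%:R^-1 :> R by rewrite invr_gt0.
  have [E [u [u1 [u2 [A ->]]]] h] := inf_adherent n0 hinf.
  by exists (u, u1, u2); split => //; exact: ltW.
have [T hT] := choice seqx.
have hV n x : 0 <= x <= 1 -> 0 <= (T n).1.2 x <= Vm.
  by move=> x01; have [_ _] := adm_bnd (hT n).1 x01.
have [|w hw] := @arzela R (fun n => (T n).1.2) Vm hV.
  move=> e ep; have [d d0 hd] := adm_modulus (emin + 1) ep.
  exists d => // n x y x01 y01 xy; apply: (hd _ _ _ (hT n).1) => //.
  by apply: (le_trans (hT n).2); rewrite lerD2l invf_le1// ler1n.
have [L L0 hL] := adm_midpoint.
(* The factor 1/4 keeps consecutive slopes within 4^-k of each other. The jumps of u'' then have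
   squared L^2 norm at most L 4^-k and, by [rint_amgm] with parameter 2^k, L^1 norm at most (L + 1)
   / 2^(k+1). *)
pose e k : R := 4^-1 ^+ k / 4.
have ep k : 0 < e k by rewrite divr_gt0// exprn_gt0.
have nk k : exists n, n.+1%:R^-1 <= e k /\ forall x, 0 <= x <= 1 -> `|(T n).1.2 x - w x| <= e k.
  have [N hN] : exists N : nat, forall n, (N <= n)%N -> n.+1%:R^-1 <= e k.
    have /cvgrPdist_le/(_ _ (ep k)) := @cvg_harmonic R; case=> N _ hN; exists N => n Nn.
    by have := hN n Nn; rewrite /= sub0r normrN ger0_norm.
  by have [n Nn hn] := hw _ (ep k) N; exists n; split => //; exact: hN.
have [phi hphi] := choice nk.
pose U k := (T (phi k)).1.1; pose U1 k := (T (phi k)).1.2; pose U2 k := (T (phi k)).2.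
have A k : adm (U k) (U1 k) (U2 k) := (hT (phi k)).1.
have EU k : energy eps (U k) (U1 k) (U2 k) <= emin + e k.
  by apply: (le_trans (hT (phi k)).2); rewrite lerD2l (hphi k).1.
have U1w k x : 0 <= x <= 1 -> `|U1 k x - w x| <= e k := (hphi k).2 x.
have e1 k : e k <= 4^-1 ^+ k.
  by rewrite /e ler_pdivrMr// ler_peMr// ?ler1n// exprn_ge0.
have eS k : e k.+1 + e k <= 4^-1 ^+ k.
  have q0 : 0 <= 4^-1 ^+ k :> R by rewrite exprn_ge0.
  by rewrite /e exprS; move: (4^-1 ^+ k) q0 => t q0; lra.
have e41 k : 4^-1 ^+ k <= 1 :> R by apply: exprn_ile1 => //; lra.
have J2 k : intg 0 1 (U2 k) := ac_intg (prof_ac1 (A k).1).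
have jump k : rint 0 1 (fun x => `|U2 k.+1 x - U2 k x|) <= (L + 1) / (2 ^ k.+1)%:R.
  have d01 : 0 <= (4^-1 : R) ^+ k <= 1 by rewrite exprn_ge0/=.
  have h1 : rint 0 1 (fun x => (U2 k.+1 x - U2 k x) ^+ 2) <= L * 4^-1 ^+ k.
    apply: (hL _ _ _ _ _ _ _ (A k.+1) (A k) d01).
    - move=> x x01; rewrite (_ : _ - _ = (U1 k.+1 x - w x) - (U1 k x - w x)); last by ring.
      rewrite (le_trans (ler_normB _ _))//; apply: le_trans (eS k).
      by rewrite lerD// U1w.
    - apply: (le_trans (EU k.+1)); rewrite lerD2l; apply: le_trans (eS k).
      by rewrite lerDl ltW.
    - by apply: (le_trans (EU k)); rewrite lerD2l.
  have p2 : 0 < 2 ^+ k :> R by rewrite exprn_gt0.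
  have jj : intg 0 1 (fun x => (U2 k.+1 x - U2 k x) ^+ 2).
    apply: (@intg_le _ _ _ _ (fun x => 2 * (U2 k.+1 x ^+ 2 + U2 k x ^+ 2))).
    - by apply: measurable_funX; apply: measurable_funB; exact: intg_meas.
    - by apply: intgZ; apply: intgD; exact: prof_L2 (A _).1.
    - move=> x _; rewrite ger0_norm ?sqr_ge0// -subr_ge0.
      by rewrite (_ : _ - _ = (U2 k.+1 x + U2 k x) ^+ 2) ?sqr_ge0//; ring.
  rewrite (le_trans (rint_amgm ler01 p2 (intgB (J2 _) (J2 _)) jj))//.
  apply: (@le_trans _ _ (2 ^+ k / 2 * (L * 4^-1 ^+ k) + (1 - 0) / (2 * 2 ^+ k))).
    by rewrite lerD2r ler_wpM2l// divr_ge0// ltW.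
  rewrite natrX (_ : (4^-1 : R) ^+ k = (2 ^+ k)^-1 ^+ 2); last first.
    by rewrite -exprVn -exprM mulnC exprM; congr (_ ^+ k); field.
  rewrite [2 ^+ k.+1]exprS le_eqVlt; apply/orP; left; apply/eqP.
  by field; rewrite gt_eqF.
have [|N [f [g [mN N0 jg hfg]]]] := L1_fast J2 _ jump; first by rewrite addr_ge0.
(* Multiplying by this indicator sets u'' to 0 on the exceptional null set, so that convergence
   holds at every point. *)
pose ind (x : R) : R := \1_(~` N) x.
have mind : measurable_fun (`[0, 1]%classic : set R) ind.
  by apply: measurable_funTS; apply: measurable_indic; exact: measurableC.
pose q k x := U2 k x * ind x; pose q2 x := f x * ind x.
have indE x : ~ N x -> ind x = 1 by move=> Nx; rewrite /ind indicE mem_set.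
have indE0 x : N x -> ind x = 0 by move=> Nx; rewrite /ind indicE memNset//=; apply.
have mq k : measurable_fun (`[0, 1]%classic : set R) (q k) by apply: measurable_funM => //; exact: intg_meas.
have Hq k := profile_ae eps (A k).1 mN N0 (fun x _ Nx => esym (etrans (congr1 _ (indE x Nx)) (mulr1 (U2 k x)))) (mq k).
have qf x : 0 <= x <= 1 -> q k x @[k --> \oo] --> q2 x.
  move=> x01; have [Nx|Nx] := pselect (N x).
    rewrite (_ : q ^~ x = fun=> 0); last by apply/funext => k; rewrite /q indE0// mulr0.
    by rewrite /q2 indE0// mulr0; exact: cvg_cst.
  by apply: cvgM; [exact: (hfg x x01 Nx).1|exact: cvg_cst].
have qg k x : 0 <= x <= 1 -> `|q k x| <= `|g x|.
  move=> x01; have [Nx|Nx] := pselect (N x); first by rewrite /q indE0// mulr0 normr0.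
  by rewrite /q indE// mulr1 (le_trans ((hfg x x01 Nx).2 k))// ler_norm.
have conv x : 0 <= x <= 1 -> intg 0 x q2 /\ rint 0 x (q k) @[k --> \oo] --> rint 0 x q2.
  move=> /andP[x0 x1]; apply: (@rint_dom _ 0 x q _ (fun x => `|g x|)).
  - move=> k; apply: intg_meas; apply: (@intg_sub _ 0 1) => //; exact: ac_intg (prof_ac1 (Hq k).1).
  - by move=> y /andP[y0 yx]; apply: qf; rewrite y0 (le_trans yx).
  - by apply: intg_abs; apply: intg_sub jg.
  - by move=> k y /andP[y0 yx]; apply: qg; rewrite y0 (le_trans yx).
have e_0 : e k @[k --> \oo] --> (0 : R).
  rewrite -(mul0r (4^-1 : R)); apply: cvgM; last exact: cvg_cst.
  by apply: cvg_expr; rewrite ger0_norm//; lra.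
have sq (h : nat -> R) (l : R) : (forall k, `|h k - l| <= e k) -> h k @[k --> \oo] --> l.
  move=> hl; apply/cvgrPdist_le => t t0.
  have /cvgrPdist_le/(_ _ t0) := e_0; apply: filterS => k /=.
  rewrite sub0r normrN => h1; rewrite distrC (le_trans (hl k))// (le_trans (ler_norm _))//.
have cU1 x : 0 <= x <= 1 -> U1 k x @[k --> \oo] --> w x.
  by move=> x01; apply: sq => k; exact: U1w.
have w0 : w 0 = 0.
  apply: (cvgn_unique (cU1 0 _)); first by rewrite lexx ler01.
  rewrite (_ : (fun k => U1 k 0) = fun=> 0); first exact: cvg_cst.
  by apply/funext => k; exact: prof_d0 (A k).1.
have w1 : w 1 = 0.
  apply: (cvgn_unique (cU1 1 _)); first by rewrite lexx ler01.
  rewrite (_ : (fun k => U1 k 1) = fun=> 0); first exact: cvg_cst.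
  by apply/funext => k; exact: prof_d1 (A k).1.
have acw : ac 0 1 w q2.
  split; first by have [] := conv 1; rewrite ?ler01 ?lexx.
  move=> x x01; rewrite w0 add0r; apply: (cvgn_unique (cU1 x x01)).
  rewrite (_ : (fun k => U1 k x) = fun k => rint 0 x (q k)); first exact: (conv x x01).2.
  apply/funext => k; have [_ ->//] := prof_ac1 (Hq k).1.
  by rewrite (prof_d0 (A k).1) add0r.
pose u x := alpha - rint x 1 w.
have jw : intg 0 1 w by apply: cont_intg; exact: ac_cont acw.
have acu : ac 0 1 u w.
  split => // x /andP[x0 x1].
  by rewrite /u (rint_chasles x0 x1 jw); ring.
have cU x : 0 <= x <= 1 -> U k x @[k --> \oo] --> u x.
  move=> /[dup] x01 /andP[x0 x1]; apply: sq => k.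
  have jk : intg x 1 (U1 k) by apply: intg_sub (ac_intg (prof_ac0 (A k).1)).
  have jwx : intg x 1 w by apply: intg_sub jw.
  have -> : U k x - u x = - rint x 1 (fun y => U1 k y - w y).
    rewrite rintB// -(ac_sub_rint (prof_ac0 (A k).1) x0 x1)// (prof_u1 (A k).1) /u; ring.
  rewrite normrN (le_trans (rint_abs (intgB jk jwx)))//.
  apply: (@le_trans _ _ (rint x 1 (fun=> e k))).
    apply: rint_le; [by apply: intg_abs; exact: intgB|exact: intg_cst|].
    by move=> y /andP[xy y1]; apply: U1w; rewrite y1 (le_trans x0).
  by rewrite rint_cst// ler_piMr ?(ltW (ep k))//; lra.
have wV x : 0 <= x <= 1 -> 0 <= w x <= V x.
  move=> x01; apply/andP; split.
    by apply: (cvgn_ge (cU1 x x01)) => k; have /andP[] := (A k).2 x x01.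
  by apply: (cvgn_le (cU1 x x01)) => k; have /andP[] := (A k).2 x x01.
have u1a : u 1 = alpha by rewrite /u rint_same subr0.
have uc x : 0 <= x <= 1 -> c0 <= u x := Vlow acu u1a wV (x := x).
have [jq2 _] : intg 0 1 (fun x => q2 x ^+ 2) /\ rint 0 1 (fun x => q2 x ^+ 2) <= (emin + 1) / (c0 / S ^+ 5).
  apply: (@rint_fatou _ 0 1 (fun k x => q k x ^+ 2)).
  - by move=> k; exact: prof_L2 (Hq k).1.
  - by move=> k x _; exact: sqr_ge0.
  - by move=> x x01; apply: cvgM; exact: qf.
  - move=> t t0; apply: nearW => k; apply: (@le_trans _ _ ((emin + 1) / (c0 / S ^+ 5))); last by rewrite lerDl ltW.
    rewrite ler_pdivlMr ?cS_gt0// mulrC.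
    have Aq : adm (U k) (U1 k) (q k) by split; [exact: (Hq k).1|exact: (A k).2].
    apply: (le_trans (adm_energy_ge Aq)); rewrite (Hq k).2 (le_trans (EU k))// lerD2l.
    exact: le_trans (e1 k) (e41 k).
have Hu : profile alpha u w q2.
  split => //.
  by move=> x x01; apply: lt_le_trans (uc x x01).
exists u, w, q2; split; first by split.
move=> v v1 v2 Av; apply: le_trans (emin_le Av).
rewrite (energy_lag eps Hu).
(* Lower semicontinuity: the Lagrangians are nonnegative and converge at every point of [0, 1]. *)
have [_ //] : intg 0 1 (fun x => lag eps (u x) (w x) (q2 x)) /\ rint 0 1 (fun x => lag eps (u x) (w x) (q2 x)) <= emin.
apply: (@rint_fatou _ 0 1 (fun k x => lag eps (U k x) (U1 k x) (q k x))).
- by move=> k; exact: prof_intg_lag (Hq k).1.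
- move=> k x x01.
  have Aq : adm (U k) (U1 k) (q k) by split; [exact: (Hq k).1|exact: (A k).2].
  apply: le_trans (adm_lag_ge Aq x01).
  by rewrite mulr_ge0 ?sqr_ge0// ltW// cS_gt0.
- move=> x x01; have c1 := cU x x01; have c2 := cU1 x x01; have c3 := qf x x01.
  have cs : sl (U1 k x) @[k --> \oo] --> sl (w x).
    apply: (@cvg_comp _ _ _ (fun k => U1 k x) sl _ _ _ c2).
    exact: is_derive_continuous (isd_sl (isd_id (w x))).
  have cz : U k x * sl (U1 k x) @[k --> \oo] --> u x * sl (w x) by apply: cvgM.
  have u0 : u x != 0 by rewrite gt_eqF// (lt_le_trans c00)// uc.
  rewrite /lag; apply: cvgD.
    apply: cvgD; last by apply: cvgM => //; exact: cvg_cst.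
    apply: cvgM; first exact: cvg_cst.
    by apply: cvgV => //; rewrite mulf_neq0// sl_neq0.
  apply: cvgM; last by apply: cvgM.
  apply: cvgM => //; apply: cvgV; first by rewrite expf_neq0// sl_neq0.
  apply: (@cvg_comp _ _ _ (fun k => sl (U1 k x)) (fun t => t ^+ 5) _ _ _ cs).
  exact: exprn_continuous.
- move=> t t0; have /cvgrPdist_le/(_ _ t0) := e_0; apply: filterS => k /=.
  rewrite sub0r normrN => h1; rewrite -(energy_lag eps (Hq k).1) (Hq k).2 (le_trans (EU k))// lerD2l.
  exact: le_trans (ler_norm _) h1.
Qed.

End Existence.

(** * The Euler-Lagrange system *)

Section EulerLagrange.
Context {R : realType}.
Notation mu := (@lebesgue_measure R).
Implicit Types (a b x y p q e d t K : R) (f g h phi psi : R -> R).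

Lemma rint_eq0 a b f : a <= b -> intg a b f -> (forall x, a <= x <= b -> 0 <= f x) -> rint a b f = 0 ->
  exists N : set R, [/\ measurable N, mu N = 0 & forall x, a <= x <= b -> ~ N x -> f x = 0].
Proof.
move=> ab jf f0 If.
have mf : measurable_fun `[a, b] (EFin \o f) by case/integrableP : jf.
have I0 : (\int[mu]_(x in `[a, b]) `|(EFin \o f) x| = 0)%E.
  rewrite -[RHS]/(0%:E) -If (rintE jf).
  by apply: eq_integral => x; rewrite inE/= in_itv/= => xab; rewrite ger0_norm// f0.
have [//|N [mN N0 hN]] := (@ae_eq_integral_abs _ _ _ mu `[a, b] _ _ mf).1 I0.
exists N; split => // x xab Nx.
have : ~ ~ ((EFin \o f) x = cst 0%E x).
  by move=> H; apply: Nx; apply: hN => /= H'; apply: H; apply: H'; rewrite in_itv.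
by move=> /contrapT [].
Qed.

(** The natural test function h - k need not be bounded, as h is only integrable. It is replaced by
    (h - k) / sqrt(1 + (h - k)^2) minus its mean; the mean drops out against h - k, whose integral
    is 0, and a nonnegative integrand remains. *)
Lemma dubois_reymond h : intg 0 1 h ->
  (forall psi K, measurable_fun (`[0, 1]%classic : set R) psi -> (forall x, 0 <= x <= 1 -> `|psi x| <= K) ->
     rint 0 1 psi = 0 -> rint 0 1 (fun x => h x * psi x) = 0) ->
  exists k (N : set R), [/\ measurable N, mu N = 0 & forall x, 0 <= x <= 1 -> ~ N x -> h x = k].
Proof.
move=> jh H; pose k := rint 0 1 h; pose g x := h x - k.
have jg : intg 0 1 g by apply: intgB => //; exact: intg_cst.
have g0 : rint 0 1 g = 0.
  by rewrite /g rintB ?rint_cst ?ler01//; [rewrite subr0 mulr1 subrr|exact: intg_cst].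
pose s x := g x / sl (g x).
have cs : continuous (fun t : R => t / sl t).
  move=> t; have d1 := isd_sl (isd_id t).
  have : isd (fun t => t / sl t) t (1 / sl t + t * (- (t * 1 / sl t) / sl t ^+ 2)).
    by apply: isd_eq; [der; exact: sl_neq0|rewrite /=; field; exact: sl_neq0].
  exact: is_derive_continuous.
have ms : measurable_fun (`[0, 1]%classic : set R) s.
  apply: (measurableT_comp (f := fun t : R => t / sl t)); last exact: intg_meas jg.
  exact: continuous_measurable_fun.
have s1 x : `|s x| <= 1 by exact: norm_sl_le.
have js : intg 0 1 s by apply: (intg_le ms (intg_cst 0 1 1)).
pose m := rint 0 1 s; pose psi x := s x - m.
have jpsi : intg 0 1 psi by apply: intgB => //; exact: intg_cst.
have p0 : rint 0 1 psi = 0.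
  by rewrite /psi rintB ?rint_cst ?ler01//; [rewrite subr0 mulr1 subrr|exact: intg_cst].
have pK x : 0 <= x <= 1 -> `|psi x| <= 1 + `|m|.
  by move=> _; rewrite (le_trans (ler_normB _ _))// lerD2r.
have := H psi (1 + `|m|) (intg_meas jpsi) pK p0.
have jgs : intg 0 1 (fun x => s x * g x) by apply: (intg_bdM ms _ jg) => x _; exact: s1.
have -> : rint 0 1 (fun x => h x * psi x) = rint 0 1 (fun x => s x * g x).
  transitivity (rint 0 1 (fun x => (s x * g x - m * g x) + k * psi x)).
    by apply: rint_eq => x _; rewrite /psi /g; ring.
  rewrite rintD; [|by apply: intgB => //; exact: intgZ|exact: intgZ].
  rewrite rintB//; last exact: intgZ.
  by rewrite !rintZ// p0 g0 !mulr0 subr0 addr0.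
move=> I0; have [|N [mN N0 hN]] := rint_eq0 ler01 jgs _ I0.
  move=> x _; rewrite /s mulrAC -expr2 divr_ge0 ?sqr_ge0//; exact: sqrtr_ge0.
exists k, N; split => // x x01 Nx.
have /eqP := hN x x01 Nx; rewrite /s mulrAC -expr2 mulf_eq0 sqrf_eq0 invr_eq0 (negbTE (sl_neq0 _)) orbF.
by rewrite /g subr_eq0 => /eqP.
Qed.

(** [lagY] and [lagP] are the partial derivatives of [lag] in y and p, and [dlag] is its
    differential. *)
Definition lagY eps y p q := (4 * eps - (y * sl p) ^- 2) * sl p + q ^+ 2 / sl p ^+ 5.
Definition lagP eps y p q := (4 * eps - (y * sl p) ^- 2) * (y * p / sl p) - 5 * y * p / sl p ^+ 7 * q ^+ 2.

Definition dlag eps y p q (dy dp dq : R) :=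
  lagY eps y p q * dy + lagP eps y p q * dp + 2 * (y / sl p ^+ 5) * q * dq.

Lemma isd_lag eps (f g h : R -> R) t (df dg dh : R) : f t != 0 -> isd f t df -> isd g t dg -> isd h t dh ->
  isd (fun s => lag eps (f s) (g s) (h s)) t (dlag eps (f t) (g t) (h t) df dg dh).
Proof.
move=> f0 hf hg hh; have hs := isd_sl hg; have s0 := sl_neq0 (g t).
rewrite /lag; apply: isd_eq; first by der; rewrite ?mulf_neq0 ?expf_neq0.
by rewrite /dlag /lagY /lagP /=; field; rewrite f0 s0.
Qed.

(** The majorant is integrable along a profile because q^2 is; this licenses differentiation under
    the integral sign. *)
Lemma dlag_bound eps (c A P K : R) : 0 < c -> 0 <= eps -> 0 <= A -> 0 <= P -> 0 <= K ->
  exists2 M : R, 0 <= M & forall y p q dy dp dq, c <= y <= A -> `|p| <= P -> `|dy| <= K -> `|dp| <= K ->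
    `|dq| <= K -> `|dlag eps y p q dy dp dq| <= M * (1 + q ^+ 2).
Proof.
move=> c0 e0 A0 P0 K0.
pose E : R := 4 * eps + c^-1 ^+ 2.
have E0 : 0 <= E by rewrite addr_ge0 ?mulr_ge0 ?exprn_ge0 ?invr_ge0 ?(ltW c0).
exists (E * ((1 + P) * K + A * K) + (K + 5 * A * K) + A * K).
  have h1 : 0 <= A * K := mulr_ge0 A0 K0.
  have h2 : 0 <= (1 + P) * K := mulr_ge0 (addr_ge0 ler01 P0) K0.
  have h3 : 0 <= 5 * A * K by rewrite -mulrA mulr_ge0.
  exact: addr_ge0 (addr_ge0 (mulr_ge0 E0 (addr_ge0 h2 h1)) (addr_ge0 K0 h3)) h1.
move=> y p q dy dp dq /andP[y1 y2] hp hdy hdp hdq.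
have y0 : 0 < y := lt_le_trans c0 y1.
have s0 := sl_gt0 p; have s1 := sl_ge1 p.
have sP : `|sl p| <= 1 + P.
  rewrite gtr0_norm//; have := sl_lip p 0; rewrite sl0 subr0 => /(le_trans (ler_norm _)).
  by move: hp; lra.
have hE : `|4 * eps - (y * sl p) ^- 2| <= E.
  rewrite (le_trans (ler_normB _ _))// lerD ?ger0_norm ?mulr_ge0// ?invr_ge0 ?exprn_ge0 ?mulr_ge0 ?(ltW y0) ?(ltW s0)//.
  rewrite -exprVn lerXn2r ?nnegrE ?invr_ge0 ?mulr_ge0 ?(ltW y0) ?(ltW s0) ?(ltW c0)//.
  by rewrite lef_pV2 ?posrE ?mulr_gt0// (le_trans y1)// ler_peMr// ltW.
have ps := norm_sl_le p.
have hyn : `|y| <= A by rewrite gtr0_norm.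
have q2 := sqr_ge0 q.
have -> : dlag eps y p q dy dp dq =
  (4 * eps - (y * sl p) ^- 2) * (sl p * dy + y * (p / sl p) * dp) +
  ((sl p)^-1 ^+ 5 * dy - 5 * (y * (p / sl p) * (sl p)^-1 ^+ 6 * dp)) * q ^+ 2 +
  2 * (y * (sl p)^-1 ^+ 5 * dq) * q.
  by rewrite /dlag /lagY /lagP; field; rewrite !gt_eqF.
have t1 : `|sl p * dy + y * (p / sl p) * dp| <= (1 + P) * K + A * K.
  rewrite (le_trans (ler_normD _ _))// lerD//; first by rewrite normrM ler_pM.
  by rewrite normrM ler_pM// normrM -[leRHS]mulr1 ler_pM.
have t2 : `|(sl p)^-1 ^+ 5 * dy - 5 * (y * (p / sl p) * (sl p)^-1 ^+ 6 * dp)| <= K + 5 * A * K.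
  rewrite (le_trans (ler_normB _ _))// lerD//.
    by rewrite normrM -[leRHS]mul1r ler_pM// slV_le1.
  rewrite normrM [`|5|]ger0_norm// -[leRHS]mulrA ler_wpM2l// normrM ler_pM// normrM -[leRHS]mulr1 ler_pM ?slV_le1//.
  by rewrite normrM -[leRHS]mulr1 ler_pM.
have t3 : `|y * (sl p)^-1 ^+ 5 * dq| <= A * K.
  by rewrite normrM ler_pM// normrM -[leRHS]mulr1 ler_pM// slV_le1.
have t4 : `|q| * 2 <= 1 + q ^+ 2.
  by rewrite -(real_normK (num_real q)); have := sqr_ge0 (`|q| - 1); rewrite sqrrB1; lra.
rewrite (le_trans (ler_normD _ _))// [leRHS]mulrDl lerD//.
  rewrite (le_trans (ler_normD _ _))// [leRHS]mulrDl lerD//.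
    rewrite normrM -[leLHS]mulr1 ler_pM ?mulr_ge0// ?ler_pM//.
    by rewrite lerDl.
  by rewrite normrM (ger0_norm q2) ler_pM// lerDr.
rewrite mulrAC normrM mulrC ler_pM//.
by rewrite normrM ger0_norm// mulrC.
Qed.

Section Variation.
Context (alpha eps c0 : R) (u u1 u2 : R -> R) (H : profile alpha u u1 u2).
Hypothesis c00 : 0 < c0.
Hypothesis e0 : 0 <= eps.
Hypothesis uc : forall x, 0 <= x <= 1 -> c0 <= u x.
Hypothesis umin : forall v v1 v2, profile alpha v v1 v2 -> energy eps u u1 u2 <= energy eps v v1 v2.

Lemma first_variation (phi phi1 psi : R -> R) K : ac 0 1 phi1 psi -> ac 0 1 phi phi1 ->
  phi 1 = 0 -> phi1 0 = 0 -> phi1 1 = 0 -> (forall x, 0 <= x <= 1 -> `|psi x| <= K) ->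
  rint 0 1 (fun x => dlag eps (u x) (u1 x) (u2 x) (phi x) (phi1 x) (psi x)) = 0.
Proof.
move=> ac1 ac0 p1 p10 p11 psiK.
have K0 : 0 <= K by apply: le_trans (psiK 0 _); rewrite // lexx ler01.
have [K1 K10 hK1] := cont_bounded (ac_cont ac1).
have [K2 K20 hK2] := cont_bounded (ac_cont ac0).
have [A A0 hA] := cont_bounded (prof_cont H).
have [P P0 hP] := cont_bounded (prof_cont1 H).
pose K3 := K + K1 + K2.
have K30 : 0 < K3 by rewrite /K3; lra.
have q1 x : 0 <= x <= 1 -> `|phi x| <= K3 by move=> /hK2; rewrite /K3; lra.
have q2 x : 0 <= x <= 1 -> `|phi1 x| <= K3 by move=> /hK1; rewrite /K3; lra.
have q3 x : 0 <= x <= 1 -> `|psi x| <= K3 by move=> /psiK; rewrite /K3; lra.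
(* For |t| < d the variation moves u by at most c0 / 2, so the competitor stays positive. *)
pose d := Num.min 1 (c0 / (2 * K3)).
have d0 : 0 < d by rewrite lt_min ltr01 divr_gt0// mulr_gt0.
have d1 : d <= 1 by rewrite ge_min lexx.
have dK : d * K3 <= c0 / 2.
  have : d <= c0 / (2 * K3) by rewrite ge_min lexx orbT.
  by rewrite ler_pdivlMr ?mulr_gt0// ler_pdivlMr//; lra.
pose w t x := u x + t * phi x. pose w1 t x := u1 x + t * phi1 x. pose w2 t x := u2 x + t * psi x.
have td t : t \in `]-d, d[ -> `|t| <= d.
  by rewrite in_itv/= ler_norml => /andP[h1 h2]; rewrite !ltW.
have small t x (f : R -> R) : t \in `]-d, d[ -> `|f x| <= K3 -> `|t * f x| <= d * K3.
  by move=> /td ht hf; rewrite normrM ler_pM.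
have wlow t x : t \in `]-d, d[ -> 0 <= x <= 1 -> c0 / 2 <= w t x.
  move=> ht x01; have := small t x phi ht (q1 x x01); rewrite ler_norml => /andP[h1 _].
  have h2 := uc x01; rewrite /w; apply: (@le_trans _ _ (c0 + - (c0 / 2))).
    by have -> : c0 - c0 / 2 = c0 / 2 by field.
  by rewrite lerD// (le_trans _ h1)// lerN2.
have c20 : 0 < c0 / 2 by rewrite divr_gt0.
have Hw t : t \in `]-d, d[ -> profile alpha (w t) (w1 t) (w2 t).
  move=> ht; split.
  - by apply: acD; [exact: prof_ac1 H|exact: acZ].
  - apply: (@intg_le _ _ _ _ (fun x => 2 * (u2 x ^+ 2 + K3 ^+ 2))).
    + apply: measurable_funX; apply: measurable_funD; first exact: intg_meas (ac_intg (prof_ac1 H)).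
      by apply: measurable_funM => //; exact: intg_meas (ac_intg ac1).
    + by apply: intgZ; apply: intgD; [exact: prof_L2 H|exact: intg_cst].
    + move=> x x01; rewrite ger0_norm ?sqr_ge0// /w2.
      have h1 : (t * psi x) ^+ 2 <= K3 ^+ 2.
        rewrite -[leLHS]real_normK ?num_real// lerXn2r ?nnegrE ?(ltW K30)//.
        by apply: (le_trans (small t x psi ht (q3 x x01))); rewrite ler_piMl// ltW.
      have := sqr_ge0 (u2 x - t * psi x); move: h1; set b := t * psi x => h1 h2.
      have -> : (u2 x + b) ^+ 2 = 2 * (u2 x ^+ 2 + b ^+ 2) - (u2 x - b) ^+ 2 by ring.
      by rewrite (@le_trans _ _ (2 * (u2 x ^+ 2 + b ^+ 2)))// ?gerBl// ler_wpM2l// lerD2l.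
  - by apply: acD; [exact: prof_ac0 H|exact: acZ].
  - by move=> x x01; apply: lt_le_trans c20 (wlow t x ht x01).
  - by rewrite /w p1 mulr0 addr0 (prof_u1 H).
  - by rewrite /w1 p10 mulr0 addr0 (prof_d0 H).
  - by rewrite /w1 p11 mulr0 addr0 (prof_d1 H).
pose F t x := lag eps (w t x) (w1 t x) (w2 t x).
have dF t x : t \in `]-d, d[ -> 0 <= x <= 1 ->
    isd (F^~ x) t (dlag eps (w t x) (w1 t x) (w2 t x) (phi x) (phi1 x) (psi x)).
  move=> ht x01; apply: isd_lag.
  - by rewrite gt_eqF// (lt_le_trans c20)// wlow.
  - by rewrite /w; apply: isd_eq; [der|rewrite /=; ring].
  - by rewrite /w1; apply: isd_eq; [der|rewrite /=; ring].
  - by rewrite /w2; apply: isd_eq; [der|rewrite /=; ring].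
have AK : 0 <= A + K3 by rewrite addr_ge0 ?(ltW A0) ?(ltW K30).
have PK : 0 <= P + K3 by rewrite addr_ge0 ?(ltW P0) ?(ltW K30).
have [M M0 hM] := dlag_bound c20 e0 AK PK (ltW K30).
pose G x := M * (1 + 2 * (u2 x ^+ 2 + K3 ^+ 2)).
have G0 x : 0 <= G x by rewrite mulr_ge0// addr_ge0// mulr_ge0// addr_ge0 ?sqr_ge0.
have jG : intg 0 1 G.
  apply: intgZ; apply: intgD; first exact: intg_cst.
  by apply: intgZ; apply: intgD; [exact: prof_L2 H|exact: intg_cst].
have tK t : t \in `]-d, d[ -> d * K3 <= K3 by move=> _; rewrite ler_piMl// ltW.
have Gb t x : t \in `]-d, d[ -> 0 <= x <= 1 -> `|derive1 (F^~ x) t| <= G x.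
  move=> ht x01; rewrite (isd_derive1 (dF t x ht x01)).
  have s1 := le_trans (small t x phi ht (q1 x x01)) (tK t ht).
  have s2 := le_trans (small t x phi1 ht (q2 x x01)) (tK t ht).
  have s3 := le_trans (small t x psi ht (q3 x x01)) (tK t ht).
  apply: (@le_trans _ _ (M * (1 + w2 t x ^+ 2))).
    apply: hM; rewrite ?q1 ?q2 ?q3//.
    - rewrite wlow//= /w; apply: (le_trans (ler_norm _)); apply: (le_trans (ler_normD _ _)).
      by rewrite lerD// hA.
    - by rewrite (le_trans (ler_normD _ _))// lerD// hP.
  rewrite ler_wpM2l// lerD2l.
  have h1 : (t * psi x) ^+ 2 <= K3 ^+ 2.
    by rewrite -[leLHS]real_normK ?num_real// lerXn2r ?nnegrE ?(ltW K30).
  have := sqr_ge0 (u2 x - t * psi x); move: h1; rewrite /w2; set b := t * psi x => h1 h2.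
  have -> : (u2 x + b) ^+ 2 = 2 * (u2 x ^+ 2 + b ^+ 2) - (u2 x - b) ^+ 2 by ring.
  by rewrite (@le_trans _ _ (2 * (u2 x ^+ 2 + b ^+ 2)))// ?gerBl// ler_wpM2l// lerD2l.
pose I t : R := \int[mu]_(x in `[0, 1]) F t x.
have IE t : t \in `]-d, d[ -> I t = energy eps (w t) (w1 t) (w2 t).
  by move=> ht; rewrite (energy_lag eps (Hw t ht)).
have jF t : `]-d, d[%classic t -> mu.-integrable `[0, 1] (EFin \o F t).
  by move=> /= ht; exact: prof_intg_lag (Hw t ht).
have derF t x : `]-d, d[%classic t -> `[0, 1]%classic x -> derivable (F^~ x) t 1.
  by move=> /= ht; rewrite in_itv/= => x01; exact: isd_derivable (dF t x ht x01).
have GF t x : `]-d, d[%classic t -> `[0, 1]%classic x -> `|partial1of2 F t x| <= G x.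
  by move=> /= ht; rewrite in_itv/= => x01; exact: Gb.
have zi : (0 : R) \in `]-d, d[ by rewrite in_itv/= oppr_lt0 d0.
have dI t : t \in `]-d, d[ -> derivable I t 1.
  by move=> ht; apply: (@derivable_under_integral _ _ _ mu F `[0, 1] _ t (- d) d ht jF derF G).
have w0E : energy eps (w 0) (w1 0) (w2 0) = energy eps u u1 u2.
  by apply: rint_eq => x _; rewrite /w /w1 /w2 !mul0r !addr0.
have Imin t : t \in `]-d, d[ -> I 0 <= I t.
  by move=> ht; rewrite (IE 0 zi) (IE t ht) w0E; apply: umin; exact: Hw.
have dd : - d <= d by rewrite ge0_cp// ltW.
have D0 := derive1_at_min dd dI zi Imin.
have E := @differentiation_under_integral _ _ _ mu F `[0, 1] (measurable_itv _) 0 (- d) d zi jF derF G.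
transitivity (derive1 I 0); last by rewrite derive1E; case: D0.
rewrite /I E//; apply: eq_Rintegral => x; rewrite inE/= in_itv/= => x01.
rewrite /partial1of2 (isd_derive1 (dF 0 x zi x01)).
by rewrite /w /w1 /w2 !mul0r !addr0.
Qed.

(* D and E are the momenta conjugate to u' and u; E vanishes at 0 because u 0 is free. *)
Lemma EL_system : exists q D E : R -> R,
  [/\ profile alpha u u1 q, energy eps u u1 q = energy eps u u1 u2,
     cont 0 1 D, cont 0 1 E & E 0 = 0] /\
  [/\ forall x, q x = D x * sl (u1 x) ^+ 5 / (2 * u x),
     forall x, 0 < x < 1 -> isd u1 x (q x),
     forall x, 0 < x < 1 -> isd D x (lagP eps (u x) (u1 x) (q x) - E x) &
     forall x, 0 < x < 1 -> isd E x (lagY eps (u x) (u1 x) (q x))].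
Proof.
have cu := prof_cont H; have cu1 := prof_cont1 H; have cs := cont_sl cu1.
have un0 x : 0 <= x <= 1 -> u x != 0 by exact: (prof_neq0 H).
have s0 n x : sl (u1 x) ^+ n != 0 by rewrite expf_neq0// sl_neq0.
have zn0 x : 0 <= x <= 1 -> (u x * sl (u1 x)) ^+ 2 != 0.
  by move=> x01; rewrite expf_neq0// mulf_neq0 ?sl_neq0// un0.
have nzV x : 0 <= x <= 1 -> [/\ (u x * sl (u1 x)) ^+ 2 != 0, sl (u1 x) ^+ 5 != 0, sl (u1 x) ^+ 7 != 0,
    sl (u1 x) != 0 & 2 * u x != 0] by move=> x01; rewrite zn0// !s0 sl_neq0 mulf_neq0// un0.
have cY1 : cont 0 1 (fun x => (4 * eps - (u x * sl (u1 x)) ^- 2) * sl (u1 x)) by ct.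
have cP1 : cont 0 1 (fun x => (4 * eps - (u x * sl (u1 x)) ^- 2) * (u x * u1 x / sl (u1 x))).
  by ct => x /nzV[].
have cP2 : cont 0 1 (fun x => 5 * u x * u1 x / sl (u1 x) ^+ 7) by ct => x /nzV[].
have cV5 : cont 0 1 (fun x => (sl (u1 x) ^+ 5)^-1) by ct => x /nzV[].
pose C (q : R -> R) x := lagY eps (u x) (u1 x) (q x).
pose B (q : R -> R) x := lagP eps (u x) (u1 x) (q x).
have j2 := prof_L2 H.
have jC : intg 0 1 (C u2).
  apply: intgD; first exact: cont_intg.
  by apply: (@intg_eq _ _ _ (fun x => (sl (u1 x) ^+ 5)^-1 * u2 x ^+ 2)); [move=> x _; rewrite mulrC|exact: intg_contM].
have jB : intg 0 1 (B u2) by apply: intgB; [exact: cont_intg|exact: intg_contM].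
pose E x := rint 0 x (C u2).
have acE : ac 0 1 E (C u2) by split => // x _; rewrite /E rint_same add0r.
have E0 : E 0 = 0 by rewrite /E rint_same.
have jBE : intg 0 1 (fun x => B u2 x - E x) by apply: intgB => //; apply: cont_intg; exact: ac_cont acE.
pose D0 x := rint 0 x (fun x => B u2 x - E x).
have acD0 : ac 0 1 D0 (fun x => B u2 x - E x) by split => // x _; rewrite /D0 rint_same add0r.
(* Integrating the first variation by parts leaves the integral of h times psi = phi'', where psi is
   any bounded function of mean zero; hence h is constant almost everywhere. *)
pose h x := 2 * (u x / sl (u1 x) ^+ 5) * u2 x - D0 x.
have cb : cont 0 1 (fun x => 2 * (u x / sl (u1 x) ^+ 5)) by ct => x /nzV[].
have j1 := ac_intg (prof_ac1 H).
have jh : intg 0 1 h.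
  by apply: intgB; [exact: intg_contM|apply: cont_intg; exact: ac_cont acD0].
have [k [N [mN N0 hN]]] : exists k (N : set R),
    [/\ measurable N, mu N = 0 & forall x, 0 <= x <= 1 -> ~ N x -> h x = k].
  apply: dubois_reymond => // psi K mpsi psiK psi0.
  have jpsi : intg 0 1 psi by apply: (intg_le mpsi (intg_cst 0 1 K)).
  pose phi1 x := rint 0 x psi.
  have ac1 : ac 0 1 phi1 psi by split => // x _; rewrite /phi1 rint_same add0r.
  have p10 : phi1 0 = 0 by rewrite /phi1 rint_same.
  have p11 : phi1 1 = 0 by [].
  have jp1 : intg 0 1 phi1 by apply: cont_intg; exact: ac_cont ac1.
  (* Integrated from the right end, since only the value of phi at 1 is prescribed. *)
  pose phi x := - rint x 1 phi1.
  have ac0 : ac 0 1 phi phi1.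
    by split => // x /andP[x0 x1]; rewrite /phi (rint_chasles x0 x1 jp1); ring.
  have p1 : phi 1 = 0 by rewrite /phi rint_same oppr0.
  have V := first_variation ac1 ac0 p1 p10 p11 psiK.
  have bp f g : intg 0 1 f -> cont 0 1 g -> intg 0 1 (fun x => f x * g x).
    by move=> jf cg; apply: (@intg_eq _ _ _ (fun x => g x * f x)); [move=> x _; rewrite mulrC|exact: intg_contM].
  have I1 := acM ler01 ac0 acE.
  have I2 := acM ler01 ac1 acD0.
  have ends f g : ac 0 1 f g -> rint 0 1 g = f 1 - f 0.
    by move=> hf; rewrite (ac_sub_rint hf)// ler01.
  have := ends _ _ I1; rewrite p1 E0 mul0r mulr0 subrr => e1.
  have := ends _ _ I2; rewrite p10 p11 !mul0r subrr => e2.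
  transitivity (rint 0 1 (fun x => dlag eps (u x) (u1 x) (u2 x) (phi x) (phi1 x) (psi x)
      - (phi1 x * E x + phi x * C u2 x) - (psi x * D0 x + phi1 x * (B u2 x - E x)))).
    by apply: rint_eq => x _; rewrite /h /dlag /C /B; ring.
  have jd : intg 0 1 (fun x => dlag eps (u x) (u1 x) (u2 x) (phi x) (phi1 x) (psi x)).
    apply: intgD; first apply: intgD.
    - by apply: bp => //; exact: ac_cont ac0.
    - by apply: bp => //; exact: ac_cont ac1.
    - apply: (@intg_eq _ _ _ (fun x => psi x * (2 * (u x / sl (u1 x) ^+ 5) * u2 x))); first by move=> x _; ring.
      by apply: (intg_bdM mpsi psiK); exact: intg_contM.
  rewrite rintB; [|by apply: intgB => //; exact: ac_intg I1|exact: ac_intg I2].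
  by rewrite rintB//; [rewrite V e1 e2 !subr0|exact: ac_intg I1].
pose D x := D0 x + k.
(* The momentum relation D = 2 u u'' / (1 + u'^2)^(5/2), solved for u'': a continuous
   representative. *)
pose q x := D x * sl (u1 x) ^+ 5 / (2 * u x).
have cD : cont 0 1 D by apply: contD; [exact: ac_cont acD0|exact: cont_cst].
have cq : cont 0 1 q by rewrite /q; ct => x /nzV[].
have uq x : 0 <= x <= 1 -> ~ N x -> u2 x = q x.
  move=> x01 Nx; have hx := hN x x01 Nx.
  have -> : q x = (D0 x + h x) * sl (u1 x) ^+ 5 / (2 * u x) by rewrite /q /D hx.
  by rewrite /h; field; rewrite un0// sl_neq0.
have [Hq eq] := profile_ae eps H mN N0 uq (cont_meas cq).
have cCq : cont 0 1 (C q) by rewrite /C /lagY; ct => x /nzV[].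
have cBq : cont 0 1 (B q) by rewrite /B /lagP; ct => x /nzV[].
have jCq := cont_intg cCq.
have cE := ac_cont acE.
have acEq : ac 0 1 E (C q).
  split => // x /[dup] x01 /andP[x0 x1]; rewrite E0 add0r /E.
  apply: (rint_ae mN N0).
  - by move=> y /andP[y0 yx] Ny; rewrite /C uq// y0 (le_trans yx).
  - by apply: intg_meas; apply: intg_sub jC.
  - by apply: intg_meas; apply: intg_sub jCq.
have cBE : cont 0 1 (fun x => B q x - E x) by exact: contB.
have acDq : ac 0 1 D (fun x => B q x - E x).
  have jq := cont_intg cBE.
  split => // x /[dup] x01 /andP[x0 x1].
  rewrite /D addrAC; congr (_ + _); rewrite /D0 rint_same add0r.
  apply: (rint_ae mN N0).
  - by move=> y /andP[y0 yx] Ny; rewrite /B uq// y0 (le_trans yx).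
  - by apply: intg_meas; apply: intg_sub jBE.
  - by apply: intg_meas; apply: intg_sub jq.
exists q, D, E; split; split => // x x01.
- by apply: ac_derive (prof_ac1 Hq) x01 (cont_for cq x01).
- by apply: ac_derive acDq x01 (cont_for cBE x01).
- by apply: ac_derive acEq x01 (cont_for cCq x01).
Qed.

End Variation.
End EulerLagrange.

(** * Smooth functions and Borel's lemma *)

Section SmoothFunctions.
Context {R : realType}.
Implicit Types (a b c x y h e C : R) (f g F : R -> R) (n k m : nat).

Lemma isd_quad f x d C : (forall h, `|h| <= 1 -> `|f (h + x) - f x - h * d| <= C * h ^+ 2) -> isd f x d.
Proof.
move=> H.
have key : h^-1 *: (f (h *: 1 + x) - f x) @[h --> 0^'] --> d.
  apply/cvgrPdist_le => e e0; near=> h.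
  have h0 : h != 0 by near: h; exact: nbhs_dnbhs_neq.
  have h1 : `|h| <= 1.
    near: h; apply: nbhs_dnbhs; apply/nbhs_ballP; exists 1 => //= z.
    by rewrite /ball/= sub0r normrN => /ltW.
  have h2 : `|h| <= e / (`|C| + 1).
    near: h; apply: nbhs_dnbhs; apply/nbhs_ballP; exists (e / (`|C| + 1)) => /=.
      by rewrite divr_gt0// ltr_wpDl.
    by move=> z; rewrite /ball/= sub0r normrN => /ltW.
  rewrite distrC [h *: 1]mulr1 /GRing.scale/=.
  rewrite (_ : h^-1 * (f (h + x) - f x) - d = h^-1 * (f (h + x) - f x - h * d)); last by field.
  rewrite normrM normfV ler_pdivrMl ?normr_gt0//.
  apply: (le_trans (H h h1)); rewrite -(real_normK (num_real h)) expr2 mulrCA.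
  rewrite ler_wpM2l//; apply: (@le_trans _ _ ((`|C| + 1) * `|h|)).
    by rewrite ler_wpM2r// (le_trans (ler_norm _))// lerDl.
  by move: h2; rewrite ler_pdivlMr ?ltr_wpDl// mulrC.
split; last by apply/cvg_lim.
by apply/cvg_ex; exists d.
Unshelve. all: by end_near. Qed.

(** By the mean value theorem, a derivative that extends continuously across a point is the
    derivative there. Used at the axis of reflection and at both ends of a smooth extension. *)
Lemma isd_glue a c b f g : a < c < b -> cont a c f -> cont c b f -> cont a c g -> cont c b g ->
  (forall x, a < x < b -> x != c -> isd f x (g x)) -> isd f c (g c).
Proof.
move=> /andP[ac cb] cf1 cf2 cg1 cg2 H.
have key : h^-1 *: (f (h *: 1 + c) - f c) @[h --> 0^'] --> g c.
  apply/cvgrPdist_le => e e0.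
  have [|d1 d10 h1] := cont_ed cg1 (x := c) _ e0; first by rewrite lexx ltW.
  have [|d2 d20 h2] := cont_ed cg2 (x := c) _ e0; first by rewrite lexx ltW.
  pose d := Num.min (Num.min d1 d2) (Num.min (c - a) (b - c)).
  have d0 : 0 < d by rewrite !lt_min d10 d20 !subr_gt0 ac cb.
  near=> h.
  have h0 : h != 0 by near: h; exact: nbhs_dnbhs_neq.
  have : `|h| < d.
    near: h; apply: nbhs_dnbhs; apply/nbhs_ballP; exists d => //= z.
    by rewrite /ball/= sub0r normrN.
  rewrite !lt_min => /andP[/andP[hd1 hd2] /andP[ha hb]].
  rewrite distrC [h *: 1]mulr1 /GRing.scale/=.
  have [hn|hp|] := ltgtP h 0; last by move=> E; rewrite E eqxx in h0.
    rewrite ltr0_norm// in hd1 hd2 ha hb.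
    have lt1 : h + c < c by lra.
    have D x : h + c < x < c -> isd f x (g x).
      by move=> xx; apply: H; [lra|rewrite lt_eqF//; lra].
    have [|z /andP[z1 z2] E] := mvt_in lt1 D; first by apply: cont_sub cf1 => //; lra.
    have -> : h^-1 * (f (h + c) - f c) = g z.
      by rewrite -opprB E; field.
    by apply/ltW/h1; [lra|rewrite ltr0_norm; lra].
  rewrite gtr0_norm// in hd1 hd2 ha hb.
  have lt1 : c < h + c by lra.
  have D x : c < x < h + c -> isd f x (g x).
    by move=> xx; apply: H; [lra|rewrite gt_eqF//; lra].
  have [|z /andP[z1 z2] E] := mvt_in lt1 D; first by apply: cont_sub cf2 => //; lra.
  have -> : h^-1 * (f (h + c) - f c) = g z by rewrite E; field.
  by apply/ltW/h2; [lra|rewrite gtr0_norm; lra].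
split; last by apply/cvg_lim.
by apply/cvg_ex; exists (g c).
Unshelve. all: by end_near. Qed.

(** k-fold differentiability by recursion on the derivative, so that products and affine
    substitutions are easy inductions; [ck_smooth] converts it to iterated derivatives. *)
Fixpoint ck k f : Prop :=
  if k is k'.+1 then exists2 f', (forall x, isd f x (f' x)) & ck k' f' else True.

Lemma ckS k f : ck k.+1 f -> ck k f.
Proof. by elim: k f => // k ih f [f' df cf']; exists f' => //; exact: ih. Qed.

Lemma ckD k f g : ck k f -> ck k g -> ck k (fun x => f x + g x).
Proof.
elim: k f g => // k ih f g [f' df cf'] [g' dg cg'].
exists (fun x => f' x + g' x); last exact: ih.
by move=> x; exact: isdD.
Qed.

Lemma ckM k f g : ck k f -> ck k g -> ck k (fun x => f x * g x).
Proof.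
elim: k f g => // k ih f g /[dup] /ckS cf [f' df cf'] /[dup] /ckS cg [g' dg cg'].
exists (fun x => f' x * g x + f x * g' x); last by apply: ckD; exact: ih.
by move=> x; exact: isdM.
Qed.

Lemma ck_cst k c : ck k (fun=> c).
Proof. by elim: k c => // k ih c; exists (fun=> 0) => [x|//]; exact: isd_cst. Qed.

Lemma ck_id k : ck k id.
Proof. by case: k => // k; exists (fun=> 1) => [x|]; [exact: isd_id|exact: ck_cst]. Qed.

Lemma ckX k n f : ck k f -> ck k (fun x => f x ^+ n).
Proof.
move=> cf; elim: n => [|n ih]; first exact: ck_cst.
by under eq_fun do rewrite exprS; exact: ckM.
Qed.

Lemma ck_lin k f a b : ck k f -> ck k (fun x => f (a * x + b)).
Proof.
elim: k f => // k ih f [f' df cf'].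
exists (fun x => f' (a * x + b) * a); last by apply: ckM; [exact: ih|exact: ck_cst].
move=> x; have h : isd (fun x => a * x + b) x a by apply: isd_eq; [der|rewrite /=; ring].
exact: (isd_comp (df _) h).
Qed.

Lemma ck_smooth f : (forall k, ck k f) -> forall n x, isd (derive1n n f) x (derive1n n.+1 f x).
Proof.
move=> H n x.
have {H} : forall k, ck k (derive1n n f).
  elim: n => [k|n ih k]; first by rewrite derive1n0.
  have [f' df cf'] := ih k.+1.
  rewrite derive1nS (_ : derive1 _ = f')//.
  by apply/funext => y; exact: isd_derive1.
move=> /(_ 1%N)[f' df _]; rewrite derive1nS.
by rewrite (isd_derive1 (df x)).
Qed.

Lemma isd_derive1n (w : nat -> R -> R) : (forall n x, isd (w n) x (w n.+1 x)) ->
  forall n, derive1n n (w 0%N) = w n.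
Proof.
move=> H; elim=> [|n ih]; first exact: derive1n0.
by rewrite derive1nS ih; apply/funext => x; exact: isd_derive1.
Qed.

(** Derivatives of these functions are linear combinations of functions of the same family, so one
    formula handles all orders; m = 0 is the usual flat function. *)
Definition flat m x : R := if 0 < x then x^-1 ^+ m * expR (- x^-1) else 0.

Lemma expR_ge_pow n y : 0 <= y -> y ^+ n / n`!%:R <= expR y.
Proof.
elim: n y => [y y0|n ih y y0].
  by rewrite expr0 fact0 divr1 (le_trans _ (expR_ge1Dx _))// lerDl.
have fn0 : n.+1`!%:R != 0 :> R by rewrite pnatr_eq0 -lt0n fact_gt0.
have fE : n.+1`!%:R = n.+1%:R * n`!%:R :> R by rewrite factS natrM.
have d x : isd (fun x => expR x - x ^+ n.+1 / n.+1`!%:R) x (expR x - x ^+ n / n`!%:R).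
  apply: isd_eq; first by der.
  rewrite /= fE; field; rewrite nat1r !pnatr_eq0 -lt0n fact_gt0//.
have := derive_ge0_le y0 (fun x _ => d x) _ (is_derive_cont d).
rewrite /= expR0 expr0n mul0r subr0 => h.
have {}h : 1 <= expR y - y ^+ n.+1 / n.+1`!%:R.
  by apply: h => x /andP[x0 _]; rewrite subr_ge0; apply: ih; exact: ltW.
lra.
Qed.

(** exp(1/h) dominates the term of order m + 2 of its series, which leaves a factor h^2: enough for
    a zero derivative at 0. *)
Lemma flat_le m h : `|flat m h| <= (m.+2)`!%:R * h ^+ 2.
Proof.
rewrite /flat; case: ifP => [h0|_]; last by rewrite normr0 mulr_ge0 ?sqr_ge0.
have hi : 0 < h^-1 by rewrite invr_gt0.
rewrite ger0_norm ?mulr_ge0 ?exprn_ge0 ?expR_ge0 ?(ltW hi)//.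
have := expR_ge_pow m.+2 (ltW hi).
have E0 := expR_gt0 h^-1.
rewrite expRN ler_pdivrMr ?ltr0n ?fact_gt0// => H.
rewrite ler_pdivrMr// mulrAC.
have -> : h^-1 ^+ m = h ^+ 2 * h^-1 ^+ m.+2 by rewrite !exprS; field; rewrite gt_eqF.
by rewrite [leRHS]mulrC ler_wpM2l ?sqr_ge0// mulrC.
Qed.

Lemma isd_flat m x : isd (flat m) x (- m%:R * flat m.+1 x + flat m.+2 x).
Proof.
case: (ltgtP 0 x) => [x0|x0|<-].
- have pos : \near x, 0 < x by exact: lt_nbhsr.
  apply: (@isd_near _ (fun x => x^-1 ^+ m * expR (- x^-1))).
    by apply: filterS pos => y y0; rewrite /flat y0.
  apply: isd_eq; first by der; rewrite gt_eqF.
  rewrite /flat x0 /=; case: m => [|m]; rewrite /= ?exprS; field; rewrite gt_eqF//.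
- have neg : \near x, x < 0 by exact: lt_nbhsl.
  rewrite /flat (ltNge 0 x) (ltW x0)/= mulr0 addr0.
  apply: (@isd_near _ (fun=> 0)); last exact: isd_cst.
  by apply: filterS neg => y y0; rewrite ltNge (ltW y0).
- rewrite /flat ltxx mulr0 addr0; apply: (@isd_quad _ _ _ (m.+2)`!%:R) => h _.
  rewrite mulr0 subr0 addr0 ltxx subr0; exact: flat_le.
Qed.

Lemma ck_flat k m : ck k (flat m).
Proof.
elim: k m => // k ih m; exists (fun x => - m%:R * flat m.+1 x + flat m.+2 x); first exact: isd_flat.
by apply: ckD => //; apply: ckM => //; exact: ck_cst.
Qed.

Lemma bump_ex : exists chi : R -> R, [/\ forall k, ck k chi, forall x, -1 <= x <= 1 -> chi x = 1 &
  forall x, 2 <= `|x| -> chi x = 0].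
Proof.
(* [b] is positive exactly on (1, 2); one minus its normalised primitive is a smooth step from 1 to
   0, and the product of the step with its reflection is the cutoff. *)
pose b x := flat 0 (x - 1) * flat 0 (2 - x).
have ckb k : ck k b.
  apply: ckM.
    rewrite (_ : (fun x => flat 0 (x - 1)) = (fun x => flat 0 (1 * x + -1))).
      exact: ck_lin (ck_flat _ _).
    by apply/funext => x; rewrite mul1r.
  rewrite (_ : (fun x => flat 0 (2 - x)) = (fun x => flat 0 (-1 * x + 2))).
    exact: ck_lin (ck_flat _ _).
  by apply/funext => x; congr flat; ring.
have b0 x : 0 <= b x.
  by rewrite /b /flat; case: ifP; case: ifP => *; rewrite ?mul0r ?mulr0// mulr_ge0// mul1r expR_ge0.
have b1 x : x <= 1 -> b x = 0 by move=> x1; rewrite /b /flat ltNge subr_le0 x1/= mul0r.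
have b2 x : 2 <= x -> b x = 0.
  by move=> x1; rewrite /b /flat [0 < 2 - x]ltNge subr_le0 x1/= mulr0.
have [b' db _] := ckb 1%N.
have cb x y : cont x y b := is_derive_cont db.
pose B x := rint 0 x b.
have B1 x : x <= 1 -> B x = 0.
  move=> x1; rewrite /B (@rint_eq _ _ _ _ (fun=> 0)); last by move=> y /andP[_ yx]; apply: b1; exact: le_trans x1.
  have [x0|x0] := leP 0 x; first by rewrite rint_cst// mul0r.
  by rewrite /rint set_itv_ge ?Rintegral_set0// bnd_simp -ltNge.
have dB x : isd B x (b x).
  have [x0|x0] := ltP 0 x.
    have x01 : 0 < x < x + 1 by rewrite x0 ltrDl ltr01.
    exact: rint_derive (cont_intg (cb _ _)) x01 (cont_for (cb 0 (x + 1)) x01).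
  rewrite b1; last by lra.
  apply: (@isd_near _ (fun=> 0)); last exact: isd_cst.
  have lt1 : x < 1 by lra.
  have := lt_nbhsl lt1; apply: filterS => y y1; rewrite B1//; exact: ltW.
have B2 x : 2 <= x -> B x = B 2.
  move=> x2; rewrite /B (@rint_chasles _ 0 2 x)//; last exact: cont_intg.
  rewrite [X in _ + X](_ : _ = 0) ?addr0//.
  rewrite (@rint_eq _ _ _ _ (fun=> 0)); last by move=> y /andP[y2 _]; exact: b2.
  by rewrite rint_cst// mul0r.
have Bpos : 0 < B 2.
  rewrite -(B1 1 (lexx _)); apply: (derive_gt0_lt _ (fun x _ => dB x)).
  - by lra.
  - by move=> x /andP[x1 x2]; rewrite /b /flat !subr_gt0 x1 x2 !mul1r mulr_gt0// expR_gt0.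
  - exact: is_derive_cont dB.
have ckB k : ck k B by case: k => // k; exists b.
pose step x := 1 - B x / B 2.
have ckst k : ck k step.
  apply: ckD; first exact: ck_cst.
  rewrite (_ : (fun x => - (B x / B 2)) = (fun x => B x * - (B 2)^-1)); last by apply/funext => x; rewrite mulrN.
  by apply: ckM => //; exact: ck_cst.
exists (fun x => step x * step (- x)); split.
- move=> k; apply: ckM => //.
  rewrite (_ : (fun x => step (- x)) = (fun x => step (-1 * x + 0))); first exact: ck_lin.
  by apply/funext => x; congr step; ring.
- move=> x /andP[x1 x2]; have xn : - x <= 1 by lra.
  by rewrite /step (B1 x)// (B1 (- x))// mul0r subr0 mulr1.
- move=> x; have [x0|x0] := ger0P x => x2.
    by rewrite /step (B2 x x2) divff ?gt_eqF// subrr mul0r.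
  by rewrite /step (B2 (- x) x2) divff ?gt_eqF// subrr mulr0.
Qed.

Lemma isd_zero_out f g r : (forall x, isd f x (g x)) -> (forall x, r < `|x| -> f x = 0) ->
  forall x, r < `|x| -> g x = 0.
Proof.
move=> df f0 x xr; rewrite -(isd_derive1 (df x)); apply: isd_derive1.
apply: (@isd_near _ (fun=> 0)); last exact: isd_cst.
move: xr; rewrite ltr_normr => /orP[xr|xr].
  by have := lt_nbhsr xr; apply: filterS => y ry; rewrite f0// ltr_normr ry.
have xr' : x < - r by rewrite ltrNr.
by have := lt_nbhsl xr'; apply: filterS => y ry; rewrite f0// ltr_normr [r < - y]ltrNr ry orbT.
Qed.

Lemma derive1n_monomial (D : nat -> R -> R) n : (forall k x, isd (D k) x (D k.+1 x)) ->
  (forall x, `|x| < 1 -> D 0%N x = x ^+ n) ->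
  forall k x, `|x| < 1 -> D k x = (n ^_ k)%:R * x ^+ (n - k).
Proof.
move=> dD D0; elim=> [x x1|k ih x x1]; first by rewrite D0// ffactn0 subn0 mul1r.
rewrite -(isd_derive1 (dD k x)); apply: isd_derive1.
apply: (@isd_near _ (fun x => (n ^_ k)%:R * x ^+ (n - k))).
  move: x1; rewrite ltr_norml => /near_oo; apply: filterS => y y1.
  by rewrite ih// ltr_norml.
apply: isd_eq; first by der.
rewrite /= ffactnSr natrM subnS; ring.
Qed.

Lemma cvg_geo_dominated (M : nat -> R) N : (forall n, 0 <= M n) ->
  (forall n, (N <= n)%N -> M n <= 2^-1 ^+ n) -> cvgn (series M).
Proof.
move=> M0 MN; apply: nondecreasing_is_cvgn.
  by apply/nondecreasing_seqP => n; rewrite /series/= big_nat_recr//= lerDl.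
pose S := \sum_(0 <= i < N) M i.
have geo n : \sum_(0 <= i < n) (2^-1 : R) ^+ i = 2 - 2 * 2^-1 ^+ n.
  elim: n => [|n ih]; first by rewrite big_geq// expr0 mulr1 subrr.
  by rewrite big_nat_recr//= ih exprS; field.
exists (S + 2) => _ [n _ <-].
have -> : series M n = \sum_(0 <= i < n) M i by [].
apply: (@le_trans _ _ (\sum_(0 <= i < n) ((if (i < N)%N then M i else 0) + 2^-1 ^+ i))).
  apply: ler_sum_nat => i _; case: ltnP => iN; first by rewrite lerDl exprn_ge0.
  by rewrite add0r MN.
rewrite big_split/= geo lerD//; last by rewrite gerDl oppr_le0 mulr_ge0// exprn_ge0.
rewrite -big_mkcond/= /S.
apply: (@le_trans _ _ (\sum_(0 <= i < n + N | (i < N)%N) M i)).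
  by rewrite [leRHS](@big_cat_nat _ _ _ n)//= ?leq_addr// lerDl sumr_ge0.
rewrite (@big_cat_nat _ _ _ N)//= ?leq_addl// [X in _ + X]big_nat_cond [X in _ + X]big1 ?addr0; last first.
  by move=> i /andP[/andP[iN _]]; rewrite ltnNge iN.
by rewrite big_mkcond big_nat [leRHS]big_nat; apply: ler_sum => i /andP[_ ->].
Qed.

Lemma series_abs_cvg (F M : nat -> R) : (forall n, `|F n| <= M n) -> cvgn (series M) -> cvgn (series F).
Proof.
move=> FM cM; apply: normed_cvg; apply: (series_le_cvg _ _ FM cM) => n //.
exact: le_trans (FM n).
Qed.

(** Summable bounds on the second derivatives give the sum a quadratic Taylor remainder, so
    [isd_quad] applies to it. *)
Lemma isd_series (F0 F1 F2 : nat -> R -> R) (M0 M1 M2 : nat -> R) :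
  (forall n x, isd (F0 n) x (F1 n x)) -> (forall n x, isd (F1 n) x (F2 n x)) ->
  (forall n x, `|F0 n x| <= M0 n) -> (forall n x, `|F1 n x| <= M1 n) -> (forall n x, `|F2 n x| <= M2 n) ->
  cvgn (series M0) -> cvgn (series M1) -> cvgn (series M2) ->
  forall x, isd (fun x => limn (series (F0 ^~ x))) x (limn (series (F1 ^~ x))).
Proof.
move=> d0 d1 b0 b1 b2 c0 c1 c2 x.
have c0' y : cvgn (series (F0 ^~ y)) := series_abs_cvg (b0 ^~ y) c0.
have c1' y : cvgn (series (F1 ^~ y)) := series_abs_cvg (b1 ^~ y) c1.
apply: (@isd_quad _ _ _ (limn (series M2))) => h _.
have lip n y z : `|F1 n y - F1 n z| <= M2 n * `|y - z|.
  have [yz|yz|->] := ltgtP y z; last by rewrite !subrr normr0 mulr0.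
    have [|t _ E] := mvt_in yz (fun x _ => d1 n x); first exact: is_derive_cont (d1 n).
    by rewrite distrC E normrM (distrC y z) ler_wpM2r.
  have [|t _ E] := mvt_in yz (fun x _ => d1 n x); first exact: is_derive_cont (d1 n).
  by rewrite E normrM ler_wpM2r.
have tay n : `|F0 n (h + x) - F0 n x - h * F1 n x| <= M2 n * h ^+ 2.
  have M20 : 0 <= M2 n by exact: le_trans (b2 n 0).
  have [h0|h0|->] := ltgtP h 0; last by rewrite add0r subrr mul0r subrr normr0 mulr_ge0// sqr_ge0.
    have lt1 : h + x < x by lra.
    have [|t /andP[t1 t2] E] := mvt_in lt1 (fun x _ => d0 n x); first exact: is_derive_cont (d0 n).
    rewrite -(opprB (F0 n x)) E (_ : _ - _ = h * (F1 n t - F1 n x)); last by ring.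
    rewrite normrM -(real_normK (num_real h)) expr2 mulrCA ler_wpM2l//.
    apply: (le_trans (lip _ _ _)); rewrite ler_wpM2l// !ltr0_norm//; lra.
  have lt1 : x < h + x by lra.
  have [|t /andP[t1 t2] E] := mvt_in lt1 (fun x _ => d0 n x); first exact: is_derive_cont (d0 n).
  rewrite E (_ : _ - _ = h * (F1 n t - F1 n x)); last by ring.
  rewrite normrM -(real_normK (num_real h)) expr2 mulrCA ler_wpM2l//.
  apply: (le_trans (lip _ _ _)); rewrite ler_wpM2l// !gtr0_norm//; lra.
have cv : (fun N => series (F0 ^~ (h + x)) N - series (F0 ^~ x) N - h * series (F1 ^~ x) N) @ \oo -->
    limn (series (F0 ^~ (h + x))) - limn (series (F0 ^~ x)) - h * limn (series (F1 ^~ x)).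
  by apply: cvgB; [apply: cvgB|apply: cvgMr].
have cvn := cvg_norm cv.
apply: (cvgn_le (cvn _)) => N.
have -> : series (F0 ^~ (h + x)) N - series (F0 ^~ x) N - h * series (F1 ^~ x) N =
    \sum_(0 <= n < N) (F0 n (h + x) - F0 n x - h * F1 n x).
  by rewrite /series/= mulr_sumr !sumrB.
apply: (le_trans (ler_norm_sum _ _ _)).
apply: (@le_trans _ _ (\sum_(0 <= n < N) M2 n * h ^+ 2)); first exact: ler_sum.
rewrite -mulr_suml ler_wpM2r ?sqr_ge0//.
apply: (@nondecreasing_cvgn_le _ (series M2)) => //.
apply/nondecreasing_seqP => n; rewrite /series/= big_nat_recr//= lerDl; exact: le_trans (b2 n 0).
Qed.

(* Borel's construction: the n-th Taylor term is cut off at scale 1 / l n, with l n large enough to make its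
   derivatives of order < n at most 2^-n. *)
Lemma borel (a : nat -> R) : exists f : nat -> R -> R,
  (forall k x, isd (f k) x (f k.+1 x)) /\ forall k, f k 0 = a k.
Proof.
have [chi [ckc chi1 chi2]] := bump_ex.
pose D n k := derive1n k (fun s => s ^+ n * chi s).
have dD n k x : isd (D n k) x (D n k.+1 x).
  by apply: ck_smooth => j; apply: ckM => //; exact: ckX (ck_id j).
have Dout n k x : 2 < `|x| -> D n k x = 0.
  elim: k x => [x x2|k ih]; first by rewrite /D derive1n0 chi2 ?mulr0// ltW.
  exact: isd_zero_out (dD n k) ih.
(* Near 0 the cutoff is 1, so these are derivatives of the monomial. *)
have D0 n k : D n k 0 = (n == k)%:R * n`!%:R.
  rewrite (derive1n_monomial (n := n) (dD n)) ?normr0//; last first.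
    move=> x; rewrite ltr_norml => /andP[x1 x2].
    by rewrite /D derive1n0 chi1 ?mulr1// !ltW.
  have [->|nk] := eqVneq n k; first by rewrite subnn expr0 ffactnn mulr1 mul1r.
  rewrite mul0r; have [nk1|nk1] := ltnP n k; first by rewrite ffact_small// mul0r.
  by rewrite expr0n subn_eq0 leqNgt ltn_neqAle eq_sym nk nk1 mulr0.
have [B DB] : {B : nat -> nat -> R | forall n k x, `|D n k x| <= B n k}.
  apply/cid.
  have H (p : nat * nat) : {C : R | forall x, `|D p.1 p.2 x| <= C}.
    apply/cid; have [C C0 H] := @cont_bounded R (-2) 2 (D p.1 p.2) (is_derive_cont (dD p.1 p.2)).
    exists C => x; have [x2|x2] := leP `|x| 2; last by rewrite Dout// normr0 ltW.
    by apply: H; rewrite -ler_norml.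
  by exists (fun n k => sval (H (n, k))) => n k x; exact: (svalP (H (n, k)) x).
have B0 n k : 0 <= B n k by exact: le_trans (DB n k 0).
pose A n : R := `|a n| / n`!%:R.
have A0 n : 0 <= A n by rewrite divr_ge0.
(* Chosen so that 2^n A_n B_nk <= l_n for all k < n; as l_n >= 1, the factor l_n^(k - n) is at most
   1 / l_n, whence M k n <= 2^-n. *)
pose l n : R := 1 + 2 ^+ n * A n * \sum_(0 <= k < n) B n k.
have l1 n : 1 <= l n by rewrite lerDl mulr_ge0// ?sumr_ge0// mulr_ge0// exprn_ge0.
have l0 n : 0 < l n by exact: lt_le_trans (l1 n).
pose F k n x := a n / n`!%:R * l n ^+ k / l n ^+ n * D n k (l n * x).
pose M k n := A n * l n ^+ k / l n ^+ n * B n k.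
have fn0 n : (n`!%:R : R) != 0 by rewrite pnatr_eq0 -lt0n fact_gt0.
have dF k n x : isd (F k n) x (F k.+1 n x).
  have h : isd (fun x => l n * x) x (l n) by apply: isd_eq; [der|rewrite /=; ring].
  apply: isd_eq; first exact: isdM (isd_cst _ _) (isd_comp (dD _ _ _) h).
  by rewrite /F mul0r add0r exprS; field; rewrite fn0 expf_neq0// gt_eqF.
have FM k n x : `|F k n x| <= M k n.
  rewrite /F normrM !normrM !normfV ler_pM ?mulr_ge0 ?invr_ge0//.
  by rewrite !normrX (ger0_norm (ltW (l0 n))) (ger0_norm (ler0n _ _)).
have M0 k n : 0 <= M k n by exact: le_trans (FM k n 0).
have cM k : cvgn (series (M k)).
  apply: (@cvg_geo_dominated _ k.+1) => // n kn.
  have Bk : B n k <= \sum_(0 <= k < n) B n k.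
    by rewrite (bigD1_seq k)/= ?mem_index_iota ?iota_uniq// lerDl sumr_ge0.
  have ln : l n ^+ k / l n ^+ n <= (l n)^-1.
    rewrite ler_pdivrMr ?exprn_gt0// ler_pdivlMl// -exprS.
    exact: ler_weXn2l.
  have AB : 2 ^+ n * (A n * B n k) <= l n.
    rewrite /l mulrA (le_trans (ler_wpM2l _ Bk)) ?mulr_ge0 ?exprn_ge0//.
    by rewrite lerDr.
  have -> : M k n = A n * B n k * (l n ^+ k / l n ^+ n) by rewrite /M; ring.
  apply: (le_trans (ler_wpM2l _ ln)); first by rewrite mulr_ge0.
  by rewrite exprVn ler_pdivrMr// ler_pdivlMl ?exprn_gt0.
exists (fun k x => limn (series (fun n => F k n x))); split.
  move=> k x; exact: isd_series (dF k) (dF k.+1) (FM k) (FM k.+1) (FM k.+2) (cM _) (cM _) (cM _) x.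
move=> k.
have E n : F k n 0 = if n == k then a k else 0.
  rewrite /F mulr0 D0; case: eqVneq => [->|_]; last by rewrite mul0r mulr0.
  by rewrite mul1r; field; rewrite fn0 expf_neq0// gt_eqF.
apply: cvg_lim => //; apply: (cvg_near_cst (a k)).
exists k.+1 => // N /= kN.
rewrite /series/= (eq_bigr (fun n => if n == k then a k else 0))//.
by rewrite (bigD1_seq k)/= ?mem_index_iota ?iota_uniq// eqxx big1 ?addr0// => i /negPf ->.
Qed.

(** Borel's lemma supplies smooth functions with the prescribed derivatives at a and at b, and
    [isd_glue] joins all orders there. *)
Lemma smooth_extension a b (w : nat -> R -> R) : a < b -> (forall n, cont a b (w n)) ->
  (forall n x, a < x < b -> isd (w n) x (w n.+1 x)) ->
  exists W : nat -> R -> R, (forall n x, isd (W n) x (W n.+1 x)) /\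
    forall n x, a <= x <= b -> W n x = w n x.
Proof.
move=> ab cw dw.
have [L [dL L0]] := borel (w ^~ a); have [F [dF F0]] := borel (w ^~ b).
have dLa n x : isd (fun x => L n (x - a)) x (L n.+1 (x - a)).
  have h : isd (fun x => x - a) x 1 by apply: isd_eq; [der|rewrite /=; ring].
  by apply: isd_eq; [exact: isd_comp (dL n _) h|rewrite mulr1].
have dFb n x : isd (fun x => F n (x - b)) x (F n.+1 (x - b)).
  have h : isd (fun x => x - b) x 1 by apply: isd_eq; [der|rewrite /=; ring].
  by apply: isd_eq; [exact: isd_comp (dF n _) h|rewrite mulr1].
pose W n x := if x < a then L n (x - a) else if x <= b then w n x else F n (x - b).
have WL n x : x <= a -> W n x = L n (x - a).
  rewrite /W le_eqVlt => /predU1P[->|->//]; by rewrite ltxx ltW// subrr L0.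
have Ww n x : a <= x <= b -> W n x = w n x by move=> /andP[ax xb]; rewrite /W ltNge ax xb.
have WF n x : b <= x -> W n x = F n (x - b).
  move=> bx; have ax : (x < a) = false by apply/negbTE; rewrite -leNgt; lra.
  rewrite /W ax; move: bx; rewrite le_eqVlt => /predU1P[<-|bx]; first by rewrite lexx subrr F0.
  by rewrite leNgt bx.
exists W; split=> // n x.
have dl y : y < a -> isd (W n) y (W n.+1 y).
  move=> ya; rewrite (WL n.+1) ?ltW//; apply: isd_near (dLa n y).
  by have := lt_nbhsl ya; apply: filterS => z za; rewrite WL// ltW.
have dm y : a < y < b -> isd (W n) y (W n.+1 y).
  move=> yab; rewrite (Ww n.+1); last by lra.
  apply: isd_near (dw n y yab).
  by apply: filterS (near_oo yab) => z zab; rewrite Ww//; lra.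
have dr y : b < y -> isd (W n) y (W n.+1 y).
  move=> yb; rewrite (WF n.+1) ?ltW//; apply: isd_near (dFb n y).
  by have := lt_nbhsr yb; apply: filterS => z zb; rewrite WF// ltW.
have cL k c : cont c a (W k).
  by apply: cont_eq (is_derive_cont (dLa k)) => y /andP[_ ya]; rewrite WL.
have cm k : cont a b (W k) by apply: cont_eq (cw k) => y yab; rewrite Ww.
have cF k c : cont b c (W k).
  by apply: cont_eq (is_derive_cont (dFb k)) => y /andP[yb _]; rewrite WF.
have [xa|xa|xa] := ltgtP x a; first exact: dl; last first.
  rewrite xa; apply: (@isd_glue (a - 1) a b) => //; first by rewrite gtrBl ltr01.
  move=> y /andP[_ yb] ya; have [ya'|ya'|ya'] := ltgtP y a; [exact: dl|by apply: dm; rewrite ya'|].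
  by rewrite ya' eqxx in ya.
have [xb|xb|->] := ltgtP x b; [by apply: dm; rewrite xa|exact: dr|].
apply: (@isd_glue a b (b + 1)) => //; first by rewrite ab ltrDl ltr01.
move=> y /andP[ay _] yb; have [yb'|yb'|yb'] := ltgtP y b; [by apply: dm; rewrite ay|exact: dr|].
by rewrite yb' eqxx in yb.
Qed.

(** Syntax for polynomials in the unknowns of a polynomial system. Differentiation along a solution
    is the symbolic operation [pder], so every derivative is again polynomial and therefore
    continuous up to the ends. *)
Inductive pexp := PVar of nat | PCst of R | PAdd of pexp & pexp | PMul of pexp & pexp.

Fixpoint pval (g : nat -> R -> R) p x : R :=
  match p with
  | PVar i => g i x
  | PCst c => c
  | PAdd p q => pval g p x + pval g q x
  | PMul p q => pval g p x * pval g q x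
  end.

Fixpoint pder (d : nat -> pexp) p : pexp :=
  match p with
  | PVar i => d i
  | PCst _ => PCst 0
  | PAdd p q => PAdd (pder d p) (pder d q)
  | PMul p q => PAdd (PMul (pder d p) q) (PMul p (pder d q))
  end.

Lemma polynomial_system_smooth a b (g : nat -> R -> R) (d : nat -> pexp) (p : pexp) : a < b ->
  (forall i, cont a b (g i)) -> (forall i x, a < x < b -> isd (g i) x (pval g (d i) x)) ->
  exists W : nat -> R -> R, (forall n x, isd (W n) x (W n.+1 x)) /\
    forall n x, a <= x <= b -> W n x = pval g (iter n (pder d) p) x.
Proof.
move=> ab cg dg; apply: smooth_extension => //.
  move=> n; elim: (iter n _ p) => [i|c|q1 h1 q2 h2|q1 h1 q2 h2] /=; first exact: cg.
  - exact: cont_cst.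
  - exact: contD.
  - exact: contM.
move=> n x xab; rewrite iterS; elim: (iter n _ p) => [i|c|q1 h1 q2 h2|q1 h1 q2 h2] /=; first exact: dg.
- exact: isd_cst.
- exact: isdD.
- exact: isdM.
Qed.

End SmoothFunctions.

(** * Solutions of the Euler-Lagrange system *)

Section EulerLagrangeSolutions.
Context {R : realType}.
Implicit Types (a b x y e K : R) (f g h : R -> R).

Lemma cont_closure_eq a b f g : a < b -> cont a b f -> cont a b g ->
  (forall x, a < x < b -> f x = g x) -> forall x, a <= x <= b -> f x = g x.
Proof.
move=> ab cf cg fg x xab; apply/eqP; rewrite -subr_eq0; apply/negPn/negP => nz.
have e0 : 0 < `|f x - g x| by rewrite normr_gt0.
have [d d0 H] := cont_ed (contB cf cg) xab e0.
pose t := Num.min 2^-1 (d / (2 * (b - a))).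
have ba : 0 < b - a by rewrite subr_gt0.
have t0 : 0 < t by rewrite lt_min invr_gt0 ltr0n divr_gt0// mulr_gt0.
have t1 : t <= 2^-1 by rewrite ge_min lexx.
have t2 : t * (b - a) < d.
  have : t <= d / (2 * (b - a)) by rewrite ge_min lexx orbT.
  rewrite ler_pdivlMr ?mulr_gt0//; nra.
(* A point close to x, moved towards the midpoint so as to be interior. *)
pose y := x + t * ((a + b) / 2 - x).
have yab : a < y < b by rewrite /y; apply/andP; split; nra.
have yab' : a <= y <= b by lra.
have yx : `|y - x| < d.
  rewrite /y addrAC subrr add0r normrM gtr0_norm//; apply: le_lt_trans t2.
  by rewrite ler_wpM2l ?(ltW t0)// ler_norml; apply/andP; split; lra.
by have := H y yab' yx; rewrite fg// subrr sub0r normrN ltxx.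
Qed.

(** u'' recovered from its momentum D. *)
Definition ELq u p D x : R := D x * sl (p x) ^+ 5 / (2 * u x).

(** Stated on a general interval so that it covers both the half solution on [0, 1] and its
    reflection on [-1, 1]. *)
Record ELsol eps a b (u p D E : R -> R) : Prop := ELSol {
  el_ab : a < b;
  el_u : cont a b u; el_p : cont a b p; el_D : cont a b D; el_E : cont a b E;
  el_gt0 : forall x, a <= x <= b -> 0 < u x;
  el_du : forall x, a < x < b -> isd u x (p x);
  el_dp : forall x, a < x < b -> isd p x (ELq u p D x);
  el_dD : forall x, a < x < b -> isd D x (lagP eps (u x) (p x) (ELq u p D x) - E x);
  el_dE : forall x, a < x < b -> isd E x (lagY eps (u x) (p x) (ELq u p D x)) }.

Section Solution.
Context eps a b (u p D E : R -> R) (S : ELsol eps a b u p D E).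
Let q := ELq u p D.
Let s x := sl (p x).

(** The Legendre transform E p + D q - lag, with D q = 2 u q^2 / s^5. *)
Definition hamilton x : R :=
  E x * p x + u x * q x ^+ 2 / s x ^+ 5 - 1 / (u x * s x) - 4 * eps * (u x * s x).

Let cs : cont a b s. Proof. exact: cont_sl (el_p S). Qed.
Let un0 x : a <= x <= b -> u x != 0. Proof. by move=> /(el_gt0 S)/gt_eqF ->. Qed.
Let sn0 x : s x != 0. Proof. exact: sl_neq0. Qed.
Let ssq x : s x ^+ 2 = 1 + p x ^+ 2. Proof. exact: sl_sqr. Qed.

Lemma el_q : cont a b q.
Proof.
have cu := el_u S; have cp := el_p S; have cD := el_D S; rewrite /q /ELq; ct => x xab.
by rewrite mulf_neq0// un0.
Qed.

Let dq x : a < x < b -> isd q x ((lagP eps (u x) (p x) (q x) - E x) * s x ^+ 5 / (2 * u x)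
  + 5 * q x ^+ 2 * p x / s x ^+ 2 - q x * p x / u x).
Proof.
move=> xab; have xab' : a <= x <= b by lra.
have du := el_du S xab; have dp := el_dp S xab; have dD := el_dD S xab.
have ds := isd_sl dp; have h := un0 xab'; have h2 := sn0 x.
apply: isd_eq; first by rewrite /q /ELq; der; rewrite mulf_neq0.
rewrite /= -/(s x) -/(q x) /q /ELq -/(s x); field; by rewrite h h2.
Qed.

(** Conserved because the Lagrangian does not depend on x. *)
Lemma hamilton_cst x y : a <= x <= b -> a <= y <= b -> hamilton x = hamilton y.
Proof.
have cq := el_q; have cu := el_u S; have cp := el_p S; have cE := el_E S.
suff H z : a <= z <= b -> hamilton z = hamilton a by move=> hx hy; rewrite !H.
move=> zab; apply/esym; apply: (@derive_0_eq _ a z hamilton (fun=> 0)) => //; first by lra.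
  move=> t tz; have tab : a < t < b by lra.
  have tab' : a <= t <= b by lra.
  have du := el_du S tab; have dp := el_dp S tab; have dE := el_dE S tab.
  have ds := isd_sl dp; have dq' := dq tab; have h := un0 tab'; have h2 := sn0 t.
  apply: isd_eq; first by rewrite /hamilton; der; rewrite ?mulf_neq0 ?expf_neq0.
  rewrite /lagP /lagY -/(s t) -/(q t) /=.
  field: (ssq t).
  by rewrite h h2.
apply: (@cont_sub _ a b) => //; first by lra.
by rewrite /hamilton; ct => t tab; rewrite ?mulf_neq0 ?expf_neq0 ?un0.
Qed.

Definition elH x : R := 2^-1 * (1 / (u x * s x) - q x / s x ^+ 3).

(** The Hamiltonian absorbs the terms in q. Since it is a constant K, u H' / s = (E + p K) / (4 s)
    has a derivative that the system gives directly. *)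
Lemma isd_elH x : a < x < b -> isd elH x ((E x + p x * hamilton x) / (4 * u x)).
Proof.
move=> xab; have xab' : a <= x <= b by lra.
have du := el_du S xab; have dp := el_dp S xab; have dq' := dq xab.
have ds := isd_sl dp; have h := un0 xab'; have h2 := sn0 x.
apply: isd_eq; first by rewrite /elH; der; rewrite ?mulf_neq0 ?expf_neq0.
rewrite /hamilton /lagP -/(s x) -/(q x) /=.
field: (ssq x).
by rewrite h h2.
Qed.

(** The Euler-Lagrange equation in terms of H: the function differentiated is u H' / s. *)
Lemma el_flux x : a < x < b ->
  isd (fun y => (E y + p y * hamilton a) / (4 * s y)) x
    (- (u x * s x * (2^-1 * elH x * (q x / s x ^+ 3 + 1 / (u x * s x)) ^+ 2 - 2 * eps * elH x))).
Proof.
move=> xab; have xab' : a <= x <= b by lra.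
have aab : a <= a <= b by have := el_ab S; lra.
have dp := el_dp S xab; have dE := el_dE S xab.
have ds := isd_sl dp; have h := un0 xab'; have h2 := sn0 x.
apply: isd_eq; first by der; rewrite ?mulf_neq0 ?expf_neq0.
rewrite (hamilton_cst aab xab') /elH /hamilton /lagY -/(s x) -/(q x) /=.
field: (ssq x).
by rewrite h h2.
Qed.

Lemma el_first_integral x : a <= x <= b ->
  u x * p x * ((E x + p x * hamilton x) / (4 * u x)) / (1 + p x ^+ 2) + u x * elH x ^+ 2 / s x
    - elH x / (1 + p x ^+ 2) - eps * u x / s x = hamilton x / 4.
Proof.
move=> xab; have h := un0 xab; have h2 := sn0 x.
rewrite -ssq /elH /hamilton.
field: (ssq x).
by rewrite h h2.
Qed.

End Solution.

(** The identity f x = f (min x c) + f (max x c) - f c writes f through continuous clamps into the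
    two intervals. *)
Lemma cont_glue a b c f : a <= c <= b -> cont a c f -> cont c b f -> cont a b f.
Proof.
move=> /andP[ac cb] f1 f2; rewrite (_ : f = fun x => f (Num.min x c) + (f (Num.max x c) - f c)); last first.
  apply/funext => x; have [xc|xc] := leP x c; first by rewrite subrr addr0.
  by rewrite addrC subrK.
apply: contD.
  apply: (@cont_comp_cont _ a b a c f (fun x => Num.min x c)) => //; first by apply: cont_min; [exact: cont_id|exact: cont_cst].
  by move=>  x /andP[xa xb];
    rewrite le_min ge_min xa ac lexx orbT.
apply: contB; last exact: cont_cst.
apply: (@cont_comp_cont _ a b c b f (fun x => Num.max x c)) => //; first by apply: cont_max; [exact: cont_id|exact: cont_cst].
by move=>  x /andP[xa xb];
  rewrite le_max ge_max xb cb lexx orbT.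
Qed.

Definition evenx f x : R := f `|x|.
(** At 0 the value is f 0, so the extension is odd only when f 0 = 0. *)
Definition oddx f x : R := if x < 0 then - f (- x) else f x.

Lemma cont_evenx f : cont 0 1 f -> cont (-1) 1 (evenx f).
Proof.
move=> cf; rewrite /evenx (_ : (fun x => _) = fun x => f (Num.max x (- x))); last first.
  by apply/funext => x; congr f; have [x0|x0] := lerP 0 x; [rewrite ger0_norm// max_l|rewrite ltr0_norm// max_r]; lra.
apply: (@cont_comp_cont _ (-1) 1 0 1 f (fun x => Num.max x (- x))) => //.
  by apply: cont_max; [exact: cont_id|apply: contN; exact: cont_id].
move=> x /andP[x1 x2].
rewrite le_max ge_max; lra.
Qed.

Lemma cont_oddx f : f 0 = 0 -> cont 0 1 f -> cont (-1) 1 (oddx f).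
Proof.
move=> f0 cf; apply: (@cont_glue _ _ 0); first by lra.
  apply: (@cont_eq _ _ _ (fun x => - f (- x))) => [x /andP[_ x0]|].
    rewrite /oddx; case: ltP => // h; have -> : x = 0 by lra.
    by rewrite oppr0 f0 oppr0.
  apply: contN; apply: (@cont_comp_cont _ (-1) 0 0 1 f (fun x => - x)) => //; last by move=> x; lra.
  by apply: contN; exact: cont_id.
by apply: cont_eq cf => x /andP[x0 _]; rewrite /oddx ltNge x0.
Qed.

Lemma isd_opp f x (df : R) : isd f (- x) df -> isd (fun y => f (- y)) x (- df).
Proof.
move=> h; have hN : isd (fun y => - y) x (-1) by apply: isdN; exact: isd_id.
by apply: isd_eq; [exact: isd_comp h hN|rewrite mulrN1].
Qed.

Lemma isd_evenx f g : cont 0 1 f -> cont 0 1 g -> g 0 = 0 -> (forall x, 0 < x < 1 -> isd f x (g x)) ->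
  forall x, -1 < x < 1 -> isd (evenx f) x (oddx g x).
Proof.
move=> cf cg g0 d.
have H x : -1 < x < 1 -> x != 0 -> isd (evenx f) x (oddx g x).
  move=> x1 x0; have [xn|xp|E] := ltgtP x 0; last by rewrite E eqxx in x0.
    rewrite /oddx xn; apply: (@isd_near _ (fun y => f (- y))).
      by have := lt_nbhsl xn; apply: filterS => y y0; rewrite /evenx ltr0_norm.
    by apply: isd_opp; apply: d; lra.
  rewrite /oddx ltNge (ltW xp)/=; apply: (@isd_near _ f).
    by have := lt_nbhsr xp; apply: filterS => y y0; rewrite /evenx gtr0_norm.
  by apply: d; lra.
have ce := cont_evenx cf; have co := cont_oddx g0 cg.
move=> x x1; have [->|x0] := eqVneq x 0; last exact: H.
apply: (@isd_glue _ (-1) 0 1) => //; rewrite ?ltr01 ?oppr_lt0 ?ltr01//.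
- by apply: cont_sub ce.
- by apply: cont_sub ce; rewrite ?oppr_le0.
- by apply: cont_sub co.
- by apply: cont_sub co; rewrite ?oppr_le0.
Qed.

Lemma isd_oddx f g : cont 0 1 f -> cont 0 1 g -> f 0 = 0 -> (forall x, 0 < x < 1 -> isd f x (g x)) ->
  forall x, -1 < x < 1 -> isd (oddx f) x (evenx g x).
Proof.
move=> cf cg f0 d.
have H x : -1 < x < 1 -> x != 0 -> isd (oddx f) x (evenx g x).
  move=> x1 x0; have [xn|xp|E] := ltgtP x 0; last by rewrite E eqxx in x0.
    rewrite /evenx ltr0_norm//; apply: (@isd_near _ (fun y => - f (- y))).
      by have := lt_nbhsl xn; apply: filterS => y y0; rewrite /oddx y0.
    have h : isd (fun y => f (- y)) x (- g (- x)) by apply: isd_opp; apply: d; lra.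
    by apply: isd_eq (isdN h) _; rewrite opprK.
  rewrite /evenx gtr0_norm//; apply: (@isd_near _ f).
    by have := lt_nbhsr xp; apply: filterS => y y0; rewrite /oddx ltNge (ltW y0).
  by apply: d; lra.
have ce := cont_evenx cg; have co := cont_oddx f0 cf.
move=> x x1; have [->|x0] := eqVneq x 0; last exact: H.
apply: (@isd_glue _ (-1) 0 1) => //; rewrite ?ltr01 ?oppr_lt0 ?ltr01//.
- by apply: cont_sub co.
- by apply: cont_sub co; rewrite ?oppr_le0.
- by apply: cont_sub ce.
- by apply: cont_sub ce; rewrite ?oppr_le0.
Qed.

(** The system is invariant under x -> -x with u and D even, p and E odd; p 0 = 0 and E 0 = 0 make
    the odd extensions continuous. *)
Lemma ELsol_reflect eps u p D E : ELsol eps 0 1 u p D E -> p 0 = 0 -> E 0 = 0 ->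
  ELsol eps (-1) 1 (evenx u) (oddx p) (evenx D) (oddx E).
Proof.
move=> S p0 E0; have cu := el_u S; have cp := el_p S; have cD := el_D S; have cE := el_E S.
have cq := el_q S; have cs := cont_sl cp.
have un0 x : 0 <= x <= 1 -> u x != 0 by move=> /(el_gt0 S)/gt_eqF ->.
have sn0 x : sl (p x) != 0 by exact: sl_neq0.
have qE x : ELq (evenx u) (oddx p) (evenx D) x = evenx (ELq u p D) x.
  rewrite /ELq /evenx /oddx; case: ltrP => x0; last by rewrite ger0_norm.
  by rewrite ltr0_norm// slN.
have cP : cont 0 1 (fun x => lagP eps (u x) (p x) (ELq u p D x) - E x).
  by rewrite /lagP; ct => x x01; rewrite ?expf_neq0 ?mulf_neq0 ?un0.
have cY : cont 0 1 (fun x => lagY eps (u x) (p x) (ELq u p D x)).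
  by rewrite /lagY; ct => x x01; rewrite ?expf_neq0 ?mulf_neq0 ?un0.
split => //.
- exact: cont_evenx.
- exact: cont_oddx.
- exact: cont_evenx.
- exact: cont_oddx.
- by move=> x x1; apply: (el_gt0 S); rewrite normr_ge0 ler_norml.
- by apply: isd_evenx => //; exact: el_du S.
- by move=> x x1; rewrite qE; apply: isd_oddx x1 => //; exact: el_dp S.
- move=> x x1; apply: isd_eq; first apply: (isd_evenx cD cP _ (el_dD S) x1).
    by rewrite /lagP p0 E0; ring.
  rewrite qE /oddx /evenx; case: ltrP => x0; last by rewrite ger0_norm.
  by rewrite ltr0_norm// /lagP slN; ring.
- move=> x x1; apply: isd_eq; first exact: (isd_oddx cE cY _ (el_dE S) x1).
  rewrite qE /oddx /evenx; case: ltrP => x0; last by rewrite ger0_norm.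
  by rewrite ltr0_norm// /lagY slN.
Qed.

Lemma ELsol_smooth eps a b u p D E : ELsol eps a b u p D E ->
  exists W : nat -> R -> R, (forall n x, isd (W n) x (W n.+1 x)) /\
    forall x, a <= x <= b -> W 0%N x = u x.
Proof.
move=> S; have ab := el_ab S.
have un0 x : a <= x <= b -> u x != 0 by move=> /(el_gt0 S)/gt_eqF ->.
have sn0 x : sl (p x) != 0 by exact: sl_neq0.
(* The last two unknowns, 1 / u and 1 / s, make the right-hand sides polynomial. *)
pose g := nth (fun=> 0) [:: u; p; D; E; fun x => (u x)^-1; fun x => (sl (p x))^-1].
pose V := @PVar R; pose C := @PCst R; pose A := @PAdd R; pose M := @PMul R.
(* s itself is polynomial in the unknowns: s = (1 + p^2) / s. *)
pose Ps := M (A (C 1) (M (V 1%N) (V 1%N))) (V 5%N).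
pose Ps5 := M (M (M Ps Ps) (M Ps Ps)) Ps.
pose Pq := M (C 2^-1) (M (M (V 2%N) Ps5) (V 4%N)).
pose Pj := V 5%N. pose Pj2 := M Pj Pj.
pose Pk := A (C (4 * eps)) (M (C (-1)) (M (M (V 4%N) (V 4%N)) Pj2)).
pose Pj5 := M (M Pj2 Pj2) Pj.
pose PD := A (A (M Pk (M (M (V 0%N) (V 1%N)) Pj))
  (M (C (-5)) (M (M (V 0%N) (V 1%N)) (M (M Pj5 Pj2) (M Pq Pq))))) (M (C (-1)) (V 3%N)).
pose PE := A (M Pk Ps) (M (M Pq Pq) Pj5).
pose d := nth (C 0) [:: V 1%N; Pq; PD; PE; M (C (-1)) (M (M (V 4) (V 4)) (V 1%N));
  M (C (-1)) (M (M Pj2 Pj) (M (V 1%N) Pq))].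
have sE x : pval g Ps x = sl (p x).
  have -> : pval g Ps x = (1 + p x * p x) * (sl (p x))^-1 by [].
  by rewrite -expr2 -sl_sqr expr2 mulfK.
have qE x : a <= x <= b -> pval g Pq x = ELq u p D x.
  move=> xab; pose t := pval g Ps x.
  have -> : pval g Pq x = 2^-1 * (D x * (t * t * (t * t) * t) * (u x)^-1) by [].
  by rewrite /t sE /ELq; field; exact: un0.
have [||W [dW W0]] := polynomial_system_smooth (g := g) (d := d) (V 0%N) ab.
- case=> [|[|[|[|[|[|i]]]]]].
  + exact: el_u S.
  + exact: el_p S.
  + exact: el_D S.
  + exact: el_E S.
  + by apply: contV => //; exact: el_u S.
  + by apply: contV => //; exact: cont_sl (el_p S).
  + by rewrite /g /= nth_nil; exact: cont_cst.
- case=> [|[|[|[|[|[|i]]]]]]; last by move=> x _; rewrite /g /d /= !nth_nil; exact: isd_cst.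
  + exact: el_du S.
  + by move=> x xab; rewrite qE; [exact: (el_dp S xab)|lra].
  + move=> x xab; have xab' : a <= x <= b by lra.
    apply: isd_eq (el_dD S xab) _; rewrite -qE//.
    pose i := (u x)^-1; pose j := (sl (p x))^-1; pose Q := pval g Pq x.
    have -> : pval g (d 2%N) x = (4 * eps + -1 * (i * i * (j * j))) * (u x * p x * j) +
      -5 * (u x * p x * (j * j * (j * j) * j * (j * j) * (Q * Q))) + -1 * E x by [].
    by rewrite /lagP -/Q /i /j; field; rewrite ?un0 ?sn0.
  + move=> x xab; have xab' : a <= x <= b by lra.
    apply: isd_eq (el_dE S xab) _; rewrite -qE//.
    pose i := (u x)^-1; pose j := (sl (p x))^-1; pose Q := pval g Pq x.
    have -> : pval g (d 3%N) x = (4 * eps + -1 * (i * i * (j * j))) * pval g Ps x +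
      Q * Q * (j * j * (j * j) * j) by [].
    by rewrite sE /lagY -/Q /i /j; field; rewrite ?un0 ?sn0.
  + move=> x xab; have xab' : a <= x <= b by lra.
    apply: isd_eq (isdV (un0 _ xab') (el_du S xab)) _.
    have -> : pval g (d 4%N) x = -1 * ((u x)^-1 * (u x)^-1 * p x) by [].
    by field; exact: un0.
  + move=> x xab; have xab' : a <= x <= b by lra.
    apply: isd_eq (@isdV _ (fun y => sl (p y)) _ _ (sn0 x) (isd_sl (el_dp S xab))) _.
    rewrite -qE//; pose j := (sl (p x))^-1; pose Q := pval g Pq x.
    have -> : pval g (d 5%N) x = -1 * (j * j * j * (p x * Q)) by [].
    by rewrite -/Q /j; field.
exists W; split => // x xab; exact: W0.
Qed.

Lemma ELsol_equations eps a b u p D E : ELsol eps a b u p D E -> exists U : R -> R,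
  smooth U /\ (forall x, a <= x <= b -> U x = u x /\ derive1 U x = p x) /\
  let U1 := derive1 U in
  let U2 := derive1n 2 U in
  let Hf := fun x => Hexpr (U x) (U1 x) (U2 x) in
  let H1 := derive1 Hf in
  (forall x, a < x < b ->
     1 / (U x * Num.sqrt (1 + U1 x ^+ 2)) *
       derive1 (fun y => U y / Num.sqrt (1 + U1 y ^+ 2) * H1 y) x
     + 2^-1 * Hf x *
       (U2 x / (Num.sqrt (1 + U1 x ^+ 2)) ^+ 3
        + 1 / (U x * Num.sqrt (1 + U1 x ^+ 2))) ^+ 2
     - 2 * eps * Hf x = 0) /\
  exists c : R, forall x, a <= x <= b ->
     U x * U1 x * H1 x / (1 + U1 x ^+ 2)
     + U x * Hf x ^+ 2 / Num.sqrt (1 + U1 x ^+ 2)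
     - Hf x / (1 + U1 x ^+ 2)
     - eps * U x / Num.sqrt (1 + U1 x ^+ 2) = c.
Proof.
move=> S; have ab := el_ab S; have [W [dW W0]] := ELsol_smooth S.
have WE n : derive1n n (W 0%N) = W n := isd_derive1n dW n.
have cW n : cont a b (W n) := is_derive_cont (dW n).
have un0 x : a <= x <= b -> u x != 0 by move=> /(el_gt0 S)/gt_eqF ->.
have nearW f g x : a < x < b -> (forall y, a < y < b -> f y = g y) -> \near x, f x = g x :> R.
  by move=> xab fg; apply: filterS (near_oo xab) => y; exact: fg.
(* The system gives derivatives only in the open interval; at the ends the identities for the
   extension follow by continuity. *)
have W1 x : a <= x <= b -> W 1%N x = p x.
  apply: cont_closure_eq (cW _) (el_p S) _ x => // x xab.
  rewrite -(isd_derive1 (dW 0%N x)) -(isd_derive1 (el_du S xab)); apply/isd_derive1.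
  apply: isd_near (derivable_isd (isd_derivable (el_du S xab))).
  by apply: nearW xab _ => y yab; rewrite W0//; lra.
have W2 x : a <= x <= b -> W 2%N x = ELq u p D x.
  apply: cont_closure_eq (cW _) (el_q S) _ x => // x xab.
  rewrite -(isd_derive1 (dW 1%N x)) -(isd_derive1 (el_dp S xab)); apply/isd_derive1.
  apply: isd_near (derivable_isd (isd_derivable (el_dp S xab))).
  by apply: nearW xab _ => y yab; rewrite W1//; lra.
exists (W 0%N); split; first by move=> n x; rewrite WE; exact: isd_derivable (dW n x).
have W1E : derive1 (W 0%N) = W 1%N by rewrite -[RHS]WE derive1n1.
split; first by move=> x xab; rewrite W1E W0// W1.
rewrite W1E WE; cbv zeta.
pose Hf x := Hexpr (W 0%N x) (W 1%N x) (W 2%N x); rewrite -/Hf.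
(* The derivative of H for the extension, valid at the ends too, because the first integral is
   claimed on the closed interval. *)
pose h1 x := 2^-1 * (- (W 1%N x * sl (W 1%N x) + W 0%N x * (W 1%N x * W 2%N x / sl (W 1%N x))) / (W 0%N x * sl (W 1%N x)) ^+ 2
  - (W 3%N x / sl (W 1%N x) ^+ 3 - 3 * W 1%N x * W 2%N x ^+ 2 / sl (W 1%N x) ^+ 5)).
have dH x : a <= x <= b -> isd Hf x (h1 x).
  move=> xab; have d0 := dW 0%N x; have d1 := dW 1%N x; have d2 := dW 2%N x.
  have ds := isd_sl d1; have sz := sl_neq0 (W 1%N x).
  have nz : W 0%N x != 0 by rewrite W0// un0.
  have HfE : Hf = fun x => 2^-1 * (1 / (W 0%N x * sl (W 1%N x)) - W 2%N x / sl (W 1%N x) ^+ 3) := erefl.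
  rewrite HfE.
  apply: isd_eq; first by der; rewrite ?mulf_neq0 ?expf_neq0.
  by rewrite /h1 /=; field; rewrite ?nz ?sz.
have H1E x : a <= x <= b -> derive1 Hf x = h1 x by move=> /dH/isd_derive1.
have HE x : a <= x <= b -> Hf x = elH u p D x.
  by move=> xab; rewrite /Hf /Hexpr W0// W1// W2.
have cu := el_u S; have cp := el_p S; have cE := el_E S.
pose G x := (E x + p x * hamilton eps u p D E a) / (4 * u x).
have aab : a <= a <= b by lra.
have cG : cont a b G by rewrite /G; ct => x xab; rewrite mulf_neq0// un0.
have ch1 : cont a b h1.
  have c0 := cW 0%N; have c1 := cW 1%N; have c2 := cW 2%N; have c3 := cW 3%N.
  by rewrite /h1; ct => x xab; rewrite ?expf_neq0 ?mulf_neq0 ?sl_neq0// W0// un0.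
have H1G x : a <= x <= b -> derive1 Hf x = G x.
  move=> xab; rewrite H1E//; apply: cont_closure_eq ch1 cG _ x xab => // x xab.
  have xab' : a <= x <= b by lra.
  rewrite -H1E// /G (hamilton_cst S aab xab'); apply: isd_derive1.
  by apply: isd_near (isd_elH S xab); apply: nearW xab _ => y yab; rewrite HE//; lra.
split=> [x xab|].
  have xab' : a <= x <= b by lra.
  rewrite -/(sl _); under eq_fun do rewrite -/(sl _).
  have -> : derive1 (fun y => W 0%N y / sl (W 1%N y) * derive1 Hf y) x = 
      - (u x * sl (p x) * (2^-1 * elH u p D x * (ELq u p D x / sl (p x) ^+ 3 + 1 / (u x * sl (p x))) ^+ 2
      - 2 * eps * elH u p D x)).
    apply: isd_derive1; apply: isd_near (el_flux S xab); apply: nearW xab _ => y yab.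
    have yab' : a <= y <= b by lra.
    by rewrite H1G// W0// W1// /G; field; rewrite un0 ?sl_neq0.
  rewrite HE// W0// W1// W2//.
  field; by rewrite un0 ?sl_neq0.
exists (hamilton eps u p D E a / 4) => x xab.
rewrite H1G// HE// W0// W1// -/(sl _) /G (hamilton_cst S aab xab).
exact: (el_first_integral S xab).
Qed.

End EulerLagrangeSolutions.

(** * Symmetric profiles *)

Section Halves.
Context {R : realType}.
Notation mu := (@lebesgue_measure R).
Implicit Types (a b x y alpha eps : R) (f g v u : R -> R).

Lemma ge0_integral_opp a b (g : R -> \bar R) : measurable_fun `[a, b] g ->
  (forall x, a <= x <= b -> (0 <= g x)%E) ->
  (\int[mu]_(x in `[a, b]) g x = \int[mu]_(x in `[(- b)%R, (- a)%R]) g (- x)%R)%E.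
Proof.
move=> mg g0.
rewrite (_ : `[- b, - a]%classic = (-%R : _ -> measurableTypeR R) @^-1` `[a, b]); last first.
  by rewrite opp_preimage_itvbndbnd.
rewrite -ge0_integral_pushforward//=; last by move=> x; rewrite inE/= in_itv/=; exact: g0.
by apply: eq_measure_integral => //= A mA AS; exact/esym/lebesgue_measureN.
Qed.

Lemma meas_opp a b f : measurable_fun `[a, b] f -> measurable_fun `[- b, - a] (fun x => f (- x)).
Proof.
move=> mf; apply: (measurable_comp (F := `[a, b]%classic : set R)) mf _ => //.
  by move=> _ [x /= + <-]; rewrite !in_itv/= => /andP[? ?]; apply/andP; split; lra.
Qed.

Lemma rint_opp a b f : measurable_fun `[a, b] f -> rint a b f = rint (- b) (- a) (fun x => f (- x)).
Proof.
move=> mf; rewrite /rint /Rintegral; congr fine.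
have mF : measurable_fun `[a, b] (EFin \o f) by exact/measurable_EFinP.
rewrite integralE [RHS]integralE; congr (_ - _)%E.
  rewrite (ge0_integral_opp (measurable_funepos mF)); last by move=> x _; exact: funepos_ge0.
  by apply: eq_integral => x _; rewrite !funeposE.
rewrite (ge0_integral_opp (measurable_funeneg mF)); last by move=> x _; exact: funeneg_ge0.
by apply: eq_integral => x _; rewrite !funenegE.
Qed.

Lemma intg_opp a b f : intg a b f -> intg (- b) (- a) (fun x => f (- x)).
Proof.
move=> jf; have mf := intg_meas jf; apply/integrableP; split.
  by apply/measurable_EFinP; exact: meas_opp.
case/integrableP : jf => _; rewrite ge0_integral_opp//.
by apply: measurableT_comp => //; exact/measurable_EFinP.
Qed.

Lemma ac_opp a b f g : a <= b -> ac a b f g -> ac (- b) (- a) (fun x => f (- x)) (fun x => - g (- x)).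
Proof.
move=> ab H; have jg := ac_intg H; have jgo := intg_opp jg.
split; first exact: intgN.
move=> x /andP[x1 x2]; rewrite opprK rintN; last by apply: intg_sub jgo.
have -> : rint (- b) x (fun y => g (- y)) = rint (- x) b g.
  by rewrite (rint_opp (intg_meas (intg_sub _ _ jg)))// ?opprK//; lra.
rewrite -(ac_sub_rint H); lra.
Qed.

(** u'(0) = 0 follows from evenness of u alone: as u' is continuous, u is differentiable at 0. *)
Lemma inN_ac alpha v v1 v2 : inN alpha v v1 v2 -> [/\ ac (-1) 1 v1 v2, ac (-1) 1 v v1 & v1 0 = 0].
Proof.
move=> [[j2 [_ [j1 [h1 h0]]]] [ev _]].
have a1 : ac (-1) 1 v1 v2.
  split => // x x1; apply/eqP; rewrite addrC -subr_eq; apply/eqP.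
  have x1' := x1; have /andP[xl xr] := x1.
  by apply: EFin_inj; rewrite h1// -rintE//; apply: intg_sub j2.
have a0 : ac (-1) 1 v v1.
  split => // x x1; apply/eqP; rewrite addrC -subr_eq; apply/eqP.
  have /andP[xl xr] := x1.
  by apply: EFin_inj; rewrite h0// -rintE//; apply: intg_sub j1.
split => //.
have z1 : -1 < (0 : R) < 1 by lra.
have d0 : isd v 0 (v1 0) := ac_derive a0 z1 (cont_for (ac_cont a1) z1).
have d1 : isd v 0 (- v1 0).
  apply: (@isd_near _ (fun x => v (- x))).
    by apply: filterS (near_oo z1) => x x1; apply: ev; lra.
  by apply: isd_opp; rewrite oppr0.
have := isd_derive1 d0; rewrite (isd_derive1 d1) => E; lra.
Qed.

Lemma inN_right alpha v v1 v2 : inN alpha v v1 v2 -> profile alpha v v1 v2.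
Proof.
move=> H; have [a1 a0 z] := inN_ac H; have [[_ [jq _]] [_ [pos [_ [e1 [_ e4]]]]]] := H.
split => //.
- by apply: ac_sub a1 => //; lra.
- by apply: intg_sub jq => //; lra.
- by apply: ac_sub a0 => //; lra.
- by move=> x x1; apply: pos; lra.
Qed.

(** u'' is determined only almost everywhere and need not be even at every point, so the left half
    is treated as a profile of its own. *)
Lemma inN_left alpha v v1 v2 : inN alpha v v1 v2 ->
  profile alpha (fun x => v (- x)) (fun x => - v1 (- x)) (fun x => v2 (- x)).
Proof.
move=> H; have [a1 a0 z] := inN_ac H; have [[_ [jq _]] [_ [pos [e0 [_ [e3 _]]]]]] := H.
have n1 : -1 <= 0 :> R by lra.
have b1 : ac (-1) 0 v1 v2 by apply: ac_sub a1 => //; lra.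
have b0 : ac (-1) 0 v v1 by apply: ac_sub a0 => //; lra.
have c1 := ac_opp n1 b1; have c0 := ac_opp n1 b0; rewrite oppr0 opprK in c1 c0.
split => //=.
- apply: ac_eq (acZ (-1) c1) => //; first by move=> x _; rewrite mulN1r.
  by move=> x _; rewrite mulN1r opprK.
- have := intg_opp jq; rewrite opprK => j; apply: intg_sub j; lra.
- by move=> x x1; apply: pos; lra.
- by rewrite oppr0 z oppr0.
- by rewrite e3 oppr0.
Qed.

Lemma inN_intg alpha eps v v1 v2 : inN alpha v v1 v2 ->
  [/\ intg (-1) 1 (fun x => (1 / (v x * sl (v1 x)) - v2 x / sl (v1 x) ^+ 3) ^+ 2 * v x * sl (v1 x)),
      intg (-1) 1 (fun x => v x * sl (v1 x)) & intg (-1) 1 (fun x => dens eps (v x) (v1 x) (v2 x))].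
Proof.
move=> H; have [a1 a0 z] := inN_ac H; have [[j2 [jq _]] [_ [pos _]]] := H.
have cv := ac_cont a0; have cv1 := ac_cont a1.
have nz x : -1 <= x <= 1 -> v x != 0 by move=> /pos/gt_eqF ->.
have cvs : cont (-1) 1 (fun x => v x * sl (v1 x)) by ct.
have jW : intg (-1) 1 (fun x => (1 / (v x * sl (v1 x)) - v2 x / sl (v1 x) ^+ 3) ^+ 2 * v x * sl (v1 x)).
  apply: (@intg_eq _ _ _ (fun x => (v x * sl (v1 x))^-1 + ((-2 * (sl (v1 x) ^+ 3)^-1) * v2 x +
      (v x * (sl (v1 x) ^+ 5)^-1) * v2 x ^+ 2))).
    by move=> x x1; field; rewrite nz ?sl_neq0.
  apply: intgD; first by apply: cont_intg; ct => x x1; rewrite mulf_neq0 ?nz ?sl_neq0.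
  by apply: intgD; apply: intg_contM => //; ct => x x1; rewrite expf_neq0// sl_neq0.
have jA := cont_intg cvs.
split => //; apply: intgD => //; exact: intgZ.
Qed.

Lemma helfH_halves alpha eps v v1 v2 : inN alpha v v1 v2 -> helfH eps v v1 v2 =
  (pi / 2 * (energy eps v v1 v2 +
    energy eps (fun x => v (- x)) (fun x => - v1 (- x)) (fun x => v2 (- x))))%:E.
Proof.
move=> H; have [jW jA jd] := inN_intg eps H.
have -> : helfH eps v v1 v2 = (pi / 2 * rint (-1) 1 (fun x => dens eps (v x) (v1 x) (v2 x)))%:E.
  rewrite /helfH /willW /areaA /Icc.
  have := rintE jW; rewrite /sl => <-; have := rintE jA; rewrite /sl => <-.
  rewrite /dens -!EFinM -EFinD; congr EFin.
  rewrite rintD ?rintZ//; last exact: intgZ.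
  by rewrite /sl; field.
congr EFin; congr (_ * _).
rewrite (@rint_chasles _ _ 0)//; try by lra.
rewrite addrC; congr (_ + _).
rewrite rint_opp ?oppr0 ?opprK; last by apply: intg_meas; apply: intg_sub jd => //; lra.
by apply: rint_eq => x _; rewrite /dens !slN.
Qed.

Lemma inN_reflect alpha u p D E eps : ELsol eps 0 1 u p D E -> p 0 = 0 -> E 0 = 0 -> p 1 = 0 -> u 1 = alpha ->
  inN alpha (evenx u) (oddx p) (evenx (ELq u p D)).
Proof.
move=> S p0 E0 p1 u1; have T := ELsol_reflect S p0 E0.
have qE x : ELq (evenx u) (oddx p) (evenx D) x = evenx (ELq u p D) x.
  rewrite /ELq /evenx /oddx; case: ltrP => x0; last by rewrite ger0_norm.
  by rewrite ltr0_norm// slN.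
have cu := el_u T; have cp := el_p T; have cq := cont_evenx (el_q S).
have acp : ac (-1) 1 (oddx p) (evenx (ELq u p D)).
  by apply: C1_ac => // x x1; rewrite -qE; exact: (el_dp T).
have acu : ac (-1) 1 (evenx u) (oddx p) by apply: C1_ac => //; exact: el_du T.
have ee f x : evenx f (- x) = evenx f x by rewrite /evenx normrN.
split; first split; last split; last split.
- exact: cont_intg.
- split; first by apply: cont_intg; exact: contX.
  split; first exact: cont_intg.
  split=> x x1; have /andP[xl xr] := x1.
    rewrite -rintE; last by apply: intg_sub (ac_intg acp).
    by rewrite (ac_sub_rint acp).
  rewrite -rintE; last by apply: intg_sub (ac_intg acu).
  by rewrite (ac_sub_rint acu).
- by [].
- exact: el_gt0 T.
- by rewrite /evenx /oddx normrN normr1 ltr10 oppr_lt0 ltr01 opprK p1 oppr0.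
Qed.

Lemma helfH_reflect alpha u p D E eps : ELsol eps 0 1 u p D E -> p 0 = 0 -> E 0 = 0 -> p 1 = 0 -> u 1 = alpha ->
  helfH eps (evenx u) (oddx p) (evenx (ELq u p D)) = (pi * energy eps u p (ELq u p D))%:E.
Proof.
move=> S p0 E0 p1 u1; rewrite (helfH_halves eps (inN_reflect S p0 E0 p1 u1)); congr EFin.
have -> : energy eps (evenx u) (oddx p) (evenx (ELq u p D)) = energy eps u p (ELq u p D).
  by apply: rint_eq => x /andP[x0 _]; rewrite /evenx /oddx ltNge x0/= ger0_norm.
have -> : energy eps (fun x => evenx u (- x)) (fun x => - oddx p (- x)) (fun x => evenx (ELq u p D) (- x))
   = energy eps u p (ELq u p D).
  apply: rint_eq => x /andP[x0 _]; rewrite /evenx /oddx normrN ger0_norm// opprK oppr_lt0.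
  case: ltP => x0'; first by rewrite opprK.
  have -> : x = 0 by lra.
  by rewrite oppr0 p0 oppr0.
by field.
Qed.

End Halves.

(** * The minimiser *)

Section Minimiser.
Context {R : realType}.
Implicit Types (a b c x y alpha eps tm K L : R) (f g h u p D E : R -> R).

(** The function f exp(-L x) is nonincreasing. *)
Lemma gronwall_le0 a b f g L : a <= b -> cont a b f -> (forall x, a < x < b -> isd f x (g x)) ->
  (forall x, a < x < b -> g x <= L * f x) -> f a <= 0 -> f b <= 0.
Proof.
move=> ab cf df gf fa.
have d x : a < x < b -> isd (fun x => - (f x * expR (- (L * x)))) x ((L * f x - g x) * expR (- (L * x))).
  by move=> xab; have h := df x xab; apply: isd_eq; [der|rewrite /=; ring].
have cE : cont a b (fun x => - (f x * expR (- (L * x)))).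
  have dE x : isd (fun x => expR (- (L * x))) x (- (expR (- (L * x)) * L)).
    by apply: isd_eq; [der|rewrite /=; ring].
  by have := is_derive_cont dE; move=> cL; ct.
have := derive_ge0_le ab d _ cE; rewrite lerN2 => H.
have {}H : f b * expR (- (L * b)) <= f a * expR (- (L * a)).
  by apply: H => x xab; rewrite mulr_ge0 ?expR_ge0// subr_ge0 gf.
have Eb := expR_gt0 (- (L * b)); have Ea := expR_gt0 (- (L * a)).
have := le_trans H (mulr_le0_ge0 fa (ltW Ea)).
by rewrite pmulr_lle0.
Qed.

Lemma cont_rint_eq0 a b f : cont a b f -> (forall x, a <= x <= b -> 0 <= f x) -> rint a b f <= 0 ->
  forall x, a < x < b -> f x = 0.
Proof.
move=> cf f0 If x xab; have jf := cont_intg cf.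
rewrite -(isd_derive1 (rint_derive jf xab (cont_for cf xab))); apply: isd_derive1.
apply: (@isd_near _ (fun=> 0)); last exact: isd_cst.
apply: filterS (near_oo xab) => y /andP[ay yb].
have h1 : 0 <= rint a y f by apply: rint_ge0 => z zy; apply: f0; lra.
have h2 : 0 <= rint y b f by apply: rint_ge0 => z zy; apply: f0; lra.
have := @rint_chasles _ a y b f (ltW ay) (ltW yb) jf; lra.
Qed.

(* (H, u H' / s) solves a homogeneous linear system, by el_flux. *)
Lemma elH_unique eps a b u p D E y : ELsol eps a b u p D E -> a < y < b ->
  (\near y, elH u p D y = 0) -> forall x, y <= x <= b -> elH u p D x = 0.
Proof.
move=> S yab hy x xyb; have cu := el_u S; have cp := el_p S; have cE := el_E S; have cq := el_q S.
have cs := cont_sl cp; have sn0 z : sl (p z) != 0 by exact: sl_neq0.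
have un0 z : a <= z <= b -> u z != 0 by move=> /(el_gt0 S)/gt_eqF ->.
have aab : a <= a <= b by lra.
pose K := hamilton eps u p D E a.
pose h := elH u p D; pose k z := (E z + p z * K) / (4 * sl (p z)).
pose m z := - (u z * sl (p z) * (2^-1 * (ELq u p D z / sl (p z) ^+ 3 + 1 / (u z * sl (p z))) ^+ 2 - 2 * eps)).
have dh z : a < z < b -> isd h z (k z * (sl (p z) / u z)).
  move=> zab; have zab' : a <= z <= b by lra.
  apply: isd_eq (isd_elH S zab) _.
  by rewrite -(hamilton_cst S aab zab') -/K /k; field; rewrite un0 ?sn0.
have dk z : a < z < b -> isd k z (h z * m z).
  by move=> zab; apply: isd_eq (el_flux S zab) _; rewrite /m /h; ring.
have ch : cont a b h by rewrite /h /elH; ct => z zab; rewrite ?expf_neq0 ?mulf_neq0 ?un0.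
have ck : cont a b k by rewrite /k; ct => z zab; rewrite mulf_neq0.
have cm : cont a b m by rewrite /m; ct => z zab; rewrite ?expf_neq0 ?mulf_neq0 ?un0.
have cL : cont a b (fun z => sl (p z) / u z + m z) by ct => z /un0.
have [L L0 HL] := cont_bounded cL.
have hy0 : h y = 0 by exact: nbhs_singleton hy.
have ky0 : k y = 0.
  have yab' : a <= y <= b by lra.
  have E1 : k y * (sl (p y) / u y) = 0.
    rewrite -(isd_derive1 (dh y yab)); apply: isd_derive1.
    apply: (@isd_near _ (fun=> 0)); last exact: isd_cst.
    by apply: filterS hy => z /esym.
  have nz : sl (p y) / u y != 0 by rewrite mulf_neq0// invr_neq0// un0.
  by move/eqP: E1; rewrite mulf_eq0 (negPf nz) orbF => /eqP.
have H : h x ^+ 2 + k x ^+ 2 <= 0.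
  apply: (@gronwall_le0 y x (fun z => h z ^+ 2 + k z ^+ 2)
    (fun z => 2 * h z * k z * (sl (p z) / u z + m z)) L); first by lra.
  - have c1 : cont y x h by apply: cont_sub ch; lra.
    have c2 : cont y x k by apply: cont_sub ck; lra.
    by apply: contD; exact: contX.
  - move=> z zyx; have zab : a < z < b by lra.
    have d1 := dh z zab; have d2 := dk z zab.
    by apply: isd_eq; [der|rewrite /=; ring].
  - move=> z zyx; have zab : a <= z <= b by lra.
    have := HL z zab; rewrite ler_norml => /andP[l1 l2].
    rewrite -subr_ge0; set w := sl (p z) / u z + m z in l1 l2 *.
    (* A sum of squares with nonnegative weights, because |w| <= L. *)
    have -> : L * (h z ^+ 2 + k z ^+ 2) - 2 * h z * k z * w =
      2^-1 * ((L - w) * (h z + k z) ^+ 2 + (L + w) * (h z - k z) ^+ 2) by field.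
    by rewrite mulr_ge0// addr_ge0// mulr_ge0 ?sqr_ge0//; lra.
  - by rewrite hy0 ky0 !expr0n addr0.
have h2 : h x ^+ 2 = 0.
  apply/le_anti; rewrite sqr_ge0 andbT; apply: le_trans H; by rewrite lerDl sqr_ge0.
by apply/eqP; rewrite -sqrf_eq0; apply/eqP.
Qed.

(** Since c cosh(1 / c) >= c, the value alpha is reached on [c_m, max(c_m, alpha)]; the root found
    there is at least c_m and, like every root, at most c_alpha. *)
Lemma larger_root_ge alpha cm ca : 0 < cm -> (forall c, 0 < c -> c * cosh (1 / c) = alpha -> c <= ca) ->
  cm * cosh (1 / cm) <= alpha -> cm <= ca.
Proof.
move=> cm0 hca hm.
have cmM : cm <= Num.max cm alpha by rewrite le_max lexx.
have M0 : 0 < Num.max cm alpha by exact: lt_le_trans cmM.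
have cf : cont cm (Num.max cm alpha) (fun c => c * cosh (1 / c)).
  apply: contM; first exact: cont_id.
  apply: (@cont_comp _ _ _ (fun c => 1 / c) (@cosh R)).
    by move=> x _; exact: cosh_continuous.
  apply: contM; first exact: cont_cst.
  by apply: contV; [move=> x /andP[x0 _]; rewrite gt_eqF//; exact: lt_le_trans x0|exact: cont_id].
have hM : alpha <= Num.max cm alpha * cosh (1 / Num.max cm alpha).
  apply: (@le_trans _ _ (Num.max cm alpha)); first by rewrite le_max lexx orbT.
  by rewrite ler_peMr ?(ltW M0)// cosh_ge1.
have [|c] := IVT cmM cf (v := alpha); first by rewrite ge_min le_max hm hM orbT.
rewrite in_itv/= => /andP[c1 c2] hc.
by apply: le_trans c1 (hca _ (lt_le_trans cm0 c1) hc).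
Qed.

Lemma ac_vcat c : 0 < c -> ac 0 1 (vcat c) (fun y => sinh (y / c)).
Proof.
move=> c0; have dv y : isd (vcat c) y (sinh (y / c)) by apply: isd_vcat; rewrite gt_eqF.
apply: C1_ac => [||y _]; [exact: is_derive_cont dv| |exact: dv].
apply: (@is_derive_cont _ _ _ _ (fun y => cosh (y / c) * (1 / c))) => y.
by apply: isd_sinh; apply: isd_eq; [der|rewrite mulr0 addr0].
Qed.

Lemma vcat_le_of_slope c u p x : 0 < c -> ac 0 1 u p -> u 1 = vcat c 1 ->
  (forall y, 0 <= y <= 1 -> p y <= sinh (y / c)) -> 0 <= x <= 1 -> vcat c x <= u x.
Proof.
move=> c0 au u1 hp /andP[x0 x1]; have av := ac_vcat c0.
have E1 := ac_sub_rint au x0 x1 (lexx 1); have E2 := ac_sub_rint av x0 x1 (lexx 1).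
have : rint x 1 p <= rint x 1 (fun y => sinh (y / c)).
  apply: rint_le; [apply: intg_sub (ac_intg au)|apply: intg_sub (ac_intg av)|] => //.
  by move=> y /andP[xy y1]; apply: hp; lra.
by rewrite -E1 -E2 u1; lra.
Qed.

Section Params.
Context alpha eps c tm.
Hypotheses (c0 : 0 < c) (vc : vcat c 1 = alpha) (tm01 : 0 < tm < 1)
  (htm : 2 * tm = 1 + expR (- (2 * tm))) (ctm : c^-1 <= tm) (e0 : 0 <= eps) (ec : 1 <= 4 * eps * c ^+ 2).

Let V x : R := sinh (x / c).

Let V_bnd x : 0 <= x <= 1 -> 0 <= V x <= V 1.
Proof.
move=> /andP[x0 x1]; rewrite /V sinh_ge0 ?divr_ge0 ?(ltW c0)//= sinh_le//.
by rewrite ler_pM2r// invr_gt0.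
Qed.

Let acV : ac 0 1 (vcat c) V. Proof. exact: ac_vcat. Qed.

Lemma catenary_below u u1 u2 : profile alpha u u1 u2 -> exists w w1 w2,
  [/\ profile alpha w w1 w2, energy eps w w1 w2 <= energy eps u u1 u2 &
    forall x, 0 <= x <= 1 -> 0 <= w1 x <= V x].
Proof.
move=> H; have [x1 [w [w1 [w2 [Hw /andP[x10 x11] le1 wV _]]]]] := catenary_replace H e0 c0 vc tm01 htm ctm.
have [||z [z1 [z2 [Hz le2 zV]]]] := nonneg_slope_replace Hw c0 ec e0 _ acV vc _.
- by move=> x _; exact: vcat_ge.
- by move=> x x01; split; [exact: wV|case/andP: (V_bnd x01)].
exists z, z1, z2; split => //; apply: le_trans le2 _; apply: le_trans le1.
rewrite lerDl; apply: rint_ge0 => x xx; rewrite mulr_ge0 ?(ltW (sl_gt0 _))//.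
by rewrite mulr_ge0 ?sqr_ge0//; apply/ltW/(prof_gt0 H); lra.
Qed.

Lemma half_minimiser : exists u u1 u2, [/\ profile alpha u u1 u2,
  forall x, 0 <= x <= 1 -> 0 <= u1 x <= V x &
  forall v v1 v2, profile alpha v v1 v2 -> energy eps u u1 u2 <= energy eps v v1 v2].
Proof.
have alpha0 : 0 < alpha by rewrite -vc; exact: lt_le_trans (vcat_ge _ c0).
(* The cylinder of radius alpha is a competitor; [catenary_below] turns it into a member of the
   constrained class, which is therefore nonempty. *)
have Hc : profile alpha (fun=> alpha) (fun=> 0) (fun=> 0).
  have a0 (z : R) : ac 0 1 (fun=> z) (fun=> 0).
    by apply: C1_ac => [||x _]; [exact: cont_cst|exact: cont_cst|exact: isd_cst].
  by split => //; rewrite expr0n; exact: intg_cst.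
have [|||u [u1 [u2 [[Hu uV] umin]]]] := @adm_min _ alpha eps c (V 1) V c0 e0.
- by move=> x /V_bnd/andP[].
- move=> u u1 au ua uV x x01; apply: le_trans (vcat_ge x c0) _.
  by apply: vcat_le_of_slope au _ _ x01 => //; [rewrite vc|move=> y /uV/andP[]].
- by have [w [w1 [w2 [Hw _ wV]]]] := catenary_below Hc; exists w, w1, w2.
exists u, u1, u2; split => // v v1 v2 Hv.
have [w [w1 [w2 [Hw le wV]]]] := catenary_below Hv.
exact: le_trans (umin _ _ _ (conj Hw wV)) le.
Qed.

Section Strict.
Context (u p D E : R -> R).
Let q := ELq u p D.
Hypotheses (S : ELsol eps 0 1 u p D E) (P : profile alpha u p q) (E0 : E 0 = 0)
  (pV : forall x, 0 <= x <= 1 -> 0 <= p x <= V x)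
  (umin : forall v v1 v2, profile alpha v v1 v2 -> energy eps u p q <= energy eps v v1 v2).

Lemma minimiser_slope_lt x : 0 < x < 1 -> p x < V x.
Proof.
have [x1 [w [w1 [w2 [Hw /andP[x10 x11] le1 _ wV]]]]] := catenary_replace P e0 c0 vc tm01 htm ctm.
move: x10; rewrite le_eqVlt => /predU1P[xE|x10]; first by rewrite xE; exact: wV.
exfalso; pose F x := (1 / (u x * sl (p x)) - q x / sl (p x) ^+ 3) ^+ 2 * u x * sl (p x).
have cu := el_u S; have cp := el_p S; have cq := el_q S; have cs := cont_sl cp.
have un0 z : 0 <= z <= 1 -> u z != 0 by move=> /(el_gt0 S)/gt_eqF ->.
have sn0 z : sl (p z) != 0 by exact: sl_neq0.
have cF : cont 0 x1 F.
  apply: (@cont_sub _ 0 1) => //; first exact: ltW.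
  by rewrite /F; ct => z z01; rewrite ?expf_neq0 ?mulf_neq0 ?un0.
(* Minimality against the replaced curve makes the Willmore energy on [0, x1] nonpositive. *)
have F0 z : 0 < z < x1 -> F z = 0.
  apply: cont_rint_eq0 cF _ _ z; last by have := umin Hw; move: le1; rewrite -/F; lra.
  move=> z zx; rewrite mulr_ge0 ?(ltW (sl_gt0 _))// mulr_ge0 ?sqr_ge0//.
  by apply/ltW/(el_gt0 S); lra.
have H0 z : 0 < z < x1 -> elH u p D z = 0.
  move=> zx; have := F0 z zx; rewrite /F => /eqP.
  have un : u z != 0 by apply: un0; lra.
  rewrite mulf_eq0 (negPf (sn0 z)) orbF mulf_eq0 (negPf un) orbF sqrf_eq0.
  by rewrite /elH => /eqP ->; rewrite mulr0.
pose y := x1 / 2.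
have y1 : 0 < y < x1 by rewrite /y; lra.
have y01 : 0 < y < 1 by lra.
have Hy : forall z, y <= z <= 1 -> elH u p D z = 0.
  by apply: elH_unique S y01 _; apply: filterS (near_oo y1) => z /H0.
(* H = 0 reads q = s^2 / u. *)
have q0 z : y <= z <= 1 -> 0 < q z.
  move=> zy; have /eqP := Hy z zy; rewrite /elH mulf_eq0 invr_eq0 pnatr_eq0/= subr_eq0 => /eqP Ez.
  have z01 : 0 <= z <= 1 by lra.
  have s0 := sl_gt0 (p z); have u0 := el_gt0 S z01.
  have -> : q z = q z / sl (p z) ^+ 3 * sl (p z) ^+ 3 by rewrite divfK// expf_neq0.
  by rewrite /q -Ez mulr_gt0 ?exprn_gt0// div1r invr_gt0 mulr_gt0.
have y1' : y < 1 by lra.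
have : p y < p 1.
  apply: derive_gt0_lt y1' _ _ _ => [z zy|z zy|].
  - by apply: (el_dp S); lra.
  - by apply: q0; lra.
  - by apply: cont_sub cp; lra.
have y02 : 0 <= y <= 1 by lra.
by rewrite (prof_d1 P); have := pV y02; lra.
Qed.

Lemma minimiser_gt_catenary x : 0 <= x < 1 -> vcat c x < u x.
Proof.
move=> /andP[x0 x1]; rewrite -subr_lt0.
have cn : c != 0 by rewrite gt_eqF.
have d z : x < z < 1 -> isd (fun z => vcat c z - u z) z (V z - p z).
  move=> zx; apply: isdD; first exact: isd_vcat.
  by apply: isdN; apply: (el_du S); lra.
have := derive_gt0_lt x1 d _ _; rewrite vc (prof_u1 P) subrr => H.
apply: H.
  by move=> z zx; rewrite subr_gt0; apply: minimiser_slope_lt; lra.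
have cx : cont x 1 u by apply: cont_sub (el_u S); lra.
by apply: contB => //; apply: cont_sub (ac_cont acV); lra.
Qed.

Lemma minimiser_slope_gt0 x : 0 < x < 1 -> 0 < p x.
Proof.
move=> x01; have x01' : 0 <= x <= 1 by lra.
rewrite lt_neqAle (andP (pV x01')).1 andbT eq_sym; apply/negP => /eqP px.
have z01 : 0 <= (0 : R) <= 1 by lra.
have p0 := prof_d0 P; have cu := el_u S; have cp := el_p S.
(* x is an interior minimum of u'. *)
have qx : q x = 0.
  have xi : x \in `]0, 1[ by rewrite in_itv.
  rewrite /q -(isd_derive1 (el_dp S x01)); apply: isd_derive1.
  apply: (@derive1_at_min _ p 0 1 x) => //.
    by move=> t; rewrite in_itv/= => t01; exact: isd_derivable (el_dp S t01).
  by move=> t; rewrite in_itv/= px => t01; have /pV/andP[] : 0 <= t <= 1 by lra.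
have u0 : 0 < u 0 by exact: (el_gt0 S).
have uc : c < u 0 by have := minimiser_gt_catenary (x := 0); rewrite /vcat mul0r cosh0 mulr1; apply; lra.
have ux : u 0 <= u x.
  have x0 : 0 <= x by lra.
  apply: derive_ge0_le x0 _ _ _ => [z zx|z zx|].
  - by apply: (el_du S); lra.
  - by have /andP[] : 0 <= p z <= V z by apply: pV; lra.
  - by apply: cont_sub cu; lra.
have e1 : 1 <= 4 * eps * u 0 ^+ 2.
  apply: (le_trans ec); rewrite ler_wpM2l ?mulr_ge0// lerXn2r ?nnegrE ?(ltW c0) ?(ltW u0) ?(ltW uc)//.
(* With f(z) = 1/z + 4 eps z, the Hamiltonian is -f(u) at x and u q^2 - f(u) at 0. Conservation
   gives f(u x) <= f(u 0), while f is increasing from u 0 on. *)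
have uE : u x = u 0.
  apply/eqP; rewrite eq_le ux andbT leNgt; apply/negP => lt1.
  have := recip_linear_lt u0 e1 lt1; have := hamilton_cst S z01 x01'.
  have un0 : u 0 != 0 by rewrite gt_eqF.
  have unx : u x != 0 by rewrite gt_eqF// (lt_le_trans u0).
  have -> : hamilton eps u p D E 0 = u 0 * q 0 ^+ 2 - 1 / u 0 - 4 * eps * u 0.
    by rewrite /hamilton -/q p0 sl0 E0; field.
  have -> : hamilton eps u p D E x = - (1 / u x) - 4 * eps * u x.
    by rewrite /hamilton -/q px qx sl0; field.
  have := mulr_ge0 (ltW u0) (sqr_ge0 (q 0)).
  lra.
have uK z : 0 <= z <= x -> u z = u 0.
  move=> zx; apply/le_anti/andP; split.
    rewrite -uE; have zx' : z <= x by lra.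
    apply: derive_ge0_le zx' _ _ _ => [t tx|t tx|].
    - by apply: (el_du S); lra.
    - by have /andP[] : 0 <= p t <= V t by apply: pV; lra.
    - by apply: cont_sub cu; lra.
  have z0 : 0 <= z by lra.
  apply: derive_ge0_le z0 _ _ _ => [t tx|t tx|].
  - by apply: (el_du S); lra.
  - by have /andP[] : 0 <= p t <= V t by apply: pV; lra.
  - by apply: cont_sub cu; lra.
(* Constancy of u propagates through the system: u', u'', D and E vanish on (0, x), and then E' = 0
   is the equation 4 eps u^2 = 1 of the stationary cylinder. *)
have chain f g (k : R) : (forall z, 0 < z < x -> f z = k) -> (forall z, 0 < z < x -> isd f z (g z)) ->
    forall z, 0 < z < x -> g z = 0.
  move=> fk df z zx; rewrite -(isd_derive1 (df z zx)); apply: isd_derive1.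
  apply: (@isd_near _ (fun=> k)); last exact: isd_cst.
  by apply: filterS (near_oo zx) => t /fk.
have pz : forall z, 0 < z < x -> p z = 0.
  by apply: (chain u p (u 0)) => z zx; [apply: uK; lra|apply: (el_du S); lra].
have qz : forall z, 0 < z < x -> q z = 0.
  by apply: (chain p q 0) => z zx; [exact: pz|apply: (el_dp S); lra].
have Dz z : 0 < z < x -> D z = 0.
  move=> zx; have /eqP := qz z zx; have un0 : u z != 0 by rewrite gt_eqF// (el_gt0 S)//; lra.
  have nz : sl (p z) ^+ 5 / (2 * u z) != 0.
    by rewrite mulf_neq0 ?expf_neq0 ?sl_neq0// invr_neq0// mulf_neq0.
  by rewrite /q /ELq -mulrA mulf_eq0 (negPf nz) orbF => /eqP.
have Ez z : 0 < z < x -> E z = 0.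
  move=> zx; have := chain D (fun z => lagP eps (u z) (p z) (q z) - E z) 0 Dz _ z zx.
  rewrite /lagP pz// qz// => H; apply/eqP; rewrite -oppr_eq0; apply/eqP; rewrite -[RHS]H; first by ring.
  by move=> t tx; rewrite -/(lagP _ _ _ _); apply: (el_dD S); lra.
have y1 : 0 < x / 2 < x by lra.
have un0 : u 0 != 0 by rewrite gt_eqF.
have := chain E (fun z => lagY eps (u z) (p z) (q z)) 0 Ez _ _ y1.
rewrite /lagY pz// qz// uK; last by lra.
rewrite sl0 mulr1 expr0n/= mul0r addr0 mulr1 => H.
have {}H : 4 * eps - (u 0) ^- 2 = 0 by apply: H => t tx; apply: (el_dE S); lra.
have : 4 * eps * u 0 ^+ 2 = 1.
  have -> : 4 * eps = (u 0) ^- 2 by lra.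
  by rewrite mulVf// expf_neq0.
have ui : 0 < u 0 ^- 2 by rewrite invr_gt0 exprn_gt0.
have ep : 0 < 4 * eps by lra.
have cu2 : c ^+ 2 < u 0 ^+ 2 by rewrite ltr_pXn2r ?nnegrE ?(ltW c0) ?(ltW u0).
have := ec; have : 4 * eps * c ^+ 2 < 4 * eps * u 0 ^+ 2 by rewrite ltr_pM2l.
lra.
Qed.

Lemma minimiser_lt_end x : 0 <= x < 1 -> u x < alpha.
Proof.
move=> /andP[x0 x1]; rewrite -(prof_u1 P).
apply: derive_gt0_lt x1 _ _ _ => [z zx|z zx|].
- by apply: (el_du S); lra.
- by apply: minimiser_slope_gt0; lra.
- by apply: cont_sub (el_u S); lra.
Qed.

End Strict.

Lemma smooth_minimiser : exists u p D E, [/\ ELsol eps 0 1 u p D E, p 0 = 0, E 0 = 0, p 1 = 0 & u 1 = alpha] /\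
  [/\ forall v v1 v2, profile alpha v v1 v2 -> energy eps u p (ELq u p D) <= energy eps v v1 v2,
     forall x, 0 < x < 1 -> 0 < p x < V x & forall x, 0 <= x < 1 -> vcat c x < u x < alpha].
Proof.
have [u [p [u2 [H pV umin]]]] := half_minimiser.
have uc x : 0 <= x <= 1 -> c <= u x.
  move=> x01; apply: le_trans (vcat_ge x c0) _.
  apply: vcat_le_of_slope (prof_ac0 H) _ _ x01 => //; first by rewrite vc (prof_u1 H).
  by move=> y /pV/andP[].
have [q [D [E [[P eE cD cE E0] [qE dp dD dE]]]]] := EL_system H c0 e0 uc umin.
have {}qE : q = ELq u p D by apply/funext => x; exact: qE.
rewrite {}qE in P eE dp dD dE.
have S : ELsol eps 0 1 u p D E.
  split => //; [exact: prof_cont H|exact: prof_cont1 H|exact: prof_gt0 H|exact: prof_isd H].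
have um v v1 v2 : profile alpha v v1 v2 -> energy eps u p (ELq u p D) <= energy eps v v1 v2.
  by rewrite eE; exact: umin.
exists u, p, D, E; split; split => //.
- exact: prof_d0 P.
- exact: prof_d1 P.
- exact: prof_u1 P.
- by move=> x x01; rewrite (minimiser_slope_gt0 S P E0 pV um)// (minimiser_slope_lt S P pV um).
- by move=> x x01; rewrite (minimiser_gt_catenary S P pV um)// (minimiser_lt_end S P E0 pV um).
Qed.

End Params.
End Minimiser.

Theorem theorem5p5 (R : realType) (alpha eps calpha cm : R) :
  (* c_m : the unique positive solution of 2/c = 1 + e^{-2/c} *)
  0 < cm -> 2 / cm = 1 + expR (- (2 / cm)) ->
  (* c_alpha : the larger positive solution of c cosh(1/c) = alpha *)
  0 < calpha -> calpha * cosh (1 / calpha) = alpha ->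
  (forall c : R, 0 < c -> c * cosh (1 / c) = alpha -> c <= calpha) ->
  (* alpha >= alpha_m, eps >= hat eps_alpha *)
  cm * cosh (1 / cm) <= alpha ->
  1 / (4 * calpha ^+ 2) <= eps ->
  exists (u u1 u2 : R -> R),
    (* u is a minimiser of H_eps in N_alpha *)
    inN alpha u u1 u2 /\
    (forall v v1 v2 : R -> R, inN alpha v v1 v2 ->
       (helfH eps u u1 u2 <= helfH eps v v1 v2)%E) /\
    (* 0 < u' < v_alpha' on (0,1) *)
    (forall x, 0 < x < 1 -> 0 < u1 x /\ u1 x < derive1 (vcat calpha) x) /\
    (* v_alpha < u < alpha on (-1,1) *)
    (forall x, -1 < x < 1 -> vcat calpha x < u x /\ u x < alpha) /\
    (* u in C^infty([-1,1]), i.e. u is the restriction of a smooth U *)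
    exists U : R -> R, smooth U /\
      (forall x, -1 <= x <= 1 -> U x = u x) /\
      let U1 := derive1 U in
      let U2 := derive1n 2 U in
      let Hf := fun x => Hexpr (U x) (U1 x) (U2 x) in
      let H1 := derive1 Hf in
      (* the Euler-Lagrange equation in (-1,1) *)
      (forall x, -1 < x < 1 ->
         1 / (U x * Num.sqrt (1 + U1 x ^+ 2)) *
           derive1 (fun y => U y / Num.sqrt (1 + U1 y ^+ 2) * H1 y) x
         + 2^-1 * Hf x *
           (U2 x / (Num.sqrt (1 + U1 x ^+ 2)) ^+ 3
            + 1 / (U x * Num.sqrt (1 + U1 x ^+ 2))) ^+ 2
         - 2 * eps * Hf x = 0) /\
      (* boundary conditions *)
      U (-1) = alpha /\ U 1 = alpha /\ U1 (-1) = 0 /\ U1 1 = 0 /\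
      (* first integral *)
      (exists c : R, forall x, -1 <= x <= 1 ->
         U x * U1 x * H1 x / (1 + U1 x ^+ 2)
         + U x * Hf x ^+ 2 / Num.sqrt (1 + U1 x ^+ 2)
         - Hf x / (1 + U1 x ^+ 2)
         - eps * U x / Num.sqrt (1 + U1 x ^+ 2) = c).
Proof.
move=> cm0 hcm ca0 hca hmax hm heps.
have cmca := larger_root_ge cm0 hmax hm.
have tm2 : 2 * cm^-1 = 1 + expR (- (2 * cm^-1)) by [].
have tm0 : 0 < cm^-1 by rewrite invr_gt0.
(* From 2 tm = 1 + exp(-2 tm) < 2. *)
have tm01 : 0 < cm^-1 < 1.
  rewrite tm0/=; have : expR (- (2 * cm^-1)) < 1 by rewrite -expR0 ltr_expR oppr_lt0 mulr_gt0.
  lra.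
have ctm : calpha^-1 <= cm^-1 by rewrite lef_pV2.
have c40 : 0 < 4 * calpha ^+ 2 by rewrite mulr_gt0// exprn_gt0.
have e0 : 0 <= eps by apply: le_trans heps; rewrite divr_ge0// ltW.
have ec : 1 <= 4 * eps * calpha ^+ 2 by move: heps; rewrite ler_pdivrMr//; lra.
have [u [p [D [E [[S p0 E0 p1 u1] [umin hp hu]]]]]] :=
  smooth_minimiser ca0 hca tm01 tm2 ctm e0 ec.
have T := ELsol_reflect S p0 E0.
have [U [smU [UE eqs]]] := ELsol_equations T.
exists (evenx u), (oddx p), (evenx (ELq u p D)); split; first exact: inN_reflect S p0 E0 p1 u1.
split.
  (* Each half of a competitor has at least the energy of the half minimiser, and both halves of the
     reflected minimiser attain it. *)
  move=> v v1 v2 Nv; rewrite (helfH_reflect S p0 E0 p1 u1) (helfH_halves eps Nv) lee_fin -mulrA.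
  rewrite ler_wpM2l ?pi_ge0//.
  have := umin _ _ _ (inN_right Nv); have := umin _ _ _ (inN_left Nv); lra.
split.
  move=> x x01; have x0 : 0 < x by lra.
  have -> : oddx p x = p x by rewrite /oddx ltNge (ltW x0).
  rewrite (isd_derive1 (isd_vcat x _)) ?gt_eqF//.
  exact/andP/hp.
split.
  move=> x x1; rewrite /evenx.
  have -> : vcat calpha x = vcat calpha `|x|.
    have [x0|x0] := leP 0 x; first by rewrite ger0_norm.
    by rewrite ltr0_norm// /vcat mulNr coshN.
  by apply/andP/hu; rewrite normr_ge0/= ltr_norml.
have b1 : -1 <= (1 : R) <= 1 by lra.
have bN1 : -1 <= (-1 : R) <= 1 by lra.
exists U; split => //; split; first by move=> x /UE[].
move: eqs => /= [eqs [c fi]]; split => //.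
have [-> ->] := UE 1 b1; have [-> ->] := UE (-1) bN1.
rewrite /evenx /oddx normrN normr1 ltr10 oppr_lt0 ltr01 opprK p1 oppr0.
by do 4 split => //; exists c.
Qed.
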